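(* Let $\alpha\in(0,1)$ and $\beta>0$ satisfy $3/4<\alpha^2\beta^2/(2\log2)<1$. Let $G_n$ be the $n$-dimensional hypercube with vertex set $\mathcal V_n=\{-1,1\}^n$ and edges between configurations differing in exactly one coordinate. Let $(E_x)_{x\in\mathcal V_n}$ be i.i.d. with $\mathbb P[-E_x/\sqrt n\ge u]=e^{-u^2/2}$, $u\ge0$, and $\tau_x=\exp(-\beta E_x)$. Let $X_n$ be the continuous-time Markov chain on $\mathcal V_n$ with $X_n(0)=(1,\dots,1)$ and jump rates $w_{xy}=n^{-1}\tau_x^{-1}$ for neighbours $x,y$ (i.e., the Bouchaud trap model with $a=0$, $\nu=1/n$). Put $t_w(n)=\exp(\alpha\beta^2n)$. Then for every $\theta>0$ and a.e. $\boldsymbol\tau$, \[\lim_{n\to\infty}\mathbb P[X_n(t_w(n))=X_n((1+\theta)t_w(n))\mid\boldsymbol\tau]=\mathrm{Asl}_\alpha\Big(\frac1{1+\theta}\Big).\]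
   Context: $\mathrm{Asl}_\alpha(u)=\frac{\sin\alpha\pi}{\pi}\int_0^u s^{\alpha-1}(1-s)^{-\alpha}ds$ is the generalised arcsine distribution function. *)

(* Defs.v *)
From HB Require Import structures.
From mathcomp Require Import all_boot all_order all_algebra.
From mathcomp Require Import all_classical all_reals all_analysis.
Set Implicit Arguments. Unset Strict Implicit. Unset Printing Implicit Defensive.
Import Order.TTheory GRing.Theory Num.Theory.
Import numFieldNormedType.Exports.
Local Open Scope classical_set_scope.
Local Open Scope ring_scope.

(* Hypercube vertices {-1,1}^n, coded as boolean functions (true = +1). *)
Definition hcube (n : nat) := {ffun 'I_n -> bool}.

Definition hc_ones (n : nat) : hcube n := [ffun _ => true].

Definition hc_adj (n : nat) (x y : hcube n) : bool :=
  #|[set i | x i != y i]| == 1%N.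

Definition Asl {R : realType} (alpha u : R) : R :=
  sin (alpha * pi) / pi *
  Rintegral lebesgue_measure `[0, u]
    (fun s => s `^ (alpha - 1) * (1 - s) `^ (- alpha)).

Definition btm_rate {R : realType} (n : nat) (tau : hcube n -> R)
  (x y : hcube n) : R :=
  if hc_adj x y then (n%:R)^-1 * (tau x)^-1 else 0.

Definition btm_gen {R : realType} (n : nat) (tau : hcube n -> R)
  (x y : hcube n) : R :=
  if x == y then - \sum_(z : hcube n | hc_adj x z) btm_rate tau x z
  else btm_rate tau x y.

Fixpoint kpow {R : realType} {V : finType} (Q : V -> V -> R) (k : nat)
  : V -> V -> R :=
  match k with
  | 0%N => fun x y => if x == y then 1 else 0
  | k'.+1 => fun x y => \sum_(z : V) kpow Q k' x z * Q z y
  end.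

Definition ctmc_kernel {R : realType} {V : finType} (Q : V -> V -> R)
  (t : R) (x y : V) : R :=
  limn (fun K : nat => \sum_(k < K) t ^+ k / (k`!)%:R * kpow Q k x y).

(* Quenched probability P[X(t) = X(s)] for the chain started at x0, t <= s,
   computed via the Markov property. *)
Definition ctmc_same_prob {R : realType} {V : finType} (Q : V -> V -> R)
  (x0 : V) (t s : R) : R :=
  \sum_(y : V) ctmc_kernel Q t x0 y * ctmc_kernel Q (s - t) y y.

Definition mutually_independent {d} {T : measurableType d} {R : realType}
  (P : probability T R) {I : finType} (X : I -> T -> R) : Prop :=
  forall B : I -> set R, (forall i, measurable (B i)) ->
    P (\bigcap_(i in [set: I]) (X i @^-1` B i)) =
    (\prod_(i : I) P (X i @^-1` B i))%E.

(* Main.v *)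
(** Measure time in units of [t_w], so that the chain leaves [y] at rate
[V_y = t_w / tau_y], and let [P_t] be its semigroup. Two facts are deterministic.
First, the resolvent of the chain at an integer [mu] is that of the simple random walk
killed at [y] with probability [a_y = mu / (mu + V_y)]; comparing with the Green function
of the lazy walk up to time [n^2], which mixes well before the killing, shows that
the killed walk stops at [y] with probability asymptotic to [a_y / sum a]. Second, the
same comparison started at [y] shows that returns to a deep trap are negligible, so
[P_theta(y,y)] may be replaced by [exp (- theta V_y)], uniformly in [y].

Since [P (V_y <= r)] is asymptotic to [exp (- kappa n) r^alpha] with
[kappa = alpha^2 beta^2 / 2 < ln 2], the law of large numbers gives almost surely, for every
integer [mu >= 2], the limit of the Laplace transform at [mu] of
[t |-> sum_y P_t(x,y) exp (- theta V_y)]. In the variable [u = e^-t] these are moments on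
[[0, 1]]; together with the one-sided Lipschitz bound of these functions they determine
the pointwise limit at [t = 1]. The limit is the normalised primitive of
[1 / (1 + x^(1/alpha))], and the substitution [s = x^(1/alpha) / (1 + x^(1/alpha))] turns it
into the generalised arcsine law by means of the reflection formula
[int_0^oo dx / (1 + x^(1/alpha)) = alpha pi / sin (alpha pi)]. *)

Require Import Defs.
From HB Require Import structures.
From mathcomp Require Import all_boot all_order all_algebra.
From mathcomp Require Import all_classical all_reals all_analysis.
From mathcomp Require Import measurable_realfun.
From mathcomp Require Import ring lra.
Import Order.TTheory GRing.Theory Num.Theory.
Import numFieldNormedType.Exports.
Local Open Scope classical_set_scope.
Local Open Scope ring_scope.
Set Implicit Arguments.
Unset Strict Implicit.
Unset Printing Implicit Defensive.

(** The two bounds on [kappa] have separate roles. By [kappa < ln 2], the number of sites with [V_y]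
    of order one grows like [exp ((ln 2 - kappa) n)], so averages over sites concentrate. The lower
    bound enters as [ln 2 < 2 * kappa]: the killing estimates must be uniform over all [2^n]
    starting points, and a pair of distinct deep traps near one of them has expected weight
    [exp (- 2 kappa n)] up to a polynomial factor. Resolvents keep the quenched part free of path
    space: only kernels on a finite set occur. Integer [mu] make the exceptional null sets
    countable, and [mu >= 2] leaves a factor [u^(mu - 1)] that vanishes at [u = 0], where [- ln u]
    explodes. The lazy walk has gap [1/n]; after [n^2] steps its relative distance to uniform is at
    most [2^n (1 - 1/n)^(n^2) <= (2/e)^n]. A return bound averaged over time passes to the fixed
    time [theta] because reversibility makes [P_t(y,y)] decrease in [t]. The reflection formula is
    obtained by expanding the integral into an alternating series and comparing it, through a Fejer
    kernel, with the arctangent case [alpha = 1/2]. *)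

Section KernelPowers.
Variables (R : realType) (V : finType).
Implicit Types (Q : V -> V -> R).

Definition delta (x y : V) : R := (x == y)%:R.

Lemma sum_delta_l (F : V -> R) x : \sum_z delta x z * F z = F x.
Proof.
rewrite (bigD1 x)//= /delta eqxx mul1r big1 ?addr0// => z.
by rewrite eq_sym => /negPf ->; rewrite mul0r.
Qed.

Lemma sum_delta_r (F : V -> R) y : \sum_z F z * delta z y = F y.
Proof.
rewrite -[RHS](sum_delta_l F); apply: eq_bigr => z _.
by rewrite mulrC /delta eq_sym.
Qed.

Lemma kpow0 Q x y : kpow Q 0 x y = delta x y.
Proof. by rewrite /= /delta; case: eqP. Qed.

Lemma kpowSr Q k x y : kpow Q k.+1 x y = \sum_z kpow Q k x z * Q z y.
Proof. by []. Qed.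

Lemma kpowSl Q k x y : kpow Q k.+1 x y = \sum_z Q x z * kpow Q k z y.
Proof.
elim: k x y => [|k IH] x y.
  rewrite kpowSr; under eq_bigr do rewrite kpow0.
  by under [RHS]eq_bigr do rewrite kpow0; rewrite sum_delta_l sum_delta_r.
rewrite kpowSr; under eq_bigr do rewrite IH mulr_suml.
rewrite exchange_big; apply: eq_bigr => z _.
by rewrite kpowSr mulr_sumr; apply: eq_bigr => w _; rewrite mulrA.
Qed.

Lemma kpow_ge0 Q k x y : (forall x y, 0 <= Q x y) -> 0 <= kpow Q k x y.
Proof.
move=> Q0; elim: k x y => [|k IH] x y; first by rewrite kpow0 /delta ler0n.
by rewrite kpowSr; apply: sumr_ge0 => z _; apply: mulr_ge0.
Qed.

Lemma kpow_stochastic Q k x :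
  (forall x, \sum_y Q x y = 1) -> \sum_y kpow Q k x y = 1.
Proof.
move=> Q1; elim: k x => [|k IH] x.
  by under eq_bigr do rewrite kpow0 -[delta _ _]mulr1; rewrite sum_delta_l.
under eq_bigr do rewrite kpowSl.
rewrite exchange_big /=; under eq_bigr do rewrite -mulr_sumr IH mulr1.
exact: Q1.
Qed.

End KernelPowers.

(** * Random walks on the hypercube and their Walsh diagonalisation *)

Section Hypercube.
Variable R : realType.
Implicit Types n : nat.

Definition srw n (x y : hcube n) : R := if hc_adj x y then n%:R^-1 else 0.

(** The simple walk is periodic. Holding with probability one half turns the eigenvalues
    [1 - 2 #|S| / n] into [1 - #|S| / n], which are nonnegative, so the powers converge to the
    uniform law. *)
Definition lazy_srw n (x y : hcube n) : R := (delta R x y + srw x y) / 2.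

Definition flip n (i : 'I_n) (x : hcube n) : hcube n :=
  [ffun j => if j == i then ~~ x j else x j].

Lemma flip_inj n (x : hcube n) : injective (fun i => flip i x).
Proof.
move=> i j /ffunP /(_ i); rewrite !ffunE eqxx.
by case: eqP => // _; case: (x i).
Qed.

Lemma hc_adjE n (x y : hcube n) :
  hc_adj x y = (#|[set i | x i != y i]%SET| == 1%N).
Proof.
rewrite /hc_adj; congr (_ == _); apply: eq_card => i.
by rewrite finset.in_set; apply/idP/idP => [|xyi]; rewrite inE.
Qed.

Lemma hc_adj_flip n (x : hcube n) i : hc_adj (flip i x) x.
Proof.
rewrite hc_adjE; apply/cards1P; exists i; apply/setP => j.
rewrite finset.in_set finset.in_set1 ffunE.
by case: (j =P i) => _; case: (x j).
Qed.

Lemma hc_adjP n (x y : hcube n) : hc_adj x y -> exists i, x = flip i y.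
Proof.
rewrite hc_adjE => /cards1P[i /setP Hi]; exists i.
apply/ffunP => j; rewrite ffunE.
have := Hi j; rewrite finset.in_set finset.in_set1 => <-.
by case: (x j); case: (y j).
Qed.

Lemma hc_adjC n (x y : hcube n) : hc_adj x y = hc_adj y x.
Proof.
rewrite !hc_adjE; congr (_ == _); apply: eq_card => i.
by rewrite !finset.in_set eq_sym.
Qed.

Lemma hc_adjxx n (x : hcube n) : hc_adj x x = false.
Proof.
rewrite hc_adjE (_ : [set i | _]%SET = finset.set0) ?cards0//.
by apply/setP => i; rewrite finset.in_set finset.in_set0 eqxx.
Qed.

Lemma hc_adj_sum n (x y : hcube n) :
  (hc_adj x y)%:R = \sum_(i < n) (x == flip i y)%:R :> R.
Proof.
case: (boolP (hc_adj x y)) => [/hc_adjP[i ->]|xy].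
  rewrite (bigD1 i)//= eqxx big1 ?addr0// => j ji.
  case: eqP => // /(@flip_inj _ y) ij; by rewrite ij eqxx in ji.
rewrite big1// => i _; case: eqP => // xyi.
by move: xy; rewrite xyi hc_adj_flip.
Qed.

Lemma srwC n (x y : hcube n) : srw x y = srw y x.
Proof. by rewrite /srw hc_adjC. Qed.

Lemma srw_ge0 n (x y : hcube n) : 0 <= srw x y.
Proof. by rewrite /srw; case: ifP => // _; rewrite invr_ge0. Qed.

Lemma sum_srw n (F : hcube n -> R) y :
  \sum_x F x * srw x y = n%:R^-1 * \sum_(i < n) F (flip i y).
Proof.
under eq_bigr => x _.
  rewrite (_ : srw x y = n%:R^-1 * (hc_adj x y)%:R); last first.
    by rewrite /srw; case: ifP; rewrite ?mulr1 ?mulr0.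
  rewrite hc_adj_sum mulrCA mulr_sumr.
  over.
rewrite -mulr_sumr exchange_big/=; congr (_ * _); apply: eq_bigr => i _.
exact: (sum_delta_r F).
Qed.

Lemma srw_stochastic n (x : hcube n) : (0 < n)%N -> \sum_y srw x y = 1.
Proof.
move=> n0; under eq_bigr do rewrite srwC -[srw _ _]mul1r.
rewrite (sum_srw (fun=> 1)) sumr_const card_ord mulVf//.
by rewrite pnatr_eq0 -lt0n.
Qed.

Lemma lazy_srw_ge0 n (x y : hcube n) : 0 <= lazy_srw x y.
Proof. by rewrite /lazy_srw divr_ge0// addr_ge0 ?srw_ge0// ler0n. Qed.

Lemma lazy_srw_stochastic n (x : hcube n) :
  (0 < n)%N -> \sum_y lazy_srw x y = 1.
Proof.
move=> n0; rewrite -mulr_suml big_split/= srw_stochastic//.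
under eq_bigr do rewrite -[delta _ _ _]mulr1.
by rewrite sum_delta_l -[1 + 1]/(2%:R) divff.
Qed.

(** The Walsh character indexed by [S]; these are common eigenvectors of [srw] and [lazy_srw]. *)
Definition hc_char n (S : {set 'I_n}) (x : hcube n) : R :=
  \prod_(i in S) (if x i then 1 else -1).

Lemma hc_char_norm n (S : {set 'I_n}) (x : hcube n) : `|hc_char S x| = 1.
Proof.
rewrite /hc_char normr_prod big1// => i _.
by case: ifP; rewrite ?normrN normr1.
Qed.

Lemma hc_char_flip n (S : {set 'I_n}) (x : hcube n) i :
  hc_char S (flip i x) = (if i \in S then -1 else 1) * hc_char S x.
Proof.
rewrite /hc_char; case: (boolP (i \in S)) => iS.
  rewrite (bigD1 i)//= [in RHS](bigD1 i)//= ffunE eqxx mulrA; congr (_ * _).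
    by case: (x i); rewrite /= ?mulr1 ?mulrN1 ?opprK ?mulN1r.
  by apply: eq_bigr => j /andP[_ /negPf ji]; rewrite ffunE ji.
rewrite mul1r; apply: eq_bigr => j jS; rewrite ffunE; case: eqP => // ji.
by rewrite -ji jS in iS.
Qed.

(** The sum over subsets factorises over coordinates as the product of [1 + x_i y_i] (with signs for
    booleans). A coordinate where [x] and [y] differ gives a zero factor; otherwise every factor is
    2. *)
Lemma hc_char_orth n (x y : hcube n) :
  \sum_(S : {set 'I_n}) hc_char S x * hc_char S y = 2 ^+ n * delta R x y.
Proof.
pose s (b : bool) : R := if b then 1 else -1.
have -> : \sum_(S : {set 'I_n}) hc_char S x * hc_char S y =
          \prod_(i < n) (s (x i) * s (y i) + 1).
  rewrite (bigA_distr _ _ (fun i => s (x i) * s (y i)) (fun=> 1)).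
  by apply: eq_bigr => S _; rewrite /hc_char -big_split/= big_mkcond.
rewrite /delta; case: eqP => [->|xy].
  rewrite (eq_bigr (fun=> 2)) => [|i _]; last first.
    by rewrite /s; case: (y _); rewrite ?mulrNN mulr1 -natr1.
  by rewrite mulr1 prodr_const card_ord.
have [i xyi] : exists i, x i != y i.
  apply/existsP; apply: contra_notT xy => /existsPn H; apply/ffunP => i.
  by apply/eqP; rewrite -[_ == _]negbK H.
rewrite mulr0 (bigD1 i)//= (_ : s _ * s _ + 1 = 0) ?mul0r//.
by move: xyi; rewrite /s; case: (x i); case: (y i) => //= _;
  rewrite ?mulr1 ?mul1r addNr.
Qed.

(** Flipping coordinate [i] changes the sign of the character exactly when [i] is in [S]; averaging
    over [i] and over the holding step gives the eigenvalue. *)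
Lemma hc_char_lazy n (S : {set 'I_n}) (y : hcube n) : (0 < n)%N ->
  \sum_x hc_char S x * lazy_srw x y = (1 - #|S|%:R / n%:R) * hc_char S y.
Proof.
move=> n0; have nR : n%:R != 0 :> R by rewrite pnatr_eq0 -lt0n.
under eq_bigr do rewrite /lazy_srw mulrA mulrDr.
rewrite -mulr_suml big_split/= sum_delta_r sum_srw.
under [X in _ + _ * X]eq_bigr do rewrite hc_char_flip.
rewrite -mulr_suml.
have -> : \sum_(i < n) (if i \in S then -1 else 1) = n%:R - 2 * #|S|%:R :> R.
  rewrite (eq_bigr (fun i => 1 - 2 * (i \in S)%:R)) => [|i _]; last first.
    by case: ifP => _; rewrite ?mulr1 ?mulr0; ring.
  rewrite sumrB sumr_const card_ord -mulr_sumr; congr (_ - 2 * _).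
  by rewrite -natr_sum -sum1_card; congr _%:R; rewrite [RHS]big_mkcond.
by field.
Qed.

Lemma kpow_lazyE n k (x y : hcube n) : (0 < n)%N ->
  kpow (@lazy_srw n) k x y = 2 ^- n *
    \sum_(S : {set 'I_n}) (1 - #|S|%:R / n%:R) ^+ k * (hc_char S x * hc_char S y).
Proof.
move=> n0; elim: k x y => [|k IH] x y.
  under eq_bigr do rewrite expr0 mul1r.
  by rewrite kpow0 hc_char_orth mulKf// expf_neq0.
rewrite kpowSr; under eq_bigr => z _ do rewrite IH -(mulrA (2 ^- n)) mulr_suml.
rewrite -mulr_sumr exchange_big/=; congr (_ * _); apply: eq_bigr => S _.
rewrite (eq_bigr (fun z => ((1 - #|S|%:R / n%:R) ^+ k * hc_char S x) *
   (hc_char S z * lazy_srw z y))); last first.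
  by move=> z _; ring.
by rewrite -mulr_sumr hc_char_lazy// exprSr; ring.
Qed.

End Hypercube.

(** * Green function of the lazy walk up to a finite time *)

Section Green.
Variable R : realType.
Implicit Types n N : nat.

(** With [S] the simple and [L] the lazy kernel, [I - L = (I - S) / 2], so the factor one half makes
    this a truncation of the inverse of [I - S]: half of the lazy steps do not move. *)
Definition green n N (x y : hcube n) : R :=
  2^-1 * \sum_(k < N) kpow (@lazy_srw R n) k x y.

(* The entries of srw * green: expected visits at positive times. *)
Definition green1 n N (x y : hcube n) : R :=
  \sum_(k < N) (kpow (@lazy_srw R n) k.+1 x y - 2^-1 * kpow (@lazy_srw R n) k x y).

(** In matrix form [(I - S) G = I - L^N], a telescoping sum. The defect [L^N] is nearly uniform once
    the walk has mixed, which is what makes the truncated [G] usable. *)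
Lemma green_green1 n N (x y : hcube n) :
  green N x y - green1 N x y = delta R x y - kpow (@lazy_srw R n) N x y.
Proof.
elim: N => [|N IH]; first by rewrite /green /green1 !big_ord0 kpow0 mulr0 !subrr.
have -> : green N.+1 x y = green N x y + 2^-1 * kpow (@lazy_srw R n) N x y.
  by rewrite /green big_ord_recr/= mulrDr.
rewrite {1}/green1 big_ord_recr/= -/(green1 N x y).
move: IH => /eqP; rewrite subr_eq => /eqP ->; by field.
Qed.

Lemma srw_green n N (x y : hcube n) :
  \sum_z srw R x z * green N z y = green1 N x y.
Proof.
have srwE z : srw R x z = 2 * lazy_srw R x z - delta R x z.
  by rewrite /lazy_srw; field.
under eq_bigr => z _ do rewrite srwE mulrBl.
rewrite sumrB sum_delta_l /green /green1.
under eq_bigr => z _ do rewrite mulrA (mulrAC 2) mulfV// mul1r mulr_sumr.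
rewrite exchange_big/= sumrB mulr_sumr; congr (_ - _).
by apply: eq_bigr => k _; rewrite -kpowSl.
Qed.

Lemma green_ge0 n N (x y : hcube n) : 0 <= green N x y.
Proof.
apply: mulr_ge0; rewrite ?invr_ge0//; apply: sumr_ge0 => k _.
by apply: kpow_ge0; exact: lazy_srw_ge0.
Qed.

Lemma green1_ge0 n N (x y : hcube n) : 0 <= green1 N x y.
Proof.
rewrite -srw_green; apply: sumr_ge0 => z _.
by rewrite mulr_ge0 ?srw_ge0 ?green_ge0.
Qed.

Lemma sum_green1 n N (x : hcube n) : (0 < n)%N ->
  \sum_y green1 N x y = N%:R / 2.
Proof.
move=> n0; rewrite exchange_big/=.
under eq_bigr => k _ do rewrite sumrB -mulr_sumr.
have stoch := fun x => lazy_srw_stochastic R x n0.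
rewrite (eq_bigr (fun=> 2^-1)) => [|k _]; last first.
  by rewrite (kpow_stochastic k.+1)// kpow_stochastic//; field.
by rewrite sumr_const card_ord mulr_natl.
Qed.

Lemma sum_card_set n :
  \sum_(S : {set 'I_n}) #|S|%:R = 2 ^+ n * n%:R / 2 :> R.
Proof.
have E : \sum_(S : {set 'I_n}) #|S|%:R =
    \sum_(S : {set 'I_n}) (n%:R - #|S|%:R) :> R.
  rewrite (reindex_inj (@finset.setC_inj _))/=; apply: eq_bigr => S _.
  apply/eqP; rewrite eq_sym subr_eq -natrD addnC cardsC card_ord//.
have : \sum_(S : {set 'I_n}) #|S|%:R + \sum_(S : {set 'I_n}) #|S|%:R =
    2 ^+ n * n%:R :> R.
  rewrite [in X in _ + X]E -big_split/= (eq_bigr (fun=> n%:R)) => [|S _].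
    rewrite sumr_const -[#|_|]/#|{: {set 'I_n}}| -cardsT -powersetT.
    by rewrite card_powerset cardsT card_ord -[LHS]mulr_natl natrX.
  by rewrite addrCA subrr addr0.
by move=> <-; field.
Qed.

(** Grouping the subsets by cardinality [k], the absorption identity
    [C(n,k) / (k+1) = C(n+1,k+1) / (n+1)] leaves a full binomial sum without its first term. *)
Lemma sum_inv_card_set n :
  \sum_(S : {set 'I_n}) (#|S|.+1%:R)^-1 = (2 ^+ n.+1 - 1) / n.+1%:R :> R.
Proof.
rewrite (partition_big (fun S : {set 'I_n} => inord #|S| : 'I_n.+1) xpredT)//=.
have E (k : 'I_n.+1) :
    \sum_(S : {set 'I_n} | inord #|S| == k) (#|S|.+1%:R)^-1 =
    'C(n.+1, k.+1)%:R / n.+1%:R :> R.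
  rewrite (eq_big (fun S : {set 'I_n} => #|S| == k) (fun=> k.+1%:R^-1)).
  - rewrite sumr_const.
    have -> : #|[pred S : {set 'I_n} | #|S| == k]| = 'C(n, k).
      have := card_draws 'I_n k; rewrite card_ord => <-.
      by apply: eq_card => S; rewrite finset.in_set.
    have := mul_bin_diag n.+1 k => /= /(congr1 (fun m => m%:R : R)).
    rewrite !natrM => H; apply: (mulfI (_ : n.+1%:R != 0)); first by rewrite pnatr_eq0.
    rewrite -[_ *+ 'C(_,_)]mulr_natl mulrA H mulrAC mulfV ?mul1r ?pnatr_eq0//.
    by rewrite mulrCA mulfV ?mulr1 ?pnatr_eq0.
  - move=> S; rewrite -val_eqE/= inordK// ltnS.
    by rewrite -[X in (_ <= X)%N]card_ord max_card.
  - move=> S; rewrite -val_eqE/= inordK ?ltnS => [/eqP->//|].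
    by rewrite -[X in (_ <= X)%N]card_ord max_card.
rewrite (eq_bigr _ (fun k _ => E k)) -mulr_suml; congr (_ / _).
have := exprDn (1 : R) 1 n.+1; rewrite big_ord_recl/= bin0 -[1 + 1]/(2%:R) => ->.
rewrite !expr1n mulr1 mulr1n [1 + _]addrC addrK; apply: eq_bigr => k _.
by rewrite /bump/= !expr1n mulr1.
Qed.

Lemma geom_sum_le (q : R) N : 0 <= q < 1 -> \sum_(k < N) q ^+ k <= (1 - q)^-1.
Proof.
move=> /andP[q0 q1]; rewrite -[leRHS]div1r ler_pdivlMr ?subr_gt0//.
have := subrX1 q N; rewrite -opprB -[in RHS]opprB mulNr => /oppr_inj H.
by rewrite mulrC -H gerBl exprn_ge0.
Qed.

Lemma green1E n N (x y : hcube n) : (0 < n)%N ->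
  green1 N x y = 2 ^- n * \sum_(S : {set 'I_n})
     ((2^-1 - #|S|%:R / n%:R) * \sum_(k < N) (1 - #|S|%:R / n%:R) ^+ k) *
     (hc_char R S x * hc_char R S y).
Proof.
move=> n0; rewrite /green1 (eq_bigr (fun k : 'I_N => \sum_(S : {set 'I_n}) 2 ^- n *
    ((2^-1 - #|S|%:R / n%:R) * (1 - #|S|%:R / n%:R) ^+ k *
     (hc_char R S x * hc_char R S y)))) => [|k _].
  rewrite exchange_big/= mulr_sumr; apply: eq_bigr => S _.
  by rewrite -mulr_sumr -mulr_suml -mulr_sumr.
rewrite !kpow_lazyE// mulrCA -mulrBr mulr_sumr -sumrB mulr_sumr.
apply: eq_bigr => S _; congr (_ * _); rewrite exprS; field; rewrite ?andbT.
by rewrite pnatr_eq0 -lt0n.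
Qed.

(** In the spectral formula the empty set gives the uniform part [2^-n N / 2]. For [S] of size
    [t > 0] the geometric sum is at most [n / t], leaving [|n - 2t| / (2t)]. As [t] is mostly within
    order [sqrt n] of [n / 2], the average over [S] is of order [1 / sqrt n]. *)
Lemma green1_le n N (x y : hcube n) : (0 < n)%N ->
  green1 N x y <= 2 ^- n * (N%:R / 2) + 3 / Num.sqrt n%:R.
Proof.
move=> n0; rewrite green1E//.
have nR : 0 < n%:R :> R by rewrite ltr0n.
have sn : 0 < Num.sqrt n%:R :> R by rewrite sqrtr_gt0.
have sn2 : Num.sqrt n%:R * Num.sqrt n%:R = n%:R :> R.
  by rewrite -expr2 sqr_sqrtr// ltW.
have cardn (S : {set 'I_n}) : #|S|%:R <= n%:R :> R.
  by rewrite ler_nat -[X in (_ <= X)%N]card_ord max_card.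
set s := Num.sqrt _ in sn sn2 *.
(* With [s = sqrt n], this is [(a^2 / s + s) / 2] divided by [t + 1], where [a = |n - 2t|]: an upper
   bound of [a / (t + 1)] by the arithmetic-geometric inequality. Writing
   [n - 2t = (n + 2) - 2 (t + 1)] splits it into sums over [S] with closed forms. *)
pose w (S : {set 'I_n}) : R := 2^-1 *
   (s^-1 * (4 * #|S|.+1%:R - 4 * (n%:R + 2) + (n%:R + 2) ^+ 2 * (#|S|.+1%:R)^-1)
   + s * (#|S|.+1%:R)^-1).
have w0 S : 0 <= w S.
  apply: mulr_ge0; rewrite ?invr_ge0//; apply: addr_ge0; last first.
    by rewrite mulr_ge0 ?invr_ge0// ltW.
  apply: mulr_ge0; first by rewrite invr_ge0 ltW.
  rewrite (_ : _ + _ = (n%:R + 2 - 2 * #|S|.+1%:R) ^+ 2 / #|S|.+1%:R).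
    by rewrite divr_ge0 ?sqr_ge0.
  by field; rewrite nat1r pnatr_eq0.
have term (S : {set 'I_n}) :
    ((2^-1 - #|S|%:R / n%:R) * \sum_(k < N) (1 - #|S|%:R / n%:R) ^+ k) *
     (hc_char R S x * hc_char R S y) <= (S == finset.set0)%:R * (N%:R / 2) + w S.
  apply: le_trans (ler_norm _) _.
  rewrite !normrM !hc_char_norm !mulr1.
  case: eqP => [->|/eqP S0].
    rewrite mul1r cards0 mul0r !subr0 (eq_bigr (fun=> 1)) => [|k _]; last by rewrite expr1n.
    rewrite sumr_const card_ord ger0_norm ?invr_ge0// ger0_norm// mulrC.
    by rewrite lerDl.
  have S1 : 1 <= #|S|%:R :> R by rewrite -[1]/(1%:R) ler_nat card_gt0.
  rewrite mul0r add0r; set t : R := #|S|%:R in S1 *.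
  have tn : t <= n%:R by exact: cardn.
  have q01 : 0 <= 1 - t / n%:R < 1.
    rewrite subr_ge0 ler_pdivrMr// mul1r tn/= ltrBlDr ltrDl divr_gt0//.
    exact: lt_le_trans S1.
  rewrite [X in _ * X]ger0_norm; last first.
    by apply: sumr_ge0 => k _; rewrite exprn_ge0//; case/andP: q01.
  apply: (@le_trans _ _ (`|2^-1 - t / n%:R| * (1 - (1 - t / n%:R))^-1)).
    by apply: ler_wpM2l => //; exact: geom_sum_le.
  have tg0 : 0 < t by exact: lt_le_trans S1.
  have -> : `|2^-1 - t / n%:R| * (1 - (1 - t / n%:R))^-1 = `|n%:R - 2 * t| / (2 * t).
    rewrite opprB addrCA subrr addr0 invf_div.
    rewrite (_ : 2^-1 - t / n%:R = (n%:R - 2 * t) / (2 * n%:R)).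
      rewrite normrM [X in _ * X * _]gtr0_norm ?invr_gt0 ?mulr_gt0//.
      by field; rewrite !gt_eqF.
    by field; rewrite gt_eqF.
  (* Since [t >= 1], [2t >= t + 1]; the denominator [t + 1] is the one that [sum_inv_card_set] can
     sum. *)
  apply: (@le_trans _ _ (`|n%:R - 2 * t| / (t + 1))).
    rewrite ler_wpM2l// lef_pV2 ?posrE ?mulr_gt0 ?addr_gt0//.
    by rewrite mulr_natl mulr2n lerD2l.
  have Sn : #|S|.+1%:R = t + 1 :> R by rewrite -natr1.
  rewrite /w Sn.
  set a := `|_|; have a2 : a ^+ 2 = (n%:R - 2 * t) ^+ 2 by rewrite real_normK ?num_real.
  have t1 : 0 < t + 1 by rewrite addr_gt0.
  rewrite ler_pdivrMr//.
  have -> : 2^-1 * (s^-1 * (4 * (t + 1) - 4 * (n%:R + 2) + (n%:R + 2) ^+ 2 / (t + 1)) +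
     s / (t + 1)) * (t + 1) = 2^-1 * (s^-1 * (n%:R - 2 * t) ^+ 2 + s).
    by field; rewrite !gt_eqF.
  rewrite -a2 -subr_ge0.
  rewrite (_ : _ - _ = 2^-1 * s^-1 * (a - s) ^+ 2); last by field; rewrite gt_eqF.
  by rewrite mulr_ge0 ?sqr_ge0// mulr_ge0 ?invr_ge0// ltW.
apply: (le_trans (ler_wpM2l _ (ler_sum _ (fun S _ => term S)))).
  by rewrite invr_ge0 exprn_ge0.
rewrite big_split/= mulrDr -mulr_suml; apply: lerD.
  rewrite (bigD1 finset.set0)//= eqxx big1 ?addr0 ?mul1r//.
  by move=> S /negPf ->.
have pw : 0 < 2 ^+ n :> R by rewrite exprn_gt0.
rewrite mulrC ler_pdivrMr//.
rewrite /w -mulr_sumr big_split/= -!mulr_sumr big_split/= sumrB -!mulr_sumr.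
rewrite sum_inv_card_set sumr_const.
have -> : #|{: {set 'I_n}}| = (2 ^ n)%N.
  by rewrite -cardsT -powersetT card_powerset cardsT card_ord.
have -> : \sum_(S : {set 'I_n}) #|S|.+1%:R = 2 ^+ n * n%:R / 2 + 2 ^+ n :> R.
  under eq_bigr do rewrite -natr1.
  rewrite big_split/= sum_card_set sumr_const; congr (_ + _).
  by rewrite -cardsT -powersetT card_powerset cardsT card_ord natrX.
rewrite -[_ *+ (2 ^ n)]mulr_natl natrX -[n.+1%:R]natr1 (exprS 2 n).
set P := 2 ^+ n in pw *; set m : R := n%:R in nR sn2 *.
have m1 : 0 < m + 1 by rewrite addr_gt0.
have sm : s^-1 * m = s by rewrite -sn2; field; rewrite gt_eqF.
have m1' : 1 <= m by rewrite -[1]/(1%:R) ler_nat.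
have I : (m + 1)^-1 <= m^-1 by rewrite lef_pV2 ?posrE// lerDl.
apply: (@le_trans _ _ (2^-1 * (s^-1 * (P * 4) + s * (2 * P / m)))); last first.
  rewrite -{2}sm le_eqVlt; apply/orP; left; apply/eqP; field; rewrite !gt_eqF//.
apply: ler_wpM2l; first by rewrite invr_ge0.
apply: lerD; last first.
  apply: ler_wpM2l; first exact: ltW.
  apply: ler_pM => //; rewrite ?invr_ge0 ?(ltW m1)//.
    have : 1 <= P by rewrite exprn_ege1// ler1n.
    by lra.
  by rewrite gerBl.
apply: ler_wpM2l; first by rewrite invr_ge0 ltW.
apply: (@le_trans _ _ (4 * (P * m / 2 + P) - 4 * (P * (m + 2)) +
    (m + 2) ^+ 2 * (2 * P / (m + 1)))).
  rewrite lerD2l; apply: ler_wpM2l; first by rewrite sqr_ge0.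
  by rewrite ler_wpM2r ?invr_ge0 ?(ltW m1)// gerBl.
rewrite (_ : _ + _ = P * (2 * (m + 2) / (m + 1))); last by field; rewrite gt_eqF.
apply: ler_wpM2l; first exact: ltW.
by rewrite ler_pdivrMr//; lra.
Qed.

(** The empty set contributes exactly [2^-n]; each of the other characters, fewer than [2^n], has an
    eigenvalue in [[0, 1 - 1/n]]. *)
Lemma kpow_lazy_uniform n N (x y : hcube n) : (0 < n)%N ->
  `|kpow (@lazy_srw R n) N x y - 2 ^- n| <=
  2 ^- n * (2 ^+ n * (1 - n%:R^-1) ^+ N).
Proof.
move=> n0; rewrite kpow_lazyE//.
have nR : 0 < n%:R :> R by rewrite ltr0n.
have cardn (S : {set 'I_n}) : #|S|%:R <= n%:R :> R.
  by rewrite ler_nat -[X in (_ <= X)%N]card_ord max_card.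
rewrite (bigD1 finset.set0)//= cards0 mul0r subr0 expr1n mul1r.
rewrite /hc_char !big_set0 mulr1 mulrDr mulr1 addrC addKr normrM.
rewrite ger0_norm ?invr_ge0 ?exprn_ge0//; apply: ler_wpM2l.
  by rewrite invr_ge0 exprn_ge0.
apply: le_trans (ler_norm_sum _ _ _) _.
apply: (@le_trans _ _ (\sum_(S : {set 'I_n} | S != finset.set0)
   (1 - n%:R^-1) ^+ N)).
  apply: ler_sum => S S0; rewrite !normrM !hc_char_norm !mulr1 normrX.
  have S1 : 1 <= #|S|%:R :> R by rewrite -[1]/(1%:R) ler_nat card_gt0.
  rewrite ger0_norm ?subr_ge0 ?ler_pdivrMr ?mul1r//.
  rewrite lerXn2r ?nnegrE ?subr_ge0 ?ler_pdivrMr ?mul1r//.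
    by rewrite invf_le1// -[1]/(1%:R) ler_nat.
  by rewrite lerD2l lerN2 -[leLHS]mul1r ler_wpM2r// invr_ge0 ltW.
rewrite sumr_const -[leLHS]mulr_natl ler_wpM2r//.
  by rewrite exprn_ge0// subr_ge0 invf_le1// -[1]/(1%:R) ler_nat.
rewrite -natrX ler_nat.
have -> : (2 ^ n)%N = #|{: {set 'I_n}}|.
  by rewrite -cardsT -powersetT card_powerset cardsT card_ord.
exact: max_card.
Qed.

End Green.

(** * Differentiation rules for real functions *)

Section Calculus.
Variable R : realType.
Implicit Types (f g : R -> R) (x a b : R).

Lemma derive_add f g x a b : is_derive x 1 f a -> is_derive x 1 g b ->
  is_derive x 1 (fun t => f t + g t) (a + b).
Proof. by move=> fa gb; apply: (is_deriveD fa gb). Qed.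

Lemma derive_mul f g x a b : is_derive x 1 f a -> is_derive x 1 g b ->
  is_derive x 1 (fun t => f t * g t) (a * g x + f x * b).
Proof.
move=> fa gb; apply: is_derive_eq.
by rewrite addrC /GRing.scale/= [in LHS](mulrC (g x)).
Qed.

Lemma derive_mulr f x a (c : R) : is_derive x 1 f a ->
  is_derive x 1 (fun t => f t * c) (a * c).
Proof.
move=> fa; have := derive_mul fa (is_derive_cst c x 1).
by rewrite mulr0 addr0.
Qed.

Lemma derive_mull f x a (c : R) : is_derive x 1 f a ->
  is_derive x 1 (fun t => c * f t) (c * a).
Proof.
move=> fa; under eq_fun do rewrite mulrC.
by rewrite mulrC; exact: derive_mulr.
Qed.

Lemma derive_exprn (n : nat) x :
  is_derive x 1 (fun t => t ^+ n.+1) (n.+1%:R * x ^+ n).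
Proof.
elim: n => [|n IH].
  by under eq_fun do rewrite expr1; rewrite expr0 mulr1; exact: is_derive_id.
under eq_fun do rewrite exprS.
apply: is_derive_eq (derive_mul (is_derive_id x 1) IH) _.
by rewrite -(natr1 n.+1) exprS; ring.
Qed.

Lemma derive_sum (I : finType) (h : I -> R -> R) (dh : I -> R) x :
  (forall i, is_derive x 1 (h i) (dh i)) ->
  is_derive x 1 (fun t => \sum_i h i t) (\sum_i dh i).
Proof.
move=> hd; rewrite (_ : (fun t => _) = \sum_i h i); last first.
  by apply/funext => t; rewrite fct_sumE.
by elim/big_ind2 : _ => // [|? ? ? ?]; [exact: is_derive_cst|exact: is_deriveD].
Qed.

Lemma derive_reflect f (t x a : R) : is_derive (t - x) 1 f a ->
  is_derive x 1 (fun s => f (t - s)) (- a).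
Proof.
move=> fa; rewrite -mulrN1.
have gd : is_derive x 1 (fun s => t - s) (-1 : R).
  have := derive_add (is_derive_cst t x 1) (is_deriveNid x (1 : R)).
  by rewrite add0r.
exact: (@is_derive1_comp R f (fun s => t - s) x a (-1) fa gd).
Qed.

Lemma derive_scale f (c x a : R) : is_derive (c * x) 1 f a ->
  is_derive x 1 (fun s => f (c * s)) (c * a).
Proof.
move=> fa; rewrite mulrC.
have gd : is_derive x 1 (fun s => c * s) c.
  by have := derive_mull c (is_derive_id x (1 : R)); rewrite mulr1.
exact: (@is_derive1_comp R f (fun s => c * s) x a c fa gd).
Qed.

Lemma derive_expRM (c x : R) :
  is_derive x 1 (fun s => expR (c * s)) (c * expR (c * x)).
Proof. exact: derive_scale. Qed.

Lemma is_derive_continuous_at f x a : is_derive x 1 f a -> {for x, continuous f}.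
Proof.
by move=> [fx _]; apply: differentiable_continuous; exact/derivable1_diffP.
Qed.

Lemma is_derive_continuous f (df : R -> R) :
  (forall x, is_derive x 1 f (df x)) -> continuous f.
Proof. by move=> fd x; exact: is_derive_continuous_at (fd x). Qed.

Lemma derive_ge0_homo f (df : R -> R) (a : R) :
  (forall x, is_derive x 1 f (df x)) -> (forall x, a <= x -> 0 <= df x) ->
  forall x y, a <= x -> x <= y -> f x <= f y.
Proof.
move=> fd df0 x y ax xy.
apply: (@ger0_derive1_le_cc _ f x y) => //.
- move=> z; rewrite in_itv/= => /andP[xz _]; rewrite derive1E.
  by case: (fd z) => _ ->; apply: df0; rewrite (le_trans ax)// ltW.
- by apply: continuous_subspaceT; exact: is_derive_continuous fd.
- by rewrite in_itv/= lexx.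
- by rewrite in_itv/= lexx andbT.
Qed.

Lemma cvg_sumr (I : finType) (T : Type) (F : set_system T) {FF : Filter F}
  (f : I -> T -> R) (l : I -> R) : (forall i, f i t @[t --> F] --> l i) ->
  \sum_i f i t @[t --> F] --> \sum_i l i.
Proof. by move=> fl; apply: (cvg_big add_continuous) => i _; exact: fl. Qed.

End Calculus.

(** * The matrix exponential of a generator: forward and backward equations, positivity, monotone
    diagonal *)

Section Semigroup.
Variables (R : realType) (V : finType).
Implicit Types (Q : V -> V -> R) (x y z : V) (t : R).

Lemma kpow_bound Q k x y :
  `|kpow Q k x y| <= (\sum_x \sum_y `|Q x y|) ^+ k.
Proof.
set C := \sum_x _; elim: k x y => [|k IH] x y.
  by rewrite kpow0 expr0 /delta; case: eqP; rewrite ?normr1 ?normr0.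
rewrite kpowSr; apply: le_trans (ler_norm_sum _ _ _) _.
apply: (@le_trans _ _ (\sum_z C ^+ k * `|Q z y|)).
  by apply: ler_sum => z _; rewrite normrM ler_wpM2r.
rewrite -mulr_sumr exprSr; apply: ler_wpM2l.
  by rewrite exprn_ge0// sumr_ge0// => i _; rewrite sumr_ge0.
apply: ler_sum => z _; rewrite (bigD1 y)//= lerDl.
by rewrite sumr_ge0.
Qed.

Definition exp_coef Q x y (k : nat) : R := kpow Q k x y / k`!%:R.

Lemma ctmc_kernelE Q t x y :
  ctmc_kernel Q t x y = limn (pseries (exp_coef Q x y) t).
Proof.
rewrite /ctmc_kernel; congr (lim (_ @ \oo)); apply/funext => K.
rewrite /pseries/series/= big_mkord; apply: eq_bigr => k _.
by rewrite /exp_coef mulrAC [RHS]mulrAC [t ^+ k * _]mulrC.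
Qed.

(** Each formal derivative of the exponential series shifts the powers of [Q] by one. Termwise
    differentiation asks for convergence of the series and of its first two derivatives, hence a
    general shift [j]. *)
Lemma is_cvg_pseries_shift Q (j : nat) x y t :
  cvgn (pseries (fun k => kpow Q (k + j) x y / k`!%:R) t).
Proof.
set C := \sum_x \sum_y `|Q x y|.
have C0 : 0 <= C by rewrite sumr_ge0// => i _; rewrite sumr_ge0.
apply: normed_cvg; rewrite /=.
apply: (@series_le_cvg _ _ (fun k => C ^+ j * exp_coeff (C * `|t|) k)).
- by move=> k /=.
- by move=> k; rewrite mulr_ge0 ?exprn_ge0// exp_coeff_ge0// mulr_ge0.
- move=> k /=; rewrite normrM normrM normrX normfV normr_nat /exp_coeff/= exprMn.
  rewrite !mulrA -exprD addnC mulrAC ler_wpM2r ?invr_ge0//.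
  by rewrite ler_wpM2r ?exprn_ge0// kpow_bound.
- have -> : (fun k => C ^+ j * exp_coeff (C * `|t|) k) =
      C ^+ j *: exp_coeff (C * `|t|) by [].
  exact/is_cvg_seriesZ/is_cvg_series_exp_coeff.
Qed.

Lemma pseries_exp_coef_cvg Q t x y :
  pseries (exp_coef Q x y) t @ \oo --> ctmc_kernel Q t x y.
Proof.
rewrite ctmc_kernelE; have := @is_cvg_pseries_shift Q 0 x y t.
by under eq_fun do rewrite addn0.
Qed.

Lemma exp_coef_diffs Q x y : pseries_diffs (exp_coef Q x y) =
  fun k => kpow Q (k + 1) x y / k`!%:R.
Proof.
apply/funext => k; rewrite /pseries_diffs /exp_coef addn1 factS natrM invfM.
by rewrite mulrCA !mulrA mulfK ?pnatr_eq0// mulrC.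
Qed.

Lemma exp_coef_diffs2 Q x y : pseries_diffs (pseries_diffs (exp_coef Q x y)) =
  fun k => kpow Q (k + 2) x y / k`!%:R.
Proof.
rewrite exp_coef_diffs; apply/funext => k.
rewrite /pseries_diffs addn1 addn2 factS natrM invfM.
by rewrite mulrCA !mulrA mulfK ?pnatr_eq0// mulrC.
Qed.

Let derive_kernel0 Q t x y : is_derive t 1 (fun t => ctmc_kernel Q t x y)
  (limn (pseries (pseries_diffs (exp_coef Q x y)) t)).
Proof.
under eq_fun do rewrite ctmc_kernelE.
apply: (@pseries_snd_diffs _ _ (`|t| + 1)).
- have := @is_cvg_pseries_shift Q 0 x y (`|t| + 1).
  by under eq_fun do rewrite addn0.
- by rewrite exp_coef_diffs; exact: is_cvg_pseries_shift.
- by rewrite exp_coef_diffs2; exact: is_cvg_pseries_shift.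
- by rewrite [ltRHS]ger0_norm ?addr_ge0// ltrDl.
Qed.

Lemma derive_kernel_r Q t x y : is_derive t 1 (fun t => ctmc_kernel Q t x y)
  (\sum_z ctmc_kernel Q t x z * Q z y).
Proof.
apply: is_derive_eq (derive_kernel0 Q t x y) _; apply: cvg_lim => //.
rewrite exp_coef_diffs (_ : pseries _ _ =
    (fun n => \sum_z pseries (exp_coef Q x z) t n * Q z y)).
  by apply: cvg_sumr => z; apply: cvgMr_tmp; exact: pseries_exp_coef_cvg.
apply/funext => n; rewrite /pseries/series/=.
under [RHS]eq_bigr do rewrite mulr_suml.
rewrite exchange_big/=; apply: eq_bigr => k _.
rewrite addn1 kpowSr !mulr_suml; apply: eq_bigr => z _.
by rewrite /exp_coef; ring.
Qed.

Lemma derive_kernel_l Q t x y : is_derive t 1 (fun t => ctmc_kernel Q t x y)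
  (\sum_z Q x z * ctmc_kernel Q t z y).
Proof.
apply: is_derive_eq (derive_kernel0 Q t x y) _; apply: cvg_lim => //.
rewrite exp_coef_diffs (_ : pseries _ _ =
    (fun n => \sum_z Q x z * pseries (exp_coef Q z y) t n)).
  by apply: cvg_sumr => z; apply: cvgMl_tmp; exact: pseries_exp_coef_cvg.
apply/funext => n; rewrite /pseries/series/=.
under [RHS]eq_bigr do rewrite mulr_sumr.
rewrite exchange_big/=; apply: eq_bigr => k _.
rewrite addn1 kpowSl !mulr_suml; apply: eq_bigr => z _.
by rewrite /exp_coef; ring.
Qed.

Lemma ctmc_kernel_at0 Q x y : ctmc_kernel Q 0 x y = delta R x y.
Proof.
rewrite ctmc_kernelE; apply: cvg_lim => //.
apply: (cvg_trans _ (cvg_cst (delta R x y))).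
apply: near_eq_cvg; exists 1%N => // -[//|n] _.
rewrite /pseries/series/= big_nat_recl// big1 => [|k _].
  by rewrite expr0 mulr1 addr0 /exp_coef kpow0 fact0 divr1.
  by rewrite expr0n mulr0.
exact: eventually_filter.
Qed.

Lemma continuous_ctmc_kernel Q x y : continuous (fun t => ctmc_kernel Q t x y).
Proof. exact: (is_derive_continuous (fun t => derive_kernel_r Q t x y)). Qed.

Lemma ctmc_kernel_scale Q (c t : R) x y :
  ctmc_kernel (fun x y => c * Q x y) t x y = ctmc_kernel Q (c * t) x y.
Proof.
rewrite /ctmc_kernel; congr (lim (_ @ \oo)); apply/funext => K.
apply: eq_bigr => k _.
have -> : kpow (fun x y => c * Q x y) k x y = c ^+ k * kpow Q k x y.
  elim: (k : nat) x y => [|j IH] x y; first by rewrite expr0 mul1r.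
  rewrite !kpowSr mulr_sumr; apply: eq_bigr => z _.
  by rewrite IH exprS; ring.
by rewrite exprMn; ring.
Qed.

Lemma eq_ctmc_kernel Q Q' t x y : (forall x y, Q x y = Q' x y) ->
  ctmc_kernel Q t x y = ctmc_kernel Q' t x y.
Proof.
by move=> QQ; congr (ctmc_kernel _ t x y); apply/funext => a; apply/funext => b.
Qed.

Lemma ctmc_kernel_sum1 Q t x : (forall x, \sum_y Q x y = 0) ->
  \sum_y ctmc_kernel Q t x y = 1.
Proof.
move=> Q0; rewrite -[RHS](_ : \sum_y ctmc_kernel Q 0 x y = 1).
  apply: (@is_derive_0_is_cst _ (fun t => \sum_y ctmc_kernel Q t x y)) => s.
  apply: is_derive_eq (derive_sum (fun y => derive_kernel_r Q s x y)) _.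
  rewrite exchange_big/= big1// => z _.
  by rewrite -mulr_sumr Q0 mulr0.
under eq_bigr do rewrite ctmc_kernel_at0 -[delta _ _ _]mulr1.
exact: sum_delta_l.
Qed.

(** Interpolating by [exp (- q s) P'_s P_(t-s)], with [P'] the exponential of [Q + q I], gives a
    function of [s] with zero derivative. For [q] large the shifted matrix is nonnegative, and
    positivity of the kernel is then visible on the series. *)
Lemma ctmc_kernel_uniformization Q (q t : R) x y :
  ctmc_kernel Q t x y =
  expR (- q * t) * ctmc_kernel (fun x y => Q x y + q * delta R x y) t x y.
Proof.
set Q' := (fun x y => _).
pose F s := \sum_z (expR (- q * s) * ctmc_kernel Q' s x z) * ctmc_kernel Q (t - s) z y.
have F0 : F 0 = ctmc_kernel Q t x y.
  rewrite /F mulr0 expR0 subr0.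
  by under eq_bigr do rewrite mul1r ctmc_kernel_at0; rewrite sum_delta_l.
have Ft : F t = expR (- q * t) * ctmc_kernel Q' t x y.
  rewrite /F subrr.
  by under eq_bigr do rewrite ctmc_kernel_at0; rewrite sum_delta_r.
rewrite -F0 -Ft; apply: is_derive_0_is_cst => s.
apply: is_derive_eq (derive_sum (fun z => derive_mul (derive_mul
  (derive_expRM (- q) s) (derive_kernel_r Q' s x z))
  (derive_reflect (derive_kernel_l Q (t - s) z y)))) _.
have E z : \sum_w ctmc_kernel Q' s x w * Q' w z =
    \sum_w ctmc_kernel Q' s x w * Q w z + q * ctmc_kernel Q' s x z.
  under eq_bigr do rewrite /Q' mulrDr.
  rewrite big_split/=; congr (_ + _).
  under eq_bigr do rewrite mulrCA.
  by rewrite -mulr_sumr sum_delta_r.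
under eq_bigr => z _ do rewrite E.
set e := expR _; set A := fun z => ctmc_kernel Q' s x z.
set B := fun z => ctmc_kernel Q (t - s) z y.
rewrite (eq_bigr (fun z => e * ((\sum_w A w * Q w z) * B z - A z * \sum_w Q z w * B w)));
  last by move=> z _; rewrite /A /B; ring.
rewrite -mulr_sumr sumrB; apply/eqP; rewrite mulf_eq0; apply/orP; right.
rewrite subr_eq0; apply/eqP.
under eq_bigr do rewrite mulr_suml.
rewrite exchange_big/=; apply: eq_bigr => z _.
by rewrite mulr_sumr; apply: eq_bigr => w _; rewrite mulrA.
Qed.

Lemma ctmc_kernel_ge0 Q t x y : 0 <= t ->
  (forall x y, x != y -> 0 <= Q x y) -> 0 <= ctmc_kernel Q t x y.
Proof.
move=> t0 Q0; pose q := \sum_x `|Q x x|.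
rewrite (ctmc_kernel_uniformization Q q); apply: mulr_ge0; first exact: expR_ge0.
rewrite ctmc_kernelE; apply: limr_ge.
  by apply: cvgP; exact: pseries_exp_coef_cvg.
near=> K; rewrite /pseries/series/=; apply: sumr_ge0 => k _.
apply: mulr_ge0; rewrite ?exprn_ge0//; apply: mulr_ge0; rewrite ?invr_ge0//.
apply: kpow_ge0 => a b; case: (eqVneq a b) => [->|ab].
  rewrite /delta eqxx mulr1 -lerBlDl sub0r /q (bigD1 b)//=.
  apply: le_trans (_ : `|Q b b| <= _); first by rewrite -normrN ler_norm.
  by rewrite lerDl sumr_ge0.
by rewrite /delta (negPf ab) mulr0 addr0 Q0.
Unshelve. all: by end_near.
Qed.

(** The left side is the probability of no jump before [t]. Multiplying [P_s(x,x)] by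
    [exp (- Q x x * s)] cancels the diagonal term of the forward equation, and the remaining terms
    are nonnegative. *)
Lemma ctmc_kernel_diag_ge Q t x : 0 <= t ->
  (forall x y, x != y -> 0 <= Q x y) -> expR (Q x x * t) <= ctmc_kernel Q t x x.
Proof.
move=> t0 Q0; pose F s := expR (- Q x x * s) * ctmc_kernel Q s x x.
have F0 : F 0 = 1 by rewrite /F mulr0 expR0 mul1r ctmc_kernel_at0 /delta eqxx.
have : F 0 <= F t.
  apply: (derive_ge0_homo (df := fun s => - Q x x * expR (- Q x x * s) *
      ctmc_kernel Q s x x + expR (- Q x x * s) * (\sum_z ctmc_kernel Q s x z * Q z x))
    (a := 0)) => // s.
    exact: (derive_mul (derive_expRM _ _) (derive_kernel_r _ _ _ _)).
  move=> s0; rewrite (bigD1 x)//= mulrDr addrA.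
  rewrite (_ : - Q x x * _ * _ + _ = 0); last by ring.
  rewrite add0r mulr_ge0 ?expR_ge0// sumr_ge0// => z zx.
  by rewrite mulr_ge0 ?Q0// ctmc_kernel_ge0.
rewrite F0 /F mulNr expRN mulrC ler_pdivlMr ?expR_gt0// mul1r.
exact.
Qed.

(* Reversibility gives pi y * P_2t(y,y) = sum_z pi z * P_t(z,y)^2, whose
   derivative is minus the Dirichlet form. *)
Lemma ctmc_kernel_diag_antimono Q (pi : V -> R) s t y :
  (forall x, 0 < pi x) -> (forall x y, pi x * Q x y = pi y * Q y x) ->
  (forall x, \sum_y Q x y = 0) -> (forall x y, x != y -> 0 <= Q x y) ->
  0 <= s -> s <= t -> ctmc_kernel Q t y y <= ctmc_kernel Q s y y.
Proof.
move=> pi0 rev Qsum Q0 s0 st.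
pose P t z := ctmc_kernel Q t z y.
pose QP t z := \sum_w Q z w * P t w.
pose G t := \sum_z pi z * (P t z * P t z).
have sym (u v : V -> R) : \sum_z pi z * ((\sum_w Q z w * u w) * v z) =
    \sum_z pi z * (u z * (\sum_w Q z w * v w)).
  under eq_bigr do rewrite mulr_suml mulr_sumr.
  under [RHS]eq_bigr do rewrite !mulr_sumr.
  rewrite exchange_big/=; apply: eq_bigr => z _; apply: eq_bigr => w _.
  by rewrite -mulrA (mulrA (pi w)) rev; ring.
have GE r : G r = pi y * ctmc_kernel Q (r + r) y y.
  (* By the symmetry of [Q] for the weights [pi], the derivative in [a] vanishes; [a = r] gives the
     sum of squares and [a = 0] the diagonal entry at time [r + r]. *)
  pose F a := \sum_z pi z * (P a z * P (r + r - a) z).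
  have -> : G r = F r by rewrite /F addrK.
  have -> : pi y * ctmc_kernel Q (r + r) y y = F 0.
    rewrite /F subr0 (eq_bigr (fun z => (pi z * P (r + r) z) * delta R z y)).
      by rewrite sum_delta_r.
    by move=> z _; rewrite /P ctmc_kernel_at0; ring.
  apply: is_derive_0_is_cst => a; apply: is_derive_eq (derive_sum (fun z => derive_mull (pi z) (derive_mul
    (derive_kernel_l Q a z y) (derive_reflect (derive_kernel_l Q (r + r - a) z y))))) _.
  under eq_bigr do rewrite mulrN mulrBr.
  by rewrite sumrB sym subrr.
have Gmono a b : 0 <= a -> a <= b -> - G a <= - G b.
  move=> a0 ab; apply: (derive_ge0_homo (f := fun t => - G t)
    (df := fun t => - \sum_z pi z * (QP t z * P t z + P t z * QP t z)) (a := 0)) => // {a b a0 ab} a.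
    exact: (is_deriveN (derive_sum (fun z => derive_mull (pi z) (derive_mul
      (derive_kernel_l Q a z y) (derive_kernel_l Q a z y))))).
  move=> _; set u := P a.
  (* Expanding the square, both pure terms vanish: one because rows of [Q] sum to zero, the other by
     the same fact after exchanging the sums. Only the cross term survives. *)
  have D : \sum_z \sum_w pi z * Q z w * (u z - u w) ^+ 2 =
      - \sum_z pi z * (QP a z * u z + u z * QP a z).
    rewrite (eq_bigr (fun z => \sum_w (pi z * u z ^+ 2 * Q z w) +
      \sum_w (pi w * Q w z * u w ^+ 2) - \sum_w (2 * (pi z * u z * (Q z w * u w))))).
      rewrite sumrB big_split/=.
      have -> : \sum_z \sum_w pi z * u z ^+ 2 * Q z w = 0.
        by rewrite big1// => z _; rewrite -mulr_sumr Qsum mulr0.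
      have -> : \sum_z \sum_w pi w * Q w z * u w ^+ 2 = 0.
        rewrite exchange_big/= big1// => z _.
        by under eq_bigr do rewrite mulrAC; rewrite -mulr_sumr Qsum mulr0.
      rewrite addr0 sub0r; congr (- _); apply: eq_bigr => z _.
      by rewrite -mulr_sumr -mulr_sumr /QP; ring.
    move=> z _; rewrite -big_split/= -sumrB; apply: eq_bigr => w _.
    by rewrite (rev w z); ring.
  rewrite -D; apply: sumr_ge0 => z _; apply: sumr_ge0 => w _.
  case: (eqVneq z w) => [->|zw]; first by rewrite subrr expr0n mulr0.
  by rewrite mulr_ge0 ?sqr_ge0// mulr_ge0 ?Q0// ltW.
have := Gmono (s / 2) (t / 2); rewrite !GE.
rewrite -(splitr s) -(splitr t) lerN2 ler_pM2l//; apply; first by rewrite divr_ge0.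
by rewrite ler_wpM2r// invr_ge0.
Qed.

End Semigroup.

(** * Laplace transforms as integrals over the unit interval *)

Section UnitIntegral.
Variable R : realType.
Implicit Types (f g : R -> R).
Local Notation leb := (@lebesgue_measure R).

Definition int01 f : R := \int[leb]_(u in `[0, 1]) f u.

Definition bdd_meas f :=
  measurable_fun [set: R] f /\ exists M, forall u, 0 <= u <= 1 -> `|f u| <= M.

Lemma bdd_meas_integrable f (A : set R) : measurable A -> A `<=` `[0, 1] ->
  bdd_meas f -> leb.-integrable A (EFin \o f).
Proof.
move=> mA A01 [mf [M fM]]; apply: measurable_bounded_integrable => //.
- apply: (@le_lt_trans _ _ (leb `[0, 1])); first by rewrite le_measure ?inE.
  by rewrite lebesgue_measure_itv/= lte01 oppr0 adde0 ltry.
- exact: measurable_funS mf.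
- exists M; split; first exact: num_real.
  move=> M' MM' u /A01 /=; rewrite in_itv/= => u01.
  by rewrite (le_trans (fM _ u01))// ltW.
Qed.

Let int01_integrable f : bdd_meas f -> leb.-integrable `[0, 1] (EFin \o f).
Proof. by apply: bdd_meas_integrable. Qed.

Lemma bdd_measD f g : bdd_meas f -> bdd_meas g -> bdd_meas (fun u => f u + g u).
Proof.
move=> [mf [M fM]] [mg [N gN]]; split; first exact: measurable_funD.
exists (M + N) => u u01; rewrite (le_trans (ler_normD _ _))//.
by rewrite lerD ?fM ?gN.
Qed.

Lemma bdd_measM f g : bdd_meas f -> bdd_meas g -> bdd_meas (fun u => f u * g u).
Proof.
move=> [mf [M fM]] [mg [N gN]]; split; first exact: measurable_funM.
by exists (M * N) => u u01; rewrite normrM ler_pM ?fM ?gN.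
Qed.

Lemma bdd_meas_cst (c : R) : bdd_meas (fun=> c).
Proof. by split; [exact: measurable_cst|exists `|c|]. Qed.

Lemma bdd_measZ f (c : R) : bdd_meas f -> bdd_meas (fun u => c * f u).
Proof. by move=> fb; apply: bdd_measM => //; exact: bdd_meas_cst. Qed.

Lemma bdd_measN f : bdd_meas f -> bdd_meas (fun u => - f u).
Proof.
by move=> fb; under eq_fun do rewrite -mulN1r; exact: bdd_measZ.
Qed.

Lemma bdd_measX (k : nat) : bdd_meas (fun u => u ^+ k).
Proof.
split; first exact: exprn_measurable.
exists 1 => u /andP[u0 u1]; rewrite normrX ger0_norm//.
exact: exprn_ile1.
Qed.

Lemma bdd_meas_log g (C : R) : continuous g ->
  (forall t, 0 <= t -> `|g t| <= C) -> bdd_meas (fun u => g (- ln u)).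
Proof.
move=> cg gC; split.
  apply: (measurableT_comp (continuous_measurable_fun cg)).
  by apply: measurable_funN; exact: measurable_ln.
(* At [u = 0] the default value [ln 0 = 0] keeps the argument of [g] nonnegative. *)
by exists C => u /andP[_ u1]; rewrite gC// oppr_ge0 ln_le0.
Qed.

Lemma expRNM_le1 (v t : R) : 0 <= v -> 0 <= t -> `|expR (- v * t)| <= 1.
Proof.
move=> v0 t0; rewrite ger0_norm ?expR_ge0// -expR0 ler_expR mulNr oppr_le0.
exact: mulr_ge0.
Qed.

Lemma bdd_meas_exp_log (v : R) : 0 <= v -> bdd_meas (fun u => expR (- v * (- ln u))).
Proof.
move=> v0; apply: (bdd_meas_log (g := fun t => expR (- v * t)) (C := 1)).
  exact: (is_derive_continuous (fun t => derive_expRM (- v) t)).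
by move=> t; exact: expRNM_le1.
Qed.

Lemma bdd_meas_sum (I : finType) (F : I -> R -> R) :
  (forall i, bdd_meas (F i)) -> bdd_meas (fun u => \sum_i F i u).
Proof.
move=> bF; rewrite (_ : (fun u => _) = \sum_i F i); last first.
  by apply/funext => u; rewrite fct_sumE.
elim/big_ind : _ => [|f g|i _]; [exact: bdd_meas_cst|exact: bdd_measD|exact: bF].
Qed.

Lemma int01D f g : bdd_meas f -> bdd_meas g ->
  int01 (fun u => f u + g u) = int01 f + int01 g.
Proof. by move=> bf bg; rewrite /int01 RintegralD//; exact: int01_integrable. Qed.

Lemma int01Z f (c : R) : bdd_meas f -> int01 (fun u => c * f u) = c * int01 f.
Proof. by move=> bf; rewrite /int01 RintegralZl//; exact: int01_integrable. Qed.

Lemma int01N f : bdd_meas f -> int01 (fun u => - f u) = - int01 f.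
Proof.
by move=> fb; under eq_fun do rewrite -mulN1r; rewrite int01Z// mulN1r.
Qed.

Lemma int01_sum (I : finType) (F : I -> R -> R) :
  (forall i, bdd_meas (F i)) ->
  int01 (fun u => \sum_i F i u) = \sum_i int01 (F i).
Proof.
move=> bF; rewrite (_ : (fun u => _) = \sum_i F i); last first.
  by apply/funext => u; rewrite fct_sumE.
suff : bdd_meas (\sum_i F i) /\ int01 (\sum_i F i) = \sum_i int01 (F i) by case.
elim/big_ind2 : _ => [|f a g b [bf fa] [bg gb]|//].
  by split; [exact: bdd_meas_cst|rewrite /int01 Rintegral_cst// mul0r].
by split; [exact: bdd_measD|rewrite int01D// fa gb].
Qed.

Lemma eq_int01 f g : (forall u, 0 <= u <= 1 -> f u = g u) -> int01 f = int01 g.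
Proof.
move=> fg; apply: eq_Rintegral => u; rewrite inE/= in_itv/= => u01.
exact: fg.
Qed.

Lemma le_int01 f g : bdd_meas f -> bdd_meas g ->
  (forall u, 0 <= u <= 1 -> f u <= g u) -> int01 f <= int01 g.
Proof.
move=> bf bg fg.
exact: le_Rintegral (int01_integrable bf) (int01_integrable bg) _.
Qed.

Lemma int01_ge0 f : (forall u, 0 <= u <= 1 -> 0 <= f u) -> 0 <= int01 f.
Proof.
by move=> f0; apply: Rintegral_ge0 => u /=; rewrite in_itv/=; exact: f0.
Qed.

Lemma int01_cst (c : R) : int01 (fun=> c) = c.
Proof.
by rewrite /int01 Rintegral_cst//= lebesgue_measure_itv/= lte01 oppr0 adde0 mulr1.
Qed.

(** [g (- ln u)] may oscillate as [u] tends to 0; being bounded, it is killed by a positive power of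
    [u]. Hence the exponent [k.+1], which corresponds to the Laplace variable [mu = k + 2] since
    [dt = du / u] up to sign. *)
Lemma within_continuous_powlog g (C : R) (k : nat) : continuous g ->
  (forall t, 0 <= t -> `|g t| <= C) ->
  {within `[0, 1], continuous (fun u => u ^+ k.+1 * g (- ln u))}.
Proof.
move=> cg gC; apply/(continuous_within_itvP _ ltr01).
have cu (u : R) : 0 < u -> {for u, continuous (fun v : R => v ^+ k.+1 * g (- ln v))}.
  move=> u0; apply: cvgM; first exact: exprn_continuous.
  apply: (@continuous_comp _ _ _ (fun u => - ln u) g); last exact: cg.
  by apply: cvgN; exact: continuous_ln.
split.
- by move=> u; rewrite in_itv/= => /andP[u0 _]; exact: cu.
- rewrite expr0n mul0r; apply: norm_cvg0.
  apply: (@squeeze_cvgr _ _ _ _ (fun=> 0) (fun u => u ^+ k.+1 * C)).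
  + near=> u; have u0 : 0 < u by near: u; exact: nbhs_right_gt.
    have u1 : u <= 1 by near: u; exact: nbhs_right_le.
    rewrite normr_ge0/= normrM normrX (gtr0_norm u0); apply: ler_wpM2l.
      by rewrite exprn_ge0// ltW.
    by apply: gC; rewrite oppr_ge0 ln_le0.
  + exact: cvg_cst.
  + rewrite -[X in _ --> X](mul0r C) -[X in X * _](expr0n R k.+1); apply: cvgMr_tmp.
    by apply: cvg_at_right_filter; exact: exprn_continuous.
- by apply: cvg_at_left_filter; exact: cu.
Unshelve. all: by end_near. Qed.

(* Laplace transform of a derivative, in the variable u = e^-t. *)
Lemma int01_laplace_derive g (dg : R -> R) (C : R) (k : nat) :
  (forall t : R, is_derive t 1 g (dg t)) -> continuous dg ->
  (forall t, 0 <= t -> `|g t| <= C) -> (forall t, 0 <= t -> `|dg t| <= C) ->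
  k.+2%:R * int01 (fun u => u ^+ k.+1 * g (- ln u)) -
  int01 (fun u => u ^+ k.+1 * dg (- ln u)) = g 0.
Proof.
move=> gd cdg gC dgC; have cg : continuous g by exact: is_derive_continuous gd.
have bg : bdd_meas (fun u => u ^+ k.+1 * g (- ln u)).
  by apply: bdd_measM; [exact: bdd_measX|exact: bdd_meas_log gC].
have bdg : bdd_meas (fun u => u ^+ k.+1 * dg (- ln u)).
  by apply: bdd_measM; [exact: bdd_measX|exact: bdd_meas_log dgC].
rewrite -int01Z// -int01N// -int01D; [|exact: bdd_measZ|exact: bdd_measN].
pose h t := k.+2%:R * g t - dg t.
rewrite (_ : (fun u => _) = (fun u => u ^+ k.+1 * h (- ln u))); last first.
  by apply/funext => u; rewrite /h; ring.
(* Integration by parts as a fundamental theorem of calculus: [F] vanishes at 0, equals [g 0] at 1,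
   and has derivative [u^(k+1) h (- ln u)]. *)
pose F u := u ^+ k.+2 * g (- ln u).
have Fd (u : R) : 0 < u -> is_derive u 1 F (u ^+ k.+1 * h (- ln u)).
  move=> u0.
  have nl : is_derive u 1 (fun u => - ln u) (- u^-1).
    exact: (is_deriveN (is_derive1_ln u0)).
  have gl := @is_derive1_comp R g (fun u => - ln u) u _ _ (gd (- ln u)) nl.
  have ud : is_derive u 1 (fun u => u ^+ k.+2) (k.+2%:R * u ^+ k.+1).
    exact: derive_exprn.
  apply: is_derive_eq (derive_mul ud gl) _.
  rewrite /= /h (exprS u k.+1); field; exact: lt0r_neq0.
rewrite /int01 /Rintegral (@continuous_FTC2 _ _ F 0 1 ltr01).
- by rewrite /F ln1 oppr0 expr1n mul1r expr0n mul0r -EFinB /= subr0.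
- apply: (@within_continuous_powlog h (k.+2%:R * C + C)).
    move=> t; apply: cvgB; last exact: cdg.
    by apply: cvgMl_tmp; exact: cg.
  move=> t t0; rewrite (le_trans (ler_normB _ _))// lerD ?dgC// normrM ger0_norm//.
  by rewrite ler_wpM2l// gC.
- have := @within_continuous_powlog g C k.+1 cg gC.
  move/(continuous_within_itvP _ ltr01) => [_ F0 F1]; split => //.
  move=> u; rewrite in_itv/= => /andP[u0 _].
  by case: (Fd u u0).
- move=> u; rewrite in_itv/= => /andP[u0 _]; rewrite derive1E.
  by case: (Fd u u0).
Qed.

End UnitIntegral.

(** * Resolvent of the trap model at a fixed environment, compared with the lazy walk *)

Section TrapModel.
Variables (R : realType) (n : nat).
Hypothesis n_gt0 : (0 < n)%N.
Variable V : hcube n -> R.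
Hypothesis V_gt0 : forall x, 0 < V x.
Implicit Types (x y z : hcube n) (k N : nat).

Definition trap_gen x y : R := V x * (srw R x y - delta R x y).

Lemma trap_gen_offdiag x y : x != y -> 0 <= trap_gen x y.
Proof.
move=> /negPf xy; rewrite /trap_gen /delta xy subr0.
by rewrite mulr_ge0 ?srw_ge0// ltW.
Qed.

Lemma trap_gen_sum0 x : \sum_y trap_gen x y = 0.
Proof.
rewrite -mulr_sumr sumrB srw_stochastic//.
under [X in 1 - X]eq_bigr do rewrite -[delta _ _ _]mulr1.
by rewrite sum_delta_l subrr mulr0.
Qed.

Lemma trap_gen_diag x : trap_gen x x = - V x.
Proof. by rewrite /trap_gen /srw hc_adjxx /delta eqxx sub0r mulrN1. Qed.

Lemma trap_gen_rev x y : (V x)^-1 * trap_gen x y = (V y)^-1 * trap_gen y x.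
Proof.
rewrite /trap_gen !mulrA !mulVf ?gt_eqF// !mul1r srwC /delta.
by rewrite [x == y]eq_sym.
Qed.

Local Notation P := (ctmc_kernel trap_gen).

Lemma trap_kernel_ge0 t x y : 0 <= t -> 0 <= P t x y.
Proof. by move=> t0; apply: ctmc_kernel_ge0 => //; exact: trap_gen_offdiag. Qed.

Lemma trap_kernel_sum1 t x : \sum_y P t x y = 1.
Proof. by apply: ctmc_kernel_sum1; exact: trap_gen_sum0. Qed.

Lemma trap_kernel_le1 t x y : 0 <= t -> P t x y <= 1.
Proof.
move=> t0; rewrite -(trap_kernel_sum1 t x) (bigD1 y)//= lerDl.
by apply: sumr_ge0 => z _; exact: trap_kernel_ge0.
Qed.

Lemma trap_kernel_norm t x y : 0 <= t -> `|P t x y| <= 1.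
Proof. by move=> t0; rewrite ger0_norm ?trap_kernel_le1 ?trap_kernel_ge0. Qed.

Lemma trap_kernel_bdd x y : bdd_meas (fun u => P (- ln u) x y).
Proof.
apply: (@bdd_meas_log _ (fun t => P t x y) 1); first exact: continuous_ctmc_kernel.
by move=> t; exact: trap_kernel_norm.
Qed.

(* The resolvent of the chain at k + 2, written in the variable u = e^-t. *)
Definition trap_resolvent k x y : R :=
  int01 (fun u => u ^+ k.+1 * P (- ln u) x y).

Local Notation M := trap_resolvent.

Let bddM k x y : bdd_meas (fun u => u ^+ k.+1 * P (- ln u) x y).
Proof. by apply: bdd_measM; [exact: bdd_measX|exact: trap_kernel_bdd]. Qed.

Lemma trap_resolvent_ge0 k x y : 0 <= M k x y.
Proof.
apply: int01_ge0 => u /andP[u0 u1]; rewrite mulr_ge0 ?exprn_ge0//.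
by rewrite trap_kernel_ge0// oppr_ge0 ln_le0.
Qed.

Lemma int01_pow k : int01 (fun u : R => u ^+ k.+1) = k.+2%:R^-1.
Proof.
have : k.+2%:R * int01 (fun u : R => u ^+ k.+1 * 1) -
    int01 (fun u : R => u ^+ k.+1 * 0) = 1.
  apply: (@int01_laplace_derive R (fun=> 1) (fun=> 0) 1).
  - by move=> t; exact: cvg_cst.
  - by move=> t _; rewrite normr1.
  - by move=> t _; rewrite normr0.
under [X in _ * int01 X]eq_fun do rewrite mulr1.
under [X in _ - int01 X]eq_fun do rewrite mulr0.
rewrite int01_cst subr0 => H.
have k0 : k.+2%:R != 0 :> R by rewrite pnatr_eq0.
by apply: (mulfI k0); rewrite H mulfV.
Qed.

Lemma trap_resolvent_sum k x : \sum_y M k x y = k.+2%:R^-1.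
Proof.
rewrite -int01_sum => [|y]; last exact: bddM.
under eq_fun do rewrite -mulr_sumr trap_kernel_sum1 mulr1.
exact: int01_pow.
Qed.

(** Laplace transform of the forward equation: with [mu = k + 2] and generator [Q],
    [M (mu - Q) = I]. *)
Lemma trap_resolventE k x y :
  k.+2%:R * M k x y - \sum_z M k x z * trap_gen z y = delta R x y.
Proof.
pose C := 1 + \sum_z `|trap_gen z y|.
have C0 : 0 <= \sum_z `|trap_gen z y| by rewrite sumr_ge0.
have dPc : continuous (fun t => \sum_z P t x z * trap_gen z y).
  move=> t; apply: cvg_sumr => z; apply: cvgMr_tmp.
  exact: continuous_ctmc_kernel.
have := @int01_laplace_derive R (fun t => P t x y) _ C k
  (fun t => derive_kernel_r trap_gen t x y) dPc.
rewrite ctmc_kernel_at0 => <-.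
- congr (_ - _); rewrite [in RHS](_ : (fun u => _) =
     (fun u => \sum_z (trap_gen z y * (u ^+ k.+1 * P (- ln u) x z)))).
    rewrite int01_sum => [|z]; last by apply: bdd_measZ; exact: bddM.
    by apply: eq_bigr => z _; rewrite int01Z// mulrC.
  by apply/funext => u; rewrite mulr_sumr; apply: eq_bigr => z _; ring.
- by move=> t t0; rewrite (le_trans (trap_kernel_norm _ _ t0))// lerDl.
- move=> t t0; apply: le_trans (ler_norm_sum _ _ _) _.
  rewrite /C -[leLHS]add0r lerD//; apply: ler_sum => z _.
  by rewrite normrM -[leRHS]mul1r ler_wpM2r// trap_kernel_norm.
Qed.

Lemma exp_resolvent k (v : R) : 0 <= v ->
  (k.+2%:R + v) * int01 (fun u => u ^+ k.+1 * expR (- v * (- ln u))) = 1.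
Proof.
move=> v0.
have e1 t : 0 <= t -> `|expR (- v * t)| <= 1 by exact: expRNM_le1.
have cexp : continuous (fun t => expR (- v * t)).
  exact: (is_derive_continuous (fun t => derive_expRM (- v) t)).
have be : bdd_meas (fun u => u ^+ k.+1 * expR (- v * (- ln u))).
  by apply: bdd_measM; [exact: bdd_measX|exact: bdd_meas_exp_log].
have : k.+2%:R * int01 (fun u => u ^+ k.+1 * expR (- v * (- ln u))) -
    int01 (fun u => u ^+ k.+1 * (- v * expR (- v * (- ln u)))) = expR (- v * 0).
  apply: (@int01_laplace_derive R (fun t => expR (- v * t))
    (fun t => - v * expR (- v * t)) (1 + v)).
  - by move=> t; exact: derive_expRM.
  - by move=> t; apply: cvgMl_tmp; exact: cexp.
  - by move=> t t0; rewrite (le_trans (e1 _ t0))// lerDl.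
  - move=> t t0; rewrite normrM normrN (ger0_norm v0).
    apply: (@le_trans _ _ (v * 1)); last by rewrite mulr1 lerDr.
    by apply: ler_wpM2l => //; exact: e1.
rewrite mulr0 expR0 [in X in _ - X = _](_ : (fun u => _) =
   (fun u => - v * (u ^+ k.+1 * expR (- v * (- ln u))))); last first.
  by apply/funext => u; ring.
by rewrite int01Z// mulNr opprK -mulrDl.
Qed.

(* Visits at y of the jump chain killed at rate k + 2 ... *)
Definition trap_visits k x y : R := (k.+2%:R + V y) * M k x y.

(* ... and the probability that a visit at y is the killing one. *)
Definition trap_kill k y : R := k.+2%:R / (k.+2%:R + V y).

Local Notation m := trap_visits.
Local Notation a := trap_kill.

Let kV k y : 0 < k.+2%:R + V y :> R.
Proof. by rewrite addr_gt0. Qed.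

Lemma trap_kill_gt0 k y : 0 < a k y.
Proof. by rewrite divr_gt0. Qed.

Lemma trap_kill_ge0 k y : 0 <= a k y.
Proof. exact/ltW/trap_kill_gt0. Qed.

Lemma trap_kill_le1 k y : a k y <= 1.
Proof. by rewrite ler_pdivrMr// mul1r lerDl ltW. Qed.

Lemma trap_visits_ge0 k x y : 0 <= m k x y.
Proof. by rewrite mulr_ge0 ?trap_resolvent_ge0// ltW. Qed.

Lemma trap_kill_visits k x y : a k y * m k x y = k.+2%:R * M k x y.
Proof. by rewrite /trap_kill /trap_visits mulrA divfK// gt_eqF. Qed.

(** Of the visits [m], the part [mu M] is killed and the rest takes one step, so
    [m - (m - mu M) S = I]. Multiplying on the right by [G] and inserting [(I - S) G = I - L^N] and
    [S G = green1] gives the formula, with no approximation. *)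
Lemma trap_visitsE k N x w : m k x w =
  \sum_z m k x z * kpow (@lazy_srw R n) N z w + green R N x w
  - \sum_z k.+2%:R * M k x z * green1 R N z w.
Proof.
have E y : m k x y - \sum_z (m k x z - k.+2%:R * M k x z) * srw R z y =
    delta R x y.
  rewrite -(trap_resolventE k x y) /trap_gen.
  rewrite [in RHS](eq_bigr (fun z => M k x z * V z * srw R z y -
    M k x z * V z * delta R z y)) => [|z _]; last by ring.
  rewrite sumrB (sum_delta_r (fun z => M k x z * V z)).
  rewrite (eq_bigr (fun z => M k x z * V z * srw R z y)) => [|z _].
    by rewrite /trap_visits; ring.
  by rewrite /trap_visits; ring.
have : \sum_y (m k x y - \sum_z (m k x z - k.+2%:R * M k x z) * srw R z y) *
    green R N y w = green R N x w.
  by under eq_bigr do rewrite E; rewrite sum_delta_l.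
under eq_bigr do rewrite mulrBl.
rewrite sumrB; under [X in _ - X]eq_bigr do rewrite mulr_suml.
rewrite exchange_big/=.
rewrite [X in _ - X](eq_bigr (fun z => m k x z * green1 R N z w -
    k.+2%:R * M k x z * green1 R N z w)) => [|z _]; last first.
  under eq_bigr do rewrite -mulrA.
  by rewrite -mulr_sumr srw_green mulrBl.
rewrite sumrB => <-.
have : \sum_y m k x y * green R N y w - \sum_y m k x y * green1 R N y w =
    m k x w - \sum_y m k x y * kpow (@lazy_srw R n) N y w.
  rewrite -[m k x w](sum_delta_r (m k x)) -!sumrB; apply: eq_bigr => y _.
  by rewrite -[LHS]mulrBr -[RHS]mulrBr green_green1.
by move=> H; lra.
Qed.

Section Estimates.
Variables (k N : nat) (dlt sigma eps : R).
Hypothesis dlt0 : 0 <= dlt.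
Hypothesis lazyN : forall z y,
  `|kpow (@lazy_srw R n) N z y - 2 ^- n| <= 2 ^- n * dlt.
Hypothesis sigmaP : forall z, \sum_y green1 R N z y * a k y <= sigma.
Hypothesis epsP : forall z y, green1 R N z y <= eps.

(** Since [L^N] is nearly uniform, the term [m L^N] is nearly this constant at every site. It is
    thus the unknown normalisation of the killing law, eventually [1 / A]. *)
Definition trap_mean x : R := 2 ^- n * \sum_z m k x z.

Local Notation c := trap_mean.
Local Notation A := (\sum_y a k y).

Lemma trap_mean_ge0 x : 0 <= c x.
Proof.
rewrite mulr_ge0 ?invr_ge0 ?exprn_ge0// sumr_ge0// => z _.
exact: trap_visits_ge0.
Qed.

Lemma trap_lazy_mean x y :
  `|\sum_z m k x z * kpow (@lazy_srw R n) N z y - c x| <= c x * dlt.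
Proof.
rewrite /trap_mean mulr_sumr -sumrB; apply: le_trans (ler_norm_sum _ _ _) _.
rewrite mulr_suml; apply: ler_sum => z _.
rewrite (mulrC (2 ^- n)) -mulrBr normrM (ger0_norm (trap_visits_ge0 _ _ _)).
by rewrite -(mulrA (m k x z)) ler_wpM2l ?trap_visits_ge0.
Qed.

(** The weights [mu M k x z] form a probability over the killing position [z], so a bound [sigma]
    valid from every [z] survives the average. *)
Let kill_sum (f : hcube n -> R) : (forall y, 0 <= f y <= 1) -> forall x,
  0 <= \sum_y (\sum_z k.+2%:R * M k x z * green1 R N z y) * (a k y * f y) <= sigma.
Proof.
move=> f01 x; apply/andP; split.
  apply: sumr_ge0 => y _; case/andP: (f01 y) => f0 _.
  apply: mulr_ge0; last by apply: mulr_ge0 => //; exact: trap_kill_ge0.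
  by apply: sumr_ge0 => z _; rewrite !mulr_ge0 ?trap_resolvent_ge0 ?green1_ge0.
under eq_bigr do rewrite mulr_suml.
rewrite exchange_big/=.
have E : \sum_z k.+2%:R * M k x z * sigma = sigma.
  by rewrite -mulr_suml -mulr_sumr trap_resolvent_sum mulfV ?mul1r.
rewrite -[leRHS]E; apply: ler_sum => z _.
under eq_bigr do rewrite -mulrA.
rewrite -mulr_sumr ler_wpM2l ?mulr_ge0 ?trap_resolvent_ge0//.
apply: le_trans (sigmaP z); apply: ler_sum => y _.
rewrite ler_wpM2l ?green1_ge0// -[leRHS]mulr1.
by case/andP: (f01 y) => _ f1; apply: ler_wpM2l => //; exact: trap_kill_ge0.
Qed.

(** As [L^N] is nonnegative, [green] is at most [delta + green1]: the start itself costs [a k x],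
    the later visits [sigma]. *)
Let green_sum (f : hcube n -> R) : (forall y, 0 <= f y <= 1) -> forall x,
  0 <= \sum_y green R N x y * (a k y * f y) <= a k x + sigma.
Proof.
move=> f01 x; apply/andP; split.
  apply: sumr_ge0 => y _; case/andP: (f01 y) => f0 _.
  by apply: mulr_ge0; [exact: green_ge0|apply: mulr_ge0 => //; exact: trap_kill_ge0].
apply: (@le_trans _ _ (\sum_y (delta R x y * a k y + green1 R N x y * a k y))).
  apply: ler_sum => y _; rewrite -mulrDl; case/andP: (f01 y) => f0 f1.
  apply: ler_pM; first exact: green_ge0.
  - by apply: mulr_ge0 => //; exact: trap_kill_ge0.
  - have := green_green1 R N x y => /eqP; rewrite subr_eq => /eqP ->.
    rewrite lerD2r gerBl; apply: kpow_ge0; exact: lazy_srw_ge0.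
  - by rewrite -[leRHS]mulr1; apply: ler_wpM2l => //; exact: trap_kill_ge0.
by rewrite big_split/= sum_delta_l lerD2l.
Qed.

(** The three sums are the mixed term, close to [c x] times the sum of [a f]; the visits soon after
    the start; and the correction for visits that would follow the killing. The last two are the
    errors bounded just above. *)
Let main_split (f : hcube n -> R) x :
  k.+2%:R * \sum_y M k x y * f y =
  \sum_y (\sum_z m k x z * kpow (@lazy_srw R n) N z y) * (a k y * f y)
  + \sum_y green R N x y * (a k y * f y)
  - \sum_y (\sum_z k.+2%:R * M k x z * green1 R N z y) * (a k y * f y).
Proof.
rewrite mulr_sumr -big_split/= -sumrB; apply: eq_bigr => y _.
by rewrite -mulrDl -mulrBl -trap_visitsE mulrA -trap_kill_visits; ring.
Qed.

Lemma trap_resolvent_estimate (f : hcube n -> R) x :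
  (forall y, 0 <= f y <= 1) ->
  `|k.+2%:R * \sum_y M k x y * f y - c x * \sum_y a k y * f y| <=
  c x * dlt * A + a k x + 2 * sigma.
Proof.
move=> f01; rewrite main_split.
have /andP[K0 K1] := kill_sum f01 x.
have /andP[G0 G1] := green_sum f01 x.
move: (\sum_y (\sum_z k.+2%:R * _ * _) * _) K0 K1 => K K0 K1.
move: (\sum_y green R N x y * _) G0 G1 => G G0 G1.
have H : `|\sum_y (\sum_z m k x z * kpow (@lazy_srw R n) N z y) * (a k y * f y) -
    c x * \sum_y a k y * f y| <= c x * dlt * A.
  rewrite mulr_sumr -sumrB; apply: le_trans (ler_norm_sum _ _ _) _.
  rewrite mulr_sumr; apply: ler_sum => y _; case/andP: (f01 y) => f0 f1.
  rewrite -mulrBl normrM; apply: ler_pM => //; first exact: trap_lazy_mean.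
  rewrite ger0_norm; last by apply: mulr_ge0 => //; exact: trap_kill_ge0.
  by rewrite -[leRHS]mulr1; apply: ler_wpM2l => //; exact: trap_kill_ge0.
move: H; move: (\sum_y (\sum_z m k x z * _) * _) => L.
move: (c x * \sum_y _) (c x * dlt * A) (a k x) G1 => B1 B2 B3 G1.
rewrite !ler_norml => /andP[H1 H2]; apply/andP; split; lra.
Qed.

(** For [f = 1] the left side of [main_split] is the total killing probability 1, which bounds the
    mixed term from above. This a priori bound on [c x * A] controls the error [c x * dlt * A],
    which involves the unknown [c x]. *)
Lemma trap_mean_le x : c x * (1 - dlt) * A <= 1 + sigma.
Proof.
have f01 : forall y : hcube n, 0 <= (1 : R) <= 1 by move=> y; rewrite ler01 lexx.
have := main_split (fun=> 1) x.
have /andP[K0 K1] := kill_sum f01 x.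
have /andP[G0 G1] := green_sum f01 x.
clear f01.
move: (\sum_y (\sum_z k.+2%:R * _ * _) * _) K0 K1 => K K0 K1.
move: (\sum_y green R N x y * _) G0 G1 => G G0 G1.
under eq_bigr do rewrite mulr1.
rewrite trap_resolvent_sum mulfV// => H.
have : c x * (1 - dlt) * A <=
    \sum_y (\sum_z m k x z * kpow (@lazy_srw R n) N z y) * (a k y * 1).
  rewrite mulr_sumr; apply: ler_sum => y _; rewrite mulr1.
  apply: ler_wpM2r; first exact: trap_kill_ge0.
  by have := trap_lazy_mean x y; rewrite ler_norml => /andP[H1 _]; lra.
lra.
Qed.

Lemma trap_visits_diag x : m k x x <= 1 + (c x * (1 + dlt) + eps).
Proof.
rewrite (trap_visitsE k N).
have -> : green R N x x = 1 - kpow (@lazy_srw R n) N x x + green1 R N x x.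
  have := green_green1 R N x x => /eqP; rewrite subr_eq => /eqP ->.
  by rewrite /delta eqxx.
have L0 : 0 <= kpow (@lazy_srw R n) N x x by apply: kpow_ge0; exact: lazy_srw_ge0.
have K0 : 0 <= \sum_z k.+2%:R * M k x z * green1 R N z x.
  by apply: sumr_ge0 => z _; rewrite !mulr_ge0 ?trap_resolvent_ge0 ?green1_ge0.
have := trap_lazy_mean x x; rewrite ler_norml => /andP[_ H].
have := epsP x x; lra.
Qed.

(** Being killed at [x] has probability [a m], and during the very first stay probability [a]. The
    left side is therefore [a (m - 1)], where [m - 1] is the expected number of returns. *)
Lemma trap_return_resolvent x :
  k.+2%:R * int01 (fun u => u ^+ k.+1 *
     (P (- ln u) x x - expR (- V x * (- ln u)))) <= c x * (1 + dlt) + eps.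
Proof.
have e0 : 0 <= eps by apply: le_trans (epsP x x); exact: green1_ge0.
have c0 := trap_mean_ge0 x.
have B0 : 0 <= c x * (1 + dlt) + eps by rewrite addr_ge0// mulr_ge0// addr_ge0.
have ex := exp_resolvent k (ltW (V_gt0 x)).
have be : bdd_meas (fun u => u ^+ k.+1 * expR (- V x * (- ln u))).
  by apply: bdd_measM; [exact: bdd_measX|apply: bdd_meas_exp_log; exact: ltW].
rewrite (_ : (fun u => _) = (fun u => u ^+ k.+1 * P (- ln u) x x
    + - (u ^+ k.+1 * expR (- V x * (- ln u))))); last first.
  by apply/funext => u; rewrite mulrBr.
rewrite int01D; [|exact: bddM|exact: bdd_measN].
rewrite int01N// -/(M k x x).
set X := int01 _ in ex *.
have -> : k.+2%:R * (M k x x + - X) = a k x * (m k x x - 1).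
  rewrite [LHS]mulrBr [RHS]mulrBr trap_kill_visits mulr1; congr (_ - _).
  have kV0 : k.+2%:R + V x != 0 by rewrite gt_eqF.
  have -> : X = (k.+2%:R + V x)^-1 by apply: (mulfI kV0); rewrite ex mulfV.
  by [].
apply: (@le_trans _ _ (a k x * (c x * (1 + dlt) + eps))).
  apply: ler_wpM2l; first exact: trap_kill_ge0.
  by rewrite lerBlDl; exact: trap_visits_diag.
by rewrite -[leRHS]mul1r ler_wpM2r// trap_kill_le1.
Qed.

End Estimates.
End TrapModel.

(** * Indicators of intervals and exponential bounds uniform in the rate *)

Section IndicatorIntegral.
Variable R : realType.

Lemma bdd_meas_indic (a b : R) : bdd_meas (\1_(`[a, b]%classic : set R) : R -> R).
Proof.
split; first exact: measurable_indic.
by exists 1 => u _; rewrite indicE; case: (_ \in _); rewrite ?normr1 ?normr0.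
Qed.

Lemma int01_indic (a b : R) : 0 <= a -> a <= b -> b <= 1 ->
  int01 (\1_(`[a, b]%classic : set R)) = b - a.
Proof.
move=> a0 ab b1; rewrite /int01 /Rintegral integral_indic//=.
rewrite (_ : _ `&` _ = `[a, b]%classic); last first.
  apply/seteqP; split => u /=; first by case.
  move=> uab; split => //; move: uab; rewrite !in_itv/= => /andP[au ub].
  by rewrite (le_trans a0 au) (le_trans ub b1).
rewrite lebesgue_measure_itv/= lte_fin.
move: ab; rewrite le_eqVlt => /predU1P[->|->//].
by rewrite ltxx subrr.
Qed.

(** The point is uniformity in [v], since trap rates range over all scales: the slope
    [v exp (- v s)] is at most [1 / s] because [x exp (- x) <= 1]. *)
Lemma expR_decr_diff (v s t : R) : 0 < v -> 0 < s -> s <= t ->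
  expR (- v * s) - expR (- v * t) <= (t - s) / s.
Proof.
move=> v0 s0 st.
have xe (x : R) : x * expR (- x) <= 1.
  rewrite expRN ler_pdivrMr ?expR_gt0// mul1r.
  by apply: le_trans (expR_ge1Dx x); rewrite lerDr.
have -> : expR (- v * t) = expR (- v * s) * expR (- (v * (t - s))).
  by rewrite -expRD; congr expR; ring.
rewrite -[X in X - _]mulr1 -mulrBr.
apply: (@le_trans _ _ (expR (- v * s) * (v * (t - s)))).
  apply: ler_wpM2l; first exact: expR_ge0.
  by have := expR_ge1Dx (- (v * (t - s))); lra.
rewrite ler_pdivlMr// (_ : _ * s = (v * s * expR (- (v * s))) * (t - s)).
  by rewrite -[leRHS]mul1r ler_wpM2r ?subr_ge0.
by rewrite -mulNr; ring.
Qed.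

Lemma mul_expRN_le (v t : R) : 0 < t -> v * expR (- t * v) <= t^-1.
Proof.
move=> t0; rewrite -(ler_pM2l t0) mulfV ?gt_eqF// mulrA mulNr expRN.
rewrite ler_pdivrMr ?expR_gt0// mul1r.
by apply: le_trans (expR_ge1Dx _); rewrite lerDr.
Qed.

End IndicatorIntegral.

(** * From resolvents to fixed times *)

Section TrapTime.
Variables (R : realType) (n : nat).
Hypothesis n_gt0 : (0 < n)%N.
Variable V : hcube n -> R.
Hypothesis V_gt0 : forall x, 0 < V x.
Local Notation P := (ctmc_kernel (trap_gen V)).

(* [P_t(x,x)] decreases in [t], so a large return probability at [th] forces
   a large integral over the window [(1 - eta) th, th]. *)
Lemma trap_return_le (th eta : R) x : 0 < th -> 0 < eta < 1 ->
  P th x x - expR (- V x * th) <= eta / (1 - eta) +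
   int01 (fun u => u ^+ 1 * (P (- ln u) x x - expR (- V x * (- ln u)))) /
   (expR (- th) * (expR (- (th * (1 - eta))) - expR (- th))).
Proof.
move=> th0 /andP[eta0 eta1].
(* The time window [[th (1 - eta), th]] becomes [[l, h]] in the variable [u = e^-t]. *)
set l := expR (- th); set h := expR (- (th * (1 - eta))).
have l0 : 0 < l by exact: expR_gt0.
have lh : l < h by rewrite ltr_expR; nra.
have h1 : h <= 1 by rewrite -expR0 ler_expR; nra.
have D0 t : 0 <= t -> 0 <= P t x x - expR (- V x * t).
  move=> t0; rewrite subr_ge0 -trap_gen_diag.
  by apply: ctmc_kernel_diag_ge => //; exact: trap_gen_offdiag.
(* [D1] bounds the excess return probability from below throughout the window: the kernel only
   increases when time goes back, and the exponential changes by at most [eta / (1 - eta)]. Outside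
   the window the excess is nonnegative and is dropped. *)
pose D1 := Num.max 0 (P th x x - expR (- V x * th) - eta / (1 - eta)).
have D10 : 0 <= D1 by rewrite le_max lexx.
have lwin u : 0 <= u <= 1 -> l * D1 * \1_(`[l, h]%classic : set R) u <=
    u ^+ 1 * (P (- ln u) x x - expR (- V x * (- ln u))).
  move=> /andP[u0 u1]; rewrite expr1 indicE.
  have nl0 : 0 <= - ln u by rewrite oppr_ge0 ln_le0.
  case: (boolP (u \in _)) => [|_]; last by rewrite mulr0 mulr_ge0// D0.
  rewrite inE/= in_itv/= => /andP[lu uh]; rewrite mulr1.
  have up : 0 < u by exact: lt_le_trans lu.
  have tth : - ln u <= th by rewrite lerNl -ler_expR lnK.
  have tth' : th * (1 - eta) <= - ln u by rewrite lerNr -ler_expR lnK.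
  have s0 : 0 < th * (1 - eta) by rewrite mulr_gt0// subr_gt0.
  have t0 : 0 < - ln u by exact: lt_le_trans tth'.
  apply: ler_pM; rewrite ?(ltW l0)// /D1 ge_max D0//=.
  have mono : P th x x <= P (- ln u) x x.
    apply: (ctmc_kernel_diag_antimono (pi := fun x => (V x)^-1)) => //.
    - by move=> y; rewrite invr_gt0.
    - exact: trap_gen_rev.
    - exact: trap_gen_sum0.
    - exact: trap_gen_offdiag.
  have := expR_decr_diff (V_gt0 x) t0 tth.
  have : (th - - ln u) / - ln u <= eta / (1 - eta).
    rewrite ler_pdivrMr// mulrAC ler_pdivlMr ?subr_gt0//.
    nra.
  lra.
have be := bdd_meas_exp_log (ltW (V_gt0 x)).
have bD : bdd_meas (fun u => u ^+ 1 * (P (- ln u) x x - expR (- V x * (- ln u)))).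
  apply: bdd_measM; first exact: bdd_measX.
  by apply: bdd_measD; [exact: trap_kernel_bdd|exact: bdd_measN].
have := le_int01 (bdd_measZ (l * D1) (bdd_meas_indic l h)) bD lwin.
rewrite int01Z; last exact: bdd_meas_indic.
rewrite int01_indic ?(ltW l0) ?(ltW lh)// => H.
have : D1 <= int01 (fun u => u ^+ 1 * (P (- ln u) x x - expR (- V x * (- ln u)))) /
   (l * (h - l)).
  rewrite ler_pdivlMr ?mulr_gt0 ?subr_gt0//; apply: le_trans H.
  by rewrite mulrA (mulrC D1).
have : P th x x - expR (- V x * th) - eta / (1 - eta) <= D1.
  by rewrite le_max lexx orbT.
lra.
Qed.

(** The probability of no jump during [[t, t + th]]: given the position [y] at time [t], the
    residual holding time is exponential of rate [V y]. *)
Definition trap_stay (th : R) x t : R := \sum_y P t x y * expR (- th * V y).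

(** In the derivative only the exits from [y] count negatively, and
    [V y * exp (- th * V y) <= 1 / th] whatever the rate. A one-sided Lipschitz constant free of [n]
    and of the environment is what upgrades moment convergence to pointwise convergence. *)
Lemma trap_stay_quasimono (th s t : R) x : 0 < th -> 0 <= s -> s <= t ->
  trap_stay th x s <= trap_stay th x t + (t - s) / th.
Proof.
move=> th0 s0 st.
suff : trap_stay th x s + s / th <= trap_stay th x t + t / th by rewrite mulrBl; lra.
apply: (derive_ge0_homo (f := fun t => trap_stay th x t + t / th) (df := fun t =>
    \sum_y (\sum_z P t x z * trap_gen V z y) * expR (- th * V y) + 1 / th) (a := 0)) => //.
  move=> {st}t; apply: derive_add.
    apply: derive_sum => y; apply: derive_mulr.
    exact: derive_kernel_r.
  by apply: derive_mulr.
move=> {st}t t0.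
have : - th^-1 <= \sum_y (\sum_z P t x z * trap_gen V z y) * expR (- th * V y).
  have <- : \sum_y P t x y * (- th^-1) = - th^-1.
    by rewrite -mulr_suml trap_kernel_sum1// mul1r.
  apply: ler_sum => y _.
  apply: (@le_trans _ _ (P t x y * trap_gen V y y * expR (- th * V y))).
    rewrite trap_gen_diag -mulrA mulNr ler_wpM2l ?trap_kernel_ge0//.
    by rewrite lerN2 mul_expRN_le.
  rewrite ler_wpM2r ?expR_ge0// (bigD1 y)//= lerDl.
  apply: sumr_ge0 => z zy; rewrite mulr_ge0 ?trap_kernel_ge0//.
  exact: trap_gen_offdiag.
rewrite div1r; lra.
Qed.

Lemma trap_stay_01 (th t : R) x : 0 < th -> 0 <= t -> 0 <= trap_stay th x t <= 1.
Proof.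
move=> th0 t0; apply/andP; split.
  by apply: sumr_ge0 => y _; rewrite mulr_ge0 ?expR_ge0 ?trap_kernel_ge0.
rewrite -(trap_kernel_sum1 n_gt0 V t x); apply: ler_sum => y _.
rewrite -[leRHS]mulr1 ler_wpM2l ?trap_kernel_ge0//.
by rewrite -expR0 ler_expR mulNr oppr_le0 mulr_ge0// ltW.
Qed.

Lemma continuous_trap_stay (th : R) x : continuous (trap_stay th x).
Proof.
move=> t; apply: cvg_sumr => y; apply: cvgMr_tmp.
exact: continuous_ctmc_kernel.
Qed.

Lemma trap_stay_resolvent (th : R) x k : 0 < th ->
  int01 (fun u => u ^+ k.+1 * trap_stay th x (- ln u)) =
  \sum_y trap_resolvent V k x y * expR (- th * V y).
Proof.
move=> th0.
have bP y : bdd_meas (fun u => u ^+ k.+1 * P (- ln u) x y).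
  by apply: bdd_measM; [exact: bdd_measX|exact: trap_kernel_bdd].
rewrite (_ : (fun u => _) = fun u => \sum_y expR (- th * V y) *
    (u ^+ k.+1 * P (- ln u) x y)); last first.
  apply/funext => u; rewrite /trap_stay mulr_sumr.
  by apply: eq_bigr => y _; ring.
rewrite int01_sum => [|y]; last exact: bdd_measZ.
by apply: eq_bigr => y _; rewrite int01Z// mulrC.
Qed.

(* Being at the same site at times 1 and 1 + th, versus never leaving the
   site occupied at time 1. *)
Lemma trap_same_stay (th B : R) x : 0 < th ->
  (forall y, P th y y - expR (- V y * th) <= B) ->
  trap_stay th x 1 <= \sum_y P 1 x y * P th y y <= trap_stay th x 1 + B.
Proof.
move=> th0 PB; apply/andP; split.
  apply: ler_sum => y _; rewrite ler_wpM2l ?trap_kernel_ge0//.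
  rewrite mulNr mulrC -mulNr -trap_gen_diag.
  by apply: ctmc_kernel_diag_ge; [exact: ltW|exact: trap_gen_offdiag].
have BE : \sum_y P 1 x y * B = B by rewrite -mulr_suml trap_kernel_sum1// mul1r.
rewrite -[X in _ + X]BE -big_split/=.
apply: ler_sum => y _; rewrite -mulrDr ler_wpM2l ?trap_kernel_ge0//.
by have := PB y; rewrite !mulNr (mulrC th); lra.
Qed.

End TrapTime.

(** * Pointwise convergence from moments and a one-sided Lipschitz bound *)

Section MomentInversion.
Variable R : realType.
Local Notation win c eta := (\1_(`[c - eta, c + eta]%classic : set R) : R -> R).

(** The Landau kernel without normalisation. On [[0, 1]] its base lies in [[0, 1]] and reaches 1
    only at [c], so high powers concentrate there while staying polynomial. *)
Definition landau_poly (c : R) (k : nat) : {poly R} := (1 - ('X - c%:P) ^+ 2) ^+ k.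

Lemma landau_polyE c k u : (landau_poly c k).[u] = (1 - (u - c) ^+ 2) ^+ k.
Proof. by rewrite /landau_poly !hornerE. Qed.

Lemma bdd_meas_poly (p : {poly R}) : bdd_meas (fun u => u * p.[u]).
Proof.
have -> : (fun u => u * p.[u]) = fun u => \sum_(i < size p) p`_i * u ^+ i.+1.
  apply/funext => u; rewrite horner_coef mulr_sumr; apply: eq_bigr => i _.
  by rewrite exprS; ring.
by apply: bdd_meas_sum => i; apply: bdd_measZ; exact: bdd_measX.
Qed.

Lemma landau_concentration (c eta eps : R) :
  0 < eta -> 0 < c - eta -> c + eta <= 1 -> 0 < eps ->
  exists k, let q u := u * (landau_poly c k).[u] in
    0 < int01 (fun u => q u * win c eta u) /\
    int01 (fun u => q u * (1 - win c eta u)) <=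
    eps * int01 (fun u => q u * win c eta u).
Proof.
move=> eta0 ce ce1 eps0.
have c0 : 0 < c by lra.
have c1 : c < 1 by lra.
have eta1 : eta < 1 by lra.
(* [A] bounds the base from above at distance more than [eta] from [c], [B] from below within
   [eta / 2]. [K] is the length [eta] of the inner window times the least value [c - eta / 2] of the
   extra factor [u]. A power with [(A/B)^k <= eps * K] suffices. *)
set A := 1 - eta ^+ 2; set B := 1 - (eta / 2) ^+ 2.
have A0 : 0 < A by rewrite /A; nra.
have AB : A < B by rewrite /A /B; nra.
have B0 : 0 < B by exact: lt_trans AB.
set K := (c - eta / 2) * eta.
have K0 : 0 < K by rewrite /K mulr_gt0//; lra.
have : (A / B) ^+ k @[k --> \oo] --> 0.
  apply: cvg_expr; rewrite ger0_norm ?divr_ge0 ?ltW//.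
  by rewrite ltr_pdivrMr// mul1r.
move=> /cvgr0Pnorm_le /(_ (eps * K)); rewrite mulr_gt0// => /(_ isT)[k _ /(_ k (leqnn k))].
have AB0 : 0 <= A / B by rewrite divr_ge0 ?(ltW A0) ?(ltW B0).
rewrite (ger0_norm (exprn_ge0 _ AB0)) => ABk; exists k => q.
have base u : 0 <= u <= 1 -> 0 <= 1 - (u - c) ^+ 2 <= 1.
  by move=> /andP[u0 u1]; rewrite subr_ge0 gerBl sqr_ge0 andbT; nra.
have bq : bdd_meas q by exact: bdd_meas_poly.
have bw e : bdd_meas (win c e) by exact: bdd_meas_indic.
have bi e : bdd_meas (fun u => q u * win c e u) by exact: bdd_measM.
have wE (e u : R) : win c e u = (`|u - c| <= e)%R%:R.
  by rewrite indicE mem_setE in_itv/= ler_distl.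
have inP : K * B ^+ k <= int01 (fun u => q u * win c eta u).
  have -> : K * B ^+ k = int01 (fun u => (c - eta / 2) * B ^+ k * win c (eta / 2) u).
    by rewrite int01Z// int01_indic /K; [field|lra..].
  apply: le_int01 => // [|u u01]; first exact: bdd_measZ.
  rewrite !wE; have /andP[b0 b1] := base u u01; case/andP: (u01) => u0 u1.
  have q0 : 0 <= q u by rewrite /q landau_polyE mulr_ge0// exprn_ge0.
  case: (lerP `|u - c| (eta / 2)) => [h|_]; last by rewrite mulr0 mulr_ge0// ler0n.
  have -> : `|u - c| <= eta by apply: le_trans h _; lra.
  rewrite !mulr1 /q landau_polyE; apply: ler_pM.
  - lra.
  - by rewrite exprn_ge0// ltW.
  - by move: h; rewrite ler_norml => /andP[]; lra.
  - rewrite lerXn2r ?nnegrE ?(ltW B0)// lerD2l lerN2 -[leLHS]real_normK ?num_real//.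
    by rewrite lerXn2r ?nnegrE//; lra.
have outP : int01 (fun u => q u * (1 - win c eta u)) <= A ^+ k.
  rewrite -[leRHS]int01_cst; apply: le_int01.
  - apply: bdd_measM => //; apply: bdd_measD; first exact: bdd_meas_cst.
    exact: bdd_measN.
  - exact: bdd_meas_cst.
  - move=> u u01; rewrite wE; have /andP[b0 b1] := base u u01.
    case/andP: (u01) => u0 u1.
    case: (lerP `|u - c| eta) => [_|h].
      by rewrite subrr mulr0 exprn_ge0// ltW.
    rewrite subr0 mulr1 /q landau_polyE -[leRHS]mul1r ler_pM// ?exprn_ge0//.
    rewrite lerXn2r ?nnegrE ?(ltW A0)// lerD2l lerN2 -[leRHS]real_normK ?num_real//.
    by rewrite lerXn2r ?nnegrE ?(ltW eta0)// ltW.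
split; first by apply: lt_le_trans inP; rewrite mulr_gt0// exprn_gt0.
apply: le_trans outP _; apply: (@le_trans _ _ (eps * (K * B ^+ k))).
  by move: ABk; rewrite expr_div_n ler_pdivrMr ?exprn_gt0// mulrA.
by rewrite ler_wpM2l// ltW.
Qed.

Section Convergence.
Variables (H_ : nat -> R -> R) (H : R -> R).
Hypothesis bH_ : forall n, bdd_meas (H_ n).
Hypothesis bH : bdd_meas H.
Hypothesis H_1 : \forall n \near \oo, forall u, 0 <= u <= 1 -> `|H_ n u| <= 1.
Hypothesis H1 : forall u, 0 <= u <= 1 -> `|H u| <= 1.
Hypothesis momH : forall k,
  int01 (fun u => u ^+ k.+1 * H_ n u) @[n --> \oo] -->
  int01 (fun u => u ^+ k.+1 * H u).

Lemma moment_cvg_poly (p : {poly R}) :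
  int01 (fun u => (u * p.[u]) * H_ n u) @[n --> \oo] -->
  int01 (fun u => (u * p.[u]) * H u).
Proof.
have E (G : R -> R) : bdd_meas G -> int01 (fun u => (u * p.[u]) * G u) =
    \sum_(i < size p) p`_i * int01 (fun u => u ^+ i.+1 * G u).
  move=> bG.
  have bi i : bdd_meas (fun u => u ^+ i.+1 * G u).
    by apply: bdd_measM => //; exact: bdd_measX.
  under [RHS]eq_bigr do rewrite -int01Z//.
  rewrite -int01_sum => [|i]; last exact: bdd_measZ.
  congr (int01 _); apply/funext => u; rewrite horner_coef mulr_sumr mulr_suml.
  by apply: eq_bigr => i _; rewrite exprS; ring.
rewrite E//; under eq_fun do rewrite E//.
by apply: cvg_sumr => i; apply: cvgMl_tmp; exact: momH.
Qed.

(** If [H_ n] exceeded [s + eps] on the whole window, its integral against the kernel would be at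
    least [(s + eps) Kin - Ko], while the limit is at most [s Kin + Ko]. With [Ko] and the
    convergence error both at most [eps / 4 * Kin], this is contradictory. *)
Lemma moment_cvg_window (c eta s eps : R) :
  0 < eta -> 0 < c - eta -> c + eta <= 1 -> 0 < eps ->
  (forall u, c - eta <= u <= c + eta -> H u <= s) ->
  \forall n \near \oo, exists2 u, c - eta <= u <= c + eta & H_ n u <= s + eps.
Proof.
move=> eta0 ce ce1 eps0 Hs.
have [|k [Kin0 Kout]] := @landau_concentration c eta (eps / 4) eta0 ce ce1.
  by rewrite divr_gt0.
pose q u := u * (landau_poly c k).[u].
pose Kin := int01 (fun u => q u * win c eta u).
pose Ko := int01 (fun u => q u * (1 - win c eta u)).
have {}Kin0 : 0 < Kin := Kin0.
have {}Kout : Ko <= eps / 4 * Kin := Kout.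
have qcvg := @moment_cvg_poly (landau_poly c k).
have q0 u : 0 <= u <= 1 -> 0 <= q u.
  move=> /andP[u0 u1]; rewrite /q landau_polyE mulr_ge0// exprn_ge0//.
  by rewrite subr_ge0; nra.
have bq : bdd_meas q by exact: bdd_meas_poly.
have bw : bdd_meas (win c eta) by exact: bdd_meas_indic.
have bi : bdd_meas (fun u => q u * win c eta u) by exact: bdd_measM.
have bo : bdd_meas (fun u => q u * (1 - win c eta u)).
  apply: bdd_measM => //; apply: bdd_measD; first exact: bdd_meas_cst.
  exact: bdd_measN.
have wE (u : R) : win c eta u = (c - eta <= u <= c + eta)%R%:R.
  by rewrite indicE mem_setE in_itv.
have up : int01 (fun u => q u * H u) <= s * Kin + Ko.
  rewrite -int01Z// -int01D//; last exact: bdd_measZ.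
  apply: le_int01; [exact: bdd_measM|by apply: bdd_measD => //; exact: bdd_measZ|].
  move=> u u01; rewrite wE; have qu := q0 u u01.
  have := H1 u01; rewrite ler_norml => /andP[_ Hu].
  case: (boolP (c - eta <= u <= c + eta)) => [/Hs Hus|_].
    by rewrite subrr mulr0 addr0 mulr1 (mulrC s) ler_wpM2l.
  by rewrite mulr0 mulr0 add0r subr0 ler_wpM2l.
have : \forall n \near \oo, int01 (fun u => q u * H_ n u) <
    int01 (fun u => q u * H u) + eps / 4 * Kin.
  apply: (cvgr_lt _ qcvg); rewrite ltrDl mulr_gt0// divr_gt0//.
apply: filterS2 H_1 => n Hn1 close.
apply: contrapT => /forall2NP noU.
have big u : c - eta <= u <= c + eta -> s + eps < H_ n u.
  by move=> uI; case: (noU u) => [//|/negP]; rewrite -ltNge.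
have low : (s + eps) * Kin - Ko <= int01 (fun u => q u * H_ n u).
  rewrite -int01Z// -int01N// -int01D; [|exact: bdd_measZ|exact: bdd_measN].
  apply: le_int01; [by apply: bdd_measD; [exact: bdd_measZ|exact: bdd_measN]|exact: bdd_measM|].
  move=> u u01; rewrite wE; have qu := q0 u u01.
  have := Hn1 _ u01; rewrite ler_norml => /andP[Hu _].
  case: (boolP (c - eta <= u <= c + eta)) => [/big Hus|_].
    by rewrite subrr mulr0 subr0 mulr1 (mulrC (s + eps)) ler_wpM2l// ltW.
  by rewrite mulr0 mulr0 add0r subr0 -mulrN ler_wpM2l.
have := Kout; nra.
Qed.

End Convergence.

(** A window ending at [u1] contains a point where [H_ n] is not much larger than [H u1]; a window
    starting at [u1], treated with the opposite functions, one where it is not much smaller. The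
    one-sided bound carries both estimates to [u1]. *)
Lemma moment_inversion (H_ : nat -> R -> R) (H : R -> R) (u1 C : R) :
  (forall n, bdd_meas (H_ n)) -> bdd_meas H ->
  (\forall n \near \oo, forall u, 0 <= u <= 1 -> `|H_ n u| <= 1) ->
  (forall u, 0 <= u <= 1 -> `|H u| <= 1) ->
  (forall k, int01 (fun u => u ^+ k.+1 * H_ n u) @[n --> \oo] -->
             int01 (fun u => u ^+ k.+1 * H u)) ->
  0 < u1 < 1 -> 0 < C ->
  (\forall n \near \oo, forall u v, u1 / 2 <= u -> u <= v -> v <= 1 ->
     H_ n v <= H_ n u + C * (v - u)) ->
  {for u1, continuous H} ->
  H_ n u1 @[n --> \oo] --> H u1.
Proof.
move=> bH_ bH H_1 H1 momH /andP[u10 u11] C0 quasi cH.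
apply/cvgrPdist_le => eps eps0.
have /cvgrPdist_le /(_ (eps / 4)) := cH; rewrite divr_gt0// => /(_ isT)[r /= r0 Hr].
(* In order: continuity of [H] covers both windows of width [2 eta]; the left one stays above
   [u1 / 2]; the right one stays below 1; the Lipschitz drift [2 C eta] is at most [eps / 4]. *)
pose eta := Num.min (Num.min (r / 4) (u1 / 4)) (Num.min ((1 - u1) / 2) (eps / (8 * C))).
have eta0 : 0 < eta by rewrite !lt_min !divr_gt0 ?mulr_gt0 ?subr_gt0.
have : eta <= eta by []; rewrite {2}/eta !le_min.
move=> /andP[/andP[er eu] /andP[e1 eC]].
have {}eC : 2 * C * eta <= eps / 4.
  by move: eC; rewrite ler_pdivlMr ?mulr_gt0//; lra.
have near u : `|u - u1| <= 2 * eta -> `|H u1 - H u| <= eps / 4.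
  move=> uu; apply: Hr; rewrite /ball/= distrC; apply: le_lt_trans uu _.
  lra.
have left_ := @moment_cvg_window H_ H bH_ bH H_1 H1 momH (u1 - eta) eta
  (H u1 + eps / 4) (eps / 4) eta0.
have right_ := @moment_cvg_window (fun n u => - H_ n u) (fun u => - H u)
  (fun n => bdd_measN (bH_ n)) (bdd_measN bH).
have {}right_ : \forall n \near \oo, exists2 u, u1 + eta - eta <= u <= u1 + eta + eta &
    - H_ n u <= - H u1 + eps / 4 + eps / 4.
  apply: right_ => //.
  - by apply: filterS H_1 => n Hn u /Hn; rewrite normrN.
  - by move=> u /H1; rewrite normrN.
  - move=> k.
    have iN (G : R -> R) : bdd_meas G -> int01 (fun u => u ^+ k.+1 * - G u) =
        - int01 (fun u => u ^+ k.+1 * G u).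
      move=> bG; under eq_fun do rewrite mulrN.
      by rewrite int01N//; apply: bdd_measM => //; exact: bdd_measX.
    rewrite iN// (_ : (fun n => _) = (fun n => - int01 (fun u => u ^+ k.+1 * H_ n u))).
      by apply: cvgN; exact: momH.
    by apply/funext => n; rewrite iN.
  - by rewrite addrK.
  - lra.
  - by rewrite divr_gt0.
  - move=> u /andP[ul ur].
    have : `|H u1 - H u| <= eps / 4 by apply: near; rewrite ler_norml; apply/andP; split; lra.
    by rewrite ler_norml => /andP[]; lra.
have {}left_ : \forall n \near \oo, exists2 u, u1 - eta - eta <= u <= u1 - eta + eta &
    H_ n u <= H u1 + eps / 4 + eps / 4.
  apply: left_; [lra|lra|by rewrite divr_gt0|].
  move=> u /andP[ul ur].
  have : `|H u1 - H u| <= eps / 4 by apply: near; rewrite ler_norml; apply/andP; split; lra.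
  by rewrite ler_norml => /andP[]; lra.
near=> n.
have [u /andP[ul ur] Hu] : exists2 u, u1 - eta - eta <= u <= u1 - eta + eta &
    H_ n u <= H u1 + eps / 4 + eps / 4 by near: n.
have [v /andP[vl vr] Hv] : exists2 u, u1 + eta - eta <= u <= u1 + eta + eta &
    - H_ n u <= - H u1 + eps / 4 + eps / 4 by near: n.
have qm : forall u v, u1 / 2 <= u -> u <= v -> v <= 1 ->
     H_ n v <= H_ n u + C * (v - u) by near: n.
have q1 : H_ n u1 <= H_ n u + C * (u1 - u) by apply: qm; lra.
have q2 : H_ n v <= H_ n u1 + C * (v - u1) by apply: qm; lra.
have w1 : C * (u1 - u) <= eps / 4 by apply: le_trans eC; rewrite (mulrC 2) -mulrA ler_pM2l//; lra.
have w2 : C * (v - u1) <= eps / 4 by apply: le_trans eC; rewrite (mulrC 2) -mulrA ler_pM2l//; lra.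
rewrite ler_norml; apply/andP; split; lra.
Unshelve. all: by end_near. Qed.

End MomentInversion.

(** * Expectations of bounded variables and almost sure convergence *)

Section BoundedExpectation.
Context {d : measure_display} {T : measurableType d} {R : realType}.
Variable P : probability T R.
Implicit Types (f g : T -> R).

Definition Ex f : R := \int[P]_w f w.

Definition bdd_rv f := measurable_fun [set: T] f /\ exists M, forall w, `|f w| <= M.

Lemma bdd_rv_integrable f : bdd_rv f -> P.-integrable setT (EFin \o f).
Proof.
move=> [mf [M fM]]; apply: measurable_bounded_integrable => //.
  by rewrite [X in (X < _)%E]probability_setT ltry.
exists M; split; first exact: num_real.
by move=> M' MM' w _ /=; rewrite (le_trans (fM w))// ltW.
Qed.

Lemma bdd_rvD f g : bdd_rv f -> bdd_rv g -> bdd_rv (fun w => f w + g w).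
Proof.
move=> [mf [M fM]] [mg [N gN]]; split; first exact: measurable_funD.
by exists (M + N) => w; rewrite (le_trans (ler_normD _ _))// lerD.
Qed.

Lemma bdd_rvM f g : bdd_rv f -> bdd_rv g -> bdd_rv (fun w => f w * g w).
Proof.
move=> [mf [M fM]] [mg [N gN]]; split; first exact: measurable_funM.
by exists (M * N) => w; rewrite normrM ler_pM.
Qed.

Lemma bdd_rv_cst (c : R) : bdd_rv (fun=> c).
Proof. by split; [exact: measurable_cst|exists `|c|]. Qed.

Lemma bdd_rvZ f (c : R) : bdd_rv f -> bdd_rv (fun w => c * f w).
Proof. by move=> fb; apply: bdd_rvM => //; exact: bdd_rv_cst. Qed.

Lemma bdd_rv_sum (I : finType) (S : pred I) (F : I -> T -> R) :
  (forall i, bdd_rv (F i)) -> bdd_rv (fun w => \sum_(i | S i) F i w).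
Proof.
move=> bF; rewrite (_ : (fun w => _) = \sum_(i | S i) F i); last first.
  by apply/funext => u; rewrite fct_sumE.
elim/big_ind : _ => [|f g|i _]; [exact: bdd_rv_cst|exact: bdd_rvD|exact: bF].
Qed.

Lemma ExD f g : bdd_rv f -> bdd_rv g -> Ex (fun w => f w + g w) = Ex f + Ex g.
Proof. by move=> bf bg; rewrite /Ex RintegralD//; exact: bdd_rv_integrable. Qed.

Lemma ExZ f (c : R) : bdd_rv f -> Ex (fun w => c * f w) = c * Ex f.
Proof. by move=> bf; rewrite /Ex RintegralZl//; exact: bdd_rv_integrable. Qed.

Lemma Ex_cst (c : R) : Ex (fun=> c) = c.
Proof. by rewrite /Ex Rintegral_cst// [X in fine X]probability_setT mulr1. Qed.

Lemma Ex_sum (I : finType) (S : pred I) (F : I -> T -> R) :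
  (forall i, bdd_rv (F i)) ->
  Ex (fun w => \sum_(i | S i) F i w) = \sum_(i | S i) Ex (F i).
Proof.
move=> bF; rewrite (_ : (fun w => _) = \sum_(i | S i) F i); last first.
  by apply/funext => u; rewrite fct_sumE.
suff : bdd_rv (\sum_(i | S i) F i) /\
  Ex (\sum_(i | S i) F i) = \sum_(i | S i) Ex (F i) by case.
elim/big_ind2 : _ => [|f a g b [bf fa] [bg gb]|//].
  by split; [exact: bdd_rv_cst|exact: Ex_cst].
by split; [exact: bdd_rvD|rewrite ExD// fa gb].
Qed.

Lemma le_Ex f g : bdd_rv f -> bdd_rv g -> (forall w, f w <= g w) -> Ex f <= Ex g.
Proof.
move=> bf bg fg.
exact: le_Rintegral (bdd_rv_integrable bf) (bdd_rv_integrable bg) _.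
Qed.

Lemma Ex_ge0 f : (forall w, 0 <= f w) -> 0 <= Ex f.
Proof. by move=> f0; apply: Rintegral_ge0 => w _. Qed.

Lemma EFin_Ex f : bdd_rv f -> (\int[P]_w (f w)%:E)%E = (Ex f)%:E.
Proof.
move=> bf; rewrite /Ex /Rintegral fineK//; apply: integrable_fin_num => //.
exact: bdd_rv_integrable.
Qed.

(** The series of the [Z n.+1] has finite expectation, so it is finite almost surely and its terms
    tend to 0. The bound is asked from index 1 on, since the law of the environment is prescribed in
    positive dimension only. *)
Lemma ae_cvg0_of_summable (Z : nat -> T -> R) (u : nat -> R) :
  (forall n, bdd_rv (Z n)) -> (forall n w, 0 <= Z n w) ->
  (forall n, Ex (Z n.+1) <= u n) -> cvgn (series u) ->
  {ae P, forall w, Z n w @[n --> \oo] --> 0}.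
Proof.
move=> bZ Z0 Zu cu.
pose S w := (\sum_(n <oo) (Z n.+1 w)%:E)%E.
have Z0' n w : (0 <= (Z n.+1 w)%:E)%E by rewrite lee_fin.
have mZ n : measurable_fun setT (fun w => (Z n.+1 w)%:E).
  by apply/measurable_EFinP; case: (bZ n.+1).
have intS : (\int[P]_w S w < +oo)%E.
  rewrite integral_nneseries//.
  apply: (@le_lt_trans _ _ (\sum_(n <oo) (u n)%:E)%E).
    apply: lee_nneseries => [n _ _|n _].
      by apply: integral_ge0 => w _.
    by rewrite EFin_Ex// lee_fin Zu.
  rewrite (_ : (\sum_(n <oo) (u n)%:E)%E = (limn (series u))%:E) ?ltry//.
  rewrite -EFin_lim//; congr (lim (_ @ \oo)); apply/funext => n /=.
  by rewrite sumEFin.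
have mS : measurable_fun setT S.
  by apply: ge0_emeasurable_sum.
have iS : P.-integrable setT S.
  apply/integrableP; split => //.
  under eq_integral do rewrite gee0_abs ?nneseries_ge0//.
  exact: intS.
apply: filterS (integrable_ae measurableT iS) => w /(_ I) Sfin.
rewrite -(cvg_shiftS (fun n => Z n w)).
have : (\sum_(n <oo) (Z n.+1 w)%:E < +oo)%E.
  by rewrite -ge0_fin_numE// nneseries_ge0.
move=> Sw; apply: cvg_series_cvg_0.
apply: nondecreasing_is_cvgn.
  by apply: nondecreasing_series => n _ _; exact: Z0.
exists (fine (S w)) => _ [n _ <-].
rewrite -lee_fin fineK// /series/= -sumEFin.
by apply: nneseries_lim_ge.
Qed.

End BoundedExpectation.

(** * Product formula for expectations of independent variables *)

Section Independence.
Context {d : measure_display} {T : measurableType d} {R : realType}.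
Variable P : probability T R.

(** Independence identifies the joint law with the product of the marginals, by uniqueness of the
    product measure; Tonelli then separates the integrals. *)
Lemma indep_Ex_prod (X Y : T -> R) (phi psi : R -> R) :
  measurable_fun [set: T] X -> measurable_fun [set: T] Y ->
  (forall A B, measurable A -> measurable B ->
     P (X @^-1` A `&` Y @^-1` B) = (P (X @^-1` A) * P (Y @^-1` B))%E) ->
  measurable_fun [set: R] phi -> measurable_fun [set: R] psi ->
  (forall r, 0 <= phi r <= 1) -> (forall r, 0 <= psi r <= 1) ->
  Ex P (fun w => phi (X w) * psi (Y w)) =
  Ex P (fun w => phi (X w)) * Ex P (fun w => psi (Y w)).
Proof.
move=> mX mY indep mphi mpsi phi01 psi01.
have bX : bdd_rv (fun w => phi (X w)).
  split; first exact: measurableT_comp.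
  by exists 1 => w; case/andP: (phi01 (X w)) => ? ?; rewrite ger0_norm.
have bY : bdd_rv (fun w => psi (Y w)).
  split; first exact: measurableT_comp.
  by exists 1 => w; case/andP: (psi01 (Y w)) => ? ?; rewrite ger0_norm.
apply: EFin_inj; rewrite EFinM -!EFin_Ex//; last exact: bdd_rvM.
pose X' : {mfun T >-> R} := mfun_Sub (mem_set mX).
pose Y' : {mfun T >-> R} := mfun_Sub (mem_set mY).
have mXY : measurable_fun [set: T] (fun w => (X w, Y w)) by exact: measurable_fun_pair.
pose XY : {mfun T >-> (R * R)%type} := mfun_Sub (mem_set mXY).
have prodE A : measurable A -> A `<=` setT ->
    (distribution P X' \x distribution P Y')%E A = distribution P XY A.
  by move=> mA _; exact: product_measure_unique.
pose f (z : R * R) := (phi z.1 * psi z.2)%:E.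
have f0 z : (0 <= f z)%E.
  rewrite lee_fin; case/andP: (phi01 z.1) => ? _; case/andP: (psi01 z.2) => ? _.
  exact: mulr_ge0.
have mf : measurable_fun setT f.
  apply/measurable_EFinP; apply: measurable_funM.
    exact: (measurableT_comp mphi measurable_fst).
  exact: (measurableT_comp mpsi measurable_snd).
have -> : (\int[P]_w (phi (X w) * psi (Y w))%:E = \int[distribution P XY]_z f z)%E.
  by rewrite ge0_integral_distribution.
rewrite -(eq_measure_integral _ prodE) fubini_tonelli1//.
have psiE : (\int[distribution P Y']_y (psi y)%:E = \int[P]_w (psi (Y w))%:E)%E.
  rewrite ge0_integral_distribution//; first exact/measurable_EFinP.
  by move=> y; rewrite lee_fin; case/andP: (psi01 y).
have phiE : (\int[distribution P X']_x (phi x)%:E = \int[P]_w (phi (X w))%:E)%E.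
  rewrite ge0_integral_distribution//; first exact/measurable_EFinP.
  by move=> y; rewrite lee_fin; case/andP: (phi01 y).
rewrite /fubini_F/= /f/=.
transitivity (\int[distribution P X']_x ((phi x)%:E * (Ex P (fun w => psi (Y w)))%:E))%E.
  apply: eq_integral => x _; under eq_integral do rewrite EFinM.
  rewrite ge0_integralZl//.
  - by rewrite psiE EFin_Ex.
  - exact/measurable_EFinP.
  - by move=> y _; rewrite lee_fin; case/andP: (psi01 y).
  - by rewrite lee_fin; case/andP: (phi01 x).
rewrite ge0_integralZr//.
- by rewrite phiE !EFin_Ex.
- exact/measurable_EFinP.
- by move=> y _; rewrite lee_fin; case/andP: (phi01 y).
- by rewrite lee_fin; apply: Ex_ge0 => w; case/andP: (psi01 (Y w)).
Qed.

Lemma mutually_independent_pair (J : finType) (X : J -> T -> R) (i j : J) :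
  mutually_independent P X -> i != j ->
  forall A B, measurable A -> measurable B ->
  P (X i @^-1` A `&` X j @^-1` B) = (P (X i @^-1` A) * P (X j @^-1` B))%E.
Proof.
move=> indep ij A B mA mB.
pose C k := if k == i then A else if k == j then B else setT.
have mC k : measurable (C k) by rewrite /C; do 2?case: ifP.
have := indep C mC.
rewrite (_ : \bigcap_(k in _) _ = X i @^-1` A `&` X j @^-1` B); last first.
  apply/seteqP; split => w.
    move=> H; split; first by have := H i I; rewrite /C eqxx.
    by have := H j I; rewrite /C eqxx [j == i]eq_sym (negPf ij).
  move=> [HA HB] k _; rewrite /C /=; case: eqP => [->//|_].
  by case: eqP => [->//|_].
rewrite (bigD1 i)//= (bigD1 j)/=; last by rewrite eq_sym.
rewrite big1 => [|k /andP[ki kj]].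
  by rewrite mule1 /C eqxx [j == i]eq_sym (negPf ij) eqxx.
by rewrite /C (negPf ki) (negPf kj) preimage_setT probability_setT.
Qed.

End Independence.

(** * Expectations read off distribution functions *)

Section LayerCake.
Variable R : realType.
Local Notation leb := (@lebesgue_measure R).
Implicit Types (s r x : R).

(** At [r = V_y / mu] and [s = theta * mu] this is [a_y * exp (- theta * V_y)], and [s = 0] gives
    [a_y] alone: one family covers all the site sums. The absolute value keeps it positive and
    continuous on the whole line. *)
Definition chi s r : R := expR (- s * r) / (1 + `|r|).

(** Minus the derivative of [chi s] on the nonnegative half-line. *)
Definition dchi s r : R := expR (- s * r) * (s / (1 + `|r|) + (1 + `|r|) ^- 2).

Let den_gt0 r : 0 < 1 + `|r|.
Proof. by rewrite ltr_pwDl. Qed.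

Lemma chi_gt0 s r : 0 < chi s r.
Proof. by rewrite divr_gt0// expR_gt0. Qed.

Lemma chi_le1 s r : 0 <= s -> 0 <= r -> chi s r <= 1.
Proof.
move=> s0 r0; rewrite ler_pdivrMr// mul1r (@le_trans _ _ 1)//.
  by rewrite -expR0 ler_expR mulNr oppr_le0 mulr_ge0.
by rewrite lerDl.
Qed.

Lemma dchi_ge0 s r : 0 <= s -> 0 <= dchi s r.
Proof.
move=> s0; rewrite mulr_ge0 ?expR_ge0// addr_ge0//.
by rewrite divr_ge0// ltW.
Qed.

Let cont_exp s : continuous (fun r => expR (- s * r)).
Proof. exact: (is_derive_continuous (fun t => derive_expRM (- s) t)). Qed.

Let cont_den : continuous (fun r : R => (1 + `|r|)^-1).
Proof.
move=> r; apply: cvgV; first by rewrite gt_eqF.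
by apply: cvgD; [exact: cvg_cst|exact: norm_continuous].
Qed.

Lemma continuous_chi s : continuous (chi s).
Proof. by move=> r; apply: cvgM; [exact: cont_exp|exact: cont_den]. Qed.

Lemma continuous_dchi s : continuous (dchi s).
Proof.
move=> r; apply: cvgM; first exact: cont_exp.
apply: cvgD; first by apply: cvgMl_tmp; exact: cont_den.
under eq_fun do rewrite -exprVn.
rewrite -exprVn.
have := @continuous_comp _ _ _ (fun r : R => (1 + `|r|)^-1) (fun y => y ^+ 2) r.
apply; first exact: cont_den.
exact: exprn_continuous.
Qed.

Lemma integral_dchi s x : 0 <= s -> 0 <= x ->
  (\int[leb]_(r in `[x, +oo[) (dchi s r)%:E = (chi s x)%:E)%E.
Proof.
move=> s0 x0; pose F r : R := - (expR (- s * r) * (1 + r)^-1).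
have Fd r : 0 <= r -> is_derive r 1 F (dchi s r).
  move=> r0; have r1 : 1 + r != 0 by rewrite gt_eqF// ltr_pwDl.
  have d1 : is_derive r 1 (fun r => 1 + r) (1 : R).
    by have := derive_add (is_derive_cst (1 : R) r 1) (is_derive_id r (1 : R)); rewrite add0r.
  have dV := is_deriveV r1 d1.
  apply: is_derive_eq (is_deriveN (derive_mul (derive_expRM (- s) r) dV)) _.
  rewrite /dchi ger0_norm// /GRing.scale/= mulr1; field.
  exact: r1.
rewrite (@ge0_continuous_FTC2y _ (dchi s) F x 0).
- by rewrite /F sub0e -EFinN opprK /chi ger0_norm.
- by move=> r _; exact: dchi_ge0.
- by apply: continuous_subspaceT; exact: continuous_dchi.
- apply/cvgrPdist_le => e e0; near=> r.
  have r0 : 0 < r by near: r; exact: nbhs_pinfty_gt.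
  have re : e^-1 <= r by near: r; apply: nbhs_pinfty_ge; exact: num_real.
  rewrite sub0r opprK ger0_norm; last by rewrite mulr_ge0 ?expR_ge0// invr_ge0 addr_ge0// ltW.
  apply: (@le_trans _ _ (1 * e)); last by rewrite mul1r.
  apply: ler_pM; rewrite ?expR_ge0 ?invr_ge0 ?addr_ge0 ?(ltW r0)//.
    by rewrite -expR0 ler_expR mulNr oppr_le0 mulr_ge0// ltW.
  rewrite -[leRHS]invrK lef_pV2 ?posrE ?invr_gt0 ?ltr_pwDl ?(ltW r0)//.
  by apply: le_trans re _; rewrite lerDr.
- by move=> r xr; case: (Fd r (ltW (le_lt_trans x0 xr))).
- by apply: cvg_at_right_filter; exact: is_derive_continuous_at (Fd x x0).
- move=> r; rewrite in_itv/= andbT => xr; rewrite derive1E.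
  by case: (Fd r (ltW (le_lt_trans x0 xr))).
Unshelve. all: by end_near. Qed.

(** [chi s x] is the integral of [dchi s] over [[x, +oo[], and Tonelli exchanges the integrals. The
    measure is general because the formula serves both the environment and Lebesgue measure. *)
Lemma layer_cake (d : measure_display) (T : measurableType d)
  (m : {sigma_finite_measure set T -> \bar R}) (D : set T) (X : T -> R) s :
  measurable D -> measurable_fun [set: T] X -> (forall w, D w -> 0 <= X w) ->
  0 <= s ->
  (\int[m]_(w in D) (chi s (X w))%:E =
   \int[leb]_(r in `[0%R, +oo[) ((dchi s r)%:E * m (D `&` [set w | (X w <= r)%R])))%E.
Proof.
move=> mD mX X0 s0.
pose A : set (T * R) := [set z | D z.1 /\ X z.1 <= z.2].
have mle : measurable [set z : T * R | X z.1 <= z.2].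
  have mB : measurable_fun [set: T * R] (fun z => z.2 - X z.1).
    apply: measurable_funB; first exact: measurable_snd.
    exact: (measurableT_comp mX measurable_fst).
  have := mB measurableT _ (measurable_itv `[0, +oo[); rewrite setTI.
  rewrite (_ : _ @^-1` _ = [set z : T * R | X z.1 <= z.2])//.
  by apply/seteqP; split => z /=; rewrite in_itv/= andbT subr_ge0.
have mA : measurable A.
  rewrite (_ : A = (D `*` setT) `&` [set z : T * R | X z.1 <= z.2]).
    by apply: measurableI => //; exact: measurableX.
  by apply/seteqP; split => z; [move=> [? ?]|move=> [[? _] ?]].
pose f (z : T * R) := (\1_A z * dchi s z.2)%:E.
have mdchi : measurable_fun [set: R] (dchi s).
  by apply: continuous_measurable_fun; exact: continuous_dchi.
have mf : measurable_fun setT f.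
  apply/measurable_EFinP; apply: measurable_funM; first exact: measurable_indic.
  exact: (measurableT_comp mdchi measurable_snd).
have f0 z : (0 <= f z)%E.
  by rewrite lee_fin mulr_ge0 ?dchi_ge0.
have := @fubini_tonelli _ _ T _ R m leb f mf f0.
have -> : (\int[m]_w \int[leb]_r f (w, r) = \int[m]_(w in D) (chi s (X w))%:E)%E.
  rewrite [RHS]integral_mkcond; apply: eq_integral => w _.
  rewrite patchE; case: ifPn => [|]; rewrite ?inE => Dw.
    rewrite -integral_dchi ?X0// [RHS]integral_mkcond; apply: eq_integral => r _.
    rewrite patchE /f indicE mem_setE in_itv/= andbT.
    case: (boolP (X w <= r)) => h.
      by rewrite (_ : _ \in A = true) ?mul1r//; apply/mem_set.
    rewrite (_ : _ \in A = false) ?mul0r//; apply/negbTE; rewrite notin_setE.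
    by move=> [_ /=]; apply/negP.
  rewrite -[RHS](integral0 leb setT); apply: eq_integral => r _.
  rewrite /f indicE (_ : _ \in A = false) ?mul0r//.
  apply/negbTE; rewrite notin_setE => -[Dw' _].
  by move: Dw; rewrite notin_setE.
move=> ->; rewrite [RHS]integral_mkcond; apply: eq_integral => r _.
have mDr : measurable (D `&` [set w | X w <= r]).
  apply: measurableI => //; rewrite -[X in measurable X]setTI.
  by have := mX measurableT _ (measurable_itv `]-oo, r]); rewrite set_itvNyc.
transitivity ((dchi s r)%:E * m (D `&` [set w | (X w <= r)%R]))%E.
  have <- : (\int[m]_w (\1_(D `&` [set w | (X w <= r)%R]) w)%:E =
      m (D `&` [set w | (X w <= r)%R]))%E by rewrite integral_indic// setIT.
  rewrite -ge0_integralZl//.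
  - by apply: eq_integral => w _; rewrite /f mulrC EFinM; congr (_ * _%:E)%E.
  - exact/measurable_EFinP/measurable_indic.
  - by rewrite lee_fin dchi_ge0.
rewrite patchE; case: ifPn => //; rewrite notin_setE/= in_itv/= andbT => /negP.
rewrite -ltNge => r0; rewrite (_ : _ `&` _ = set0) ?measure0 ?mule0//.
by apply/seteqP; split => w // -[/X0 Xw /= Xr]; have := le_lt_trans (le_trans Xw Xr) r0; rewrite ltxx.
Qed.

End LayerCake.

(** * The limit measure of the rates and the convergence of rescaled expectations *)

Section StableConstants.
Variables (R : realType) (alpha : R).
Hypothesis alpha01 : 0 < alpha < 1.
Local Notation leb := (@lebesgue_measure R).
Local Notation p := (alpha^-1).
Implicit Types (s r x : R).

Let a0 : 0 < alpha. Proof. by case/andP: alpha01. Qed.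
Let a1 : alpha < 1. Proof. by case/andP: alpha01. Qed.
Let p1 : 1 < p. Proof. by rewrite invf_gt1. Qed.
Let p0 : 0 < p. Proof. by rewrite invr_gt0. Qed.

Lemma powR_le_inv x r : 0 <= x -> 0 <= r -> (x `^ p <= r) = (x <= r `^ alpha).
Proof.
move=> x0 r0; apply/idP/idP => h.
  have -> : x = (x `^ p) `^ alpha by rewrite -powRrM mulVf ?gt_eqF// powRr1.
  by apply: ge0_ler_powR => //; rewrite ?nnegrE ?powR_ge0// ltW.
have -> : r = (r `^ alpha) `^ p by rewrite -powRrM mulfV ?gt_eqF// powRr1.
by apply: ge0_ler_powR => //; rewrite ?nnegrE ?powR_ge0// ltW.
Qed.

Lemma lebesgue_powR_sublevel r : 0 <= r ->
  leb (`[0, +oo[%classic `&` [set x | x `^ p <= r]) = (r `^ alpha)%:E.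
Proof.
move=> r0; rewrite (_ : _ `&` _ = `[0, r `^ alpha]%classic); last first.
  apply/seteqP; split => x /=; rewrite !in_itv/= ?andbT.
    by move=> [x0]; rewrite powR_le_inv// x0.
  by move=> /andP[x0 xr]; rewrite powR_le_inv.
rewrite lebesgue_measure_itv/= lte_fin oppr0 adde0.
by case: ltP => // h; congr (_%:E); apply/eqP; rewrite eq_le powR_ge0.
Qed.

(** After rescaling, the law of the rates tends to the measure with distribution function [r^alpha],
    the image of Lebesgue measure under [x^(1/alpha)]; this is the integral of [chi s] against
    it. *)
Definition stab_int s : \bar R := (\int[leb]_(x in `[0%R, +oo[) (chi s (x `^ p))%:E)%E.

Definition stabC s : R := fine (stab_int s).

Let mpow : measurable_fun [set: R] (fun x : R => x `^ p).
Proof. exact: measurable_powR. Qed.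

Lemma measurable_chi_pow s : measurable_fun [set: R] (fun x : R => chi s (x `^ p)).
Proof.
apply: measurableT_comp (mpow) => //.
by apply: continuous_measurable_fun; exact: continuous_chi.
Qed.

Lemma stab_intE s : 0 <= s ->
  stab_int s = (\int[leb]_(r in `[0%R, +oo[) (dchi s r * r `^ alpha)%:E)%E.
Proof.
move=> s0; rewrite /stab_int layer_cake//; last first.
  by move=> x _; exact: powR_ge0.
apply: eq_integral => r; rewrite inE/= in_itv/= andbT => r0.
by rewrite lebesgue_powR_sublevel// -EFinM.
Qed.

(** From [1 + x <= 2 max(1, x)]. It bounds the integrand of [stab_int] by a multiple of
    [(1 + x)^(-p)], integrable because [p = 1 / alpha > 1]. *)
Lemma one_plus_powR_le x : 0 <= x -> (1 + x) `^ p <= 2 `^ p * (1 + x `^ p).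
Proof.
move=> x0; have pw0 : 0 <= x `^ p by exact: powR_ge0.
case: (leP x 1) => h.
  apply: (@le_trans _ _ (2 `^ p)).
    apply: ge0_ler_powR; rewrite ?nnegrE ?(ltW p0) ?addr_ge0//; lra.
  by rewrite ler_peMr ?powR_ge0// lerDl.
apply: (@le_trans _ _ ((2 * x) `^ p)).
  apply: ge0_ler_powR; rewrite ?nnegrE ?(ltW p0) ?addr_ge0 ?mulr_ge0//; lra.
by rewrite powRM// ler_wpM2l ?powR_ge0// lerDr.
Qed.

Lemma integral_one_plus_powR :
  (\int[leb]_(x in `[0%R, +oo[) ((1 + `|x|) `^ (- p))%:E = ((p - 1)^-1)%:E)%E.
Proof.
pose F x : R := - ((p - 1)^-1 * (1 + x) `^ (1 - p)).
have q0 : 0 < p - 1 by rewrite subr_gt0.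
have pos x : 0 <= x -> 0 < 1 + x by move=> x0; rewrite ltr_pwDl.
have posn x : 0 < 1 + `|x| by rewrite ltr_pwDl.
have Fd x : 0 <= x -> is_derive x 1 F ((1 + `|x|) `^ (- p)).
  move=> x0.
  have d1 : is_derive x 1 (fun r => 1 + r) (1 : R).
    by have := derive_add (is_derive_cst (1 : R) x 1) (is_derive_id x (1 : R)); rewrite add0r.
  have dp := @is_derive1_comp R (fun y => y `^ (1 - p)) (fun r => 1 + r) x _ _
    (is_derive1_powR (1 - p) (pos x x0)) d1.
  apply: is_derive_eq (is_deriveN (derive_mull (p - 1)^-1 dp)) _.
  rewrite ger0_norm// mulr1 -addrA (addrC (- p)) addrA subrr add0r.
  by rewrite -[1 - p]opprB mulNr mulrN opprK mulKf// gt_eqF.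
rewrite (@ge0_continuous_FTC2y _ (fun x => (1 + `|x|) `^ (- p)) F 0 0).
- by rewrite /F addr0 powR1 mulr1 sub0e -EFinN opprK.
- by move=> x _; exact: powR_ge0.
- apply: continuous_subspaceT => x.
  have := @continuous_comp _ _ _ (fun x : R => 1 + `|x|) (fun y => y `^ (- p)) x.
  apply; first by apply: cvgD; [exact: cvg_cst|exact: norm_continuous].
  exact: is_derive_continuous_at (is_derive1_powR (- p) (posn x)).
- rewrite -oppr0; apply: cvgN; rewrite -(mulr0 (p - 1)^-1); apply: cvgMl_tmp.
  apply/cvgrPdist_le => e e0; near=> x.
  have x0 : 0 < x by near: x; exact: nbhs_pinfty_gt.
  have xe : e `^ (- (p - 1)^-1) <= x by near: x; apply: nbhs_pinfty_ge; exact: num_real.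
  rewrite sub0r normrN ger0_norm ?powR_ge0//.
  have -> : e = (e `^ (- (p - 1)^-1)) `^ (1 - p).
    rewrite -powRrM (_ : - (p - 1)^-1 * (1 - p) = 1) ?powRr1 ?ltW//.
    by rewrite -[1 - p]opprB mulrNN mulVf// gt_eqF.
  have y0 : 0 < e `^ (- (p - 1)^-1) by exact: powR_gt0.
  move: (e `^ _) y0 xe => y y0 yx; have x1 : 0 < 1 + x by exact: pos (ltW x0).
  rewrite -opprB !powRN lef_pV2 ?posrE ?powR_gt0//.
  apply: ge0_ler_powR; rewrite ?nnegrE ?(ltW q0) ?(ltW y0) ?(ltW x1)//.
  by apply: le_trans yx _; rewrite lerDr.
- by move=> x x0; case: (Fd x (ltW x0)).
- by apply: cvg_at_right_filter; exact: is_derive_continuous_at (Fd 0 (lexx 0)).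
- move=> x; rewrite in_itv/= andbT => x0; rewrite derive1E.
  by case: (Fd x (ltW x0)).
Unshelve. all: by end_near. Qed.

Lemma chi_pow_le s x : 0 <= s -> 0 <= x ->
  chi s (x `^ p) <= 2 `^ p * (1 + `|x|) `^ (- p).
Proof.
move=> s0 x0; have pw0 : 0 <= x `^ p by exact: powR_ge0.
have pw1 : 0 < 1 + x `^ p by rewrite ltr_pwDl.
have pw2 : 0 < (1 + x) `^ p by rewrite powR_gt0// ltr_pwDl.
rewrite /chi !ger0_norm// powRN; apply: (@le_trans _ _ (1 / (1 + x `^ p))).
  rewrite ler_wpM2r ?invr_ge0 ?(ltW pw1)//.
  by rewrite -expR0 ler_expR mulNr oppr_le0 mulr_ge0.
rewrite ler_pdivrMr// mulrAC ler_pdivlMr// mul1r.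
exact: one_plus_powR_le.
Qed.

Lemma stab_int_fin s : 0 <= s -> stab_int s = (stabC s)%:E.
Proof.
move=> s0; rewrite /stabC fineK// ge0_fin_numE; last first.
  by apply: integral_ge0 => x _; rewrite lee_fin ltW// chi_gt0.
apply: (@le_lt_trans _ _ (\int[leb]_(x in `[0%R, +oo[)
    ((2 `^ p)%:E * ((1 + `|x|) `^ (- p))%:E))%E).
  apply: ge0_le_integral => //.
  - by move=> x _; rewrite lee_fin ltW// chi_gt0.
  - apply/measurable_EFinP; apply: measurable_funTS; exact: measurable_chi_pow.
  - apply: emeasurable_funM => //; apply/measurable_EFinP.
    apply: measurable_funTS; apply: (measurableT_comp (measurable_powR _)).
    by apply: measurable_funD => //; exact: normr_measurable.
  - move=> x; rewrite /= in_itv/= andbT => x0; rewrite -EFinM lee_fin.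
    exact: chi_pow_le.
rewrite ge0_integralZl//.
- by rewrite integral_one_plus_powR -EFinM ltry.
- apply/measurable_EFinP.
  apply: measurable_funTS; apply: (measurableT_comp (measurable_powR _)).
  by apply: measurable_funD => //; exact: normr_measurable.
Qed.

Lemma stabC_gt0 s : 0 <= s -> 0 < stabC s.
Proof.
move=> s0; rewrite -lte_fin -stab_int_fin//.
have c0 : 0 < expR (- s) / 2 by rewrite divr_gt0// expR_gt0.
apply: (@lt_le_trans _ _ (expR (- s) / 2)%:E); first by rewrite lte_fin.
apply: (@le_trans _ _ (\int[leb]_(x in `[0%R, 1%R]) (chi s (x `^ p))%:E)%E).
  have -> : ((expR (- s) / 2)%:E = \int[leb]_(x in `[0%R, 1%R]) (expR (- s) / 2)%:E)%E.
    by rewrite integral_cst//= lebesgue_measure_itv/= lte_fin ltr01 oppr0 adde0 mule1.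
  apply: ge0_le_integral => //.
  - apply/measurable_EFinP; apply: measurable_funTS; exact: measurable_chi_pow.
  - move=> x; rewrite /= in_itv/= => /andP[x0 x1]; rewrite lee_fin /chi.
    have pw0 : 0 <= x `^ p by exact: powR_ge0.
    have pw1 : x `^ p <= 1.
      by rewrite powR_le_inv// powR1.
    rewrite ger0_norm//; apply: ler_pM; rewrite ?expR_ge0 ?invr_ge0//.
      by rewrite ler_expR; nra.
    by rewrite lef_pV2 ?posrE//; lra.
apply: ge0_subset_integral => //.
- apply/measurable_EFinP; apply: measurable_funTS; exact: measurable_chi_pow.
- by move=> x _; rewrite lee_fin ltW// chi_gt0.
- by move=> x /=; rewrite !in_itv/= andbT => /andP[].
Qed.

Section Asymptotics.
Context {d : measure_display} {T : measurableType d}.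
Variable P : probability T R.
Variables (X_ : nat -> T -> R) (c_ : nat -> R) (s : R).
Hypothesis s_ge0 : 0 <= s.
Hypothesis mX_ : forall n, measurable_fun [set: T] (X_ n).
Hypothesis X_ge0 : forall n w, 0 <= X_ n w.
Hypothesis c_ge0 : forall n, 0 <= c_ n.
Hypothesis cdf_le : forall n r, 0 <= r ->
  c_ n * fine (P [set w | X_ n w <= r]) <= r `^ alpha.
Hypothesis cdf_cvg : forall r, 0 <= r ->
  c_ n * fine (P [set w | X_ n w <= r]) @[n --> \oo] --> r `^ alpha.

Lemma bdd_rv_chi n : bdd_rv (fun w => chi s (X_ n w)).
Proof.
split.
  apply: measurableT_comp => //.
  by apply: continuous_measurable_fun; exact: continuous_chi.
by exists 1 => w; rewrite ger0_norm ?chi_le1// ltW// chi_gt0.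
Qed.

Let mset n r : measurable [set w | X_ n w <= r].
Proof.
rewrite -[X in measurable X]setTI.
by have := @mX_ n measurableT _ (measurable_itv `]-oo, r]); rewrite set_itvNyc.
Qed.

Let f_ n r := (dchi s r * (c_ n * fine (P [set w | X_ n w <= r])))%:E.

Let Ex_chiE n : ((c_ n * Ex P (fun w => chi s (X_ n w)))%:E =
  \int[leb]_(r in `[0%R, +oo[) f_ n r)%E.
Proof.
rewrite EFinM -EFin_Ex; last exact: bdd_rv_chi.
rewrite (layer_cake P measurableT (mX_ n) (fun w _ => X_ge0 n w) s_ge0).
rewrite -ge0_integralZl ?lee_fin//.
- apply: eq_integral => r _; rewrite /f_ setTI mulrCA !EFinM fineK//.
  exact: fin_num_measure.
- apply: emeasurable_funM.
    apply/measurable_EFinP; apply: measurable_funTS.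
    by apply: continuous_measurable_fun; exact: continuous_dchi.
  rewrite [X in measurable_fun _ X](_ : _ =
    (fun r => (fine (P [set w | X_ n w <= r]))%:E)); last first.
    by apply/funext => r; rewrite setTI fineK// fin_num_measure.
  apply/measurable_EFinP; apply: nondecreasing_measurable => // r r' rr'.
  rewrite fine_le ?fin_num_measure// le_measure ?inE//.
  by move=> w /= /le_trans; exact.
- by move=> r _; rewrite mule_ge0// lee_fin dchi_ge0.
Qed.

Let mf_ n : measurable_fun (`[0, +oo[%classic : set R) (f_ n).
Proof.
apply/measurable_EFinP; apply: measurable_funTS; apply: measurable_funM.
  by apply: continuous_measurable_fun; exact: continuous_dchi.
apply: measurable_funM => //.
apply: nondecreasing_measurable => // r r' rr'.
rewrite fine_le ?fin_num_measure// le_measure ?inE//.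
by move=> w /= /le_trans; exact.
Qed.

Let mg : measurable_fun (`[0, +oo[%classic : set R) (fun r => (dchi s r * r `^ alpha)%:E).
Proof.
apply/measurable_EFinP; apply: measurable_funTS; apply: measurable_funM.
  by apply: continuous_measurable_fun; exact: continuous_dchi.
exact: measurable_powR.
Qed.

Lemma Ex_chi_le n : c_ n * Ex P (fun w => chi s (X_ n w)) <= stabC s.
Proof.
rewrite -lee_fin Ex_chiE -stab_int_fin// stab_intE//.
apply: ge0_le_integral => //.
- by move=> r _; rewrite lee_fin mulr_ge0 ?dchi_ge0// mulr_ge0// fine_ge0.
- exact: mf_.
- move=> r; rewrite /= in_itv/= andbT => r0.
  by rewrite lee_fin ler_wpM2l ?dchi_ge0// cdf_le.
Qed.

(** Dominated convergence, with the limit itself as dominating function: [cdf_le] holds at every [n]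
    and not only asymptotically. *)
Lemma Ex_chi_cvg : c_ n * Ex P (fun w => chi s (X_ n w)) @[n --> \oo] --> stabC s.
Proof.
have g0 r : 0 <= dchi s r * r `^ alpha by rewrite mulr_ge0 ?dchi_ge0// powR_ge0.
have [|||_ _] := @dominated_convergence _ _ R leb `[0, +oo[%classic
  (measurable_itv _) f_ (fun r => (dchi s r * r `^ alpha)%:E)
  (fun r => (dchi s r * r `^ alpha)%:E) mf_ mg.
- apply: aeW => r; rewrite /= in_itv/= andbT => r0.
  apply: cvg_EFin; first by near=> n.
  by apply: cvgMl_tmp; exact: cdf_cvg.
- apply/integrableP; split; first exact: mg.
  under eq_integral do rewrite gee0_abs ?lee_fin//.
  by rewrite -stab_intE// stab_int_fin// ltry.
- apply: aeW => r n; rewrite /= in_itv/= andbT => r0.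
  have f0 : 0 <= c_ n * fine (P [set w | X_ n w <= r]) by rewrite mulr_ge0 ?fine_ge0.
  rewrite lee_fin normrM !ger0_norm ?dchi_ge0//.
  by rewrite ler_wpM2l ?dchi_ge0// cdf_le.
rewrite -stab_intE// stab_int_fin// => H.
suff : (c_ n * Ex P (fun w => chi s (X_ n w)))%:E @[n --> \oo] --> (stabC s)%:E.
  by move/fine_cvgP => [].
apply: cvg_trans H; apply: near_eq_cvg; near=> n.
by rewrite /= Ex_chiE.
Unshelve. all: by end_near. Qed.

End Asymptotics.
End StableConstants.

(** * Almost sure estimates for the random environment *)

Section Environment.
Context {R : realType} {d : measure_display} {T : measurableType d}.
Variables (P : probability T R) (E : forall n : nat, hcube n -> T -> R).
Variables (alpha beta : R).
Hypothesis alpha01 : 0 < alpha < 1.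
Hypothesis beta0 : 0 < beta.
Hypothesis mE : forall n (x : hcube n), measurable_fun setT (E x).
Hypothesis indepE : forall n, (0 < n)%N -> mutually_independent P (@E n).
Hypothesis tailE : forall n (x : hcube n) (u : R), (0 < n)%N -> 0 <= u ->
  P [set w | u <= - E x w / Num.sqrt (n%:R)] = (expR (- (u ^+ 2) / 2))%:E.

Implicit Types (s : R) (k n : nat) (w : T).

Let a0 : 0 < alpha. Proof. by case/andP: alpha01. Qed.

(* Jump rates of the chain once time is measured in units of the age t_w. *)
Definition env_rate n (x : hcube n) (w : T) : R :=
  expR (alpha * beta ^+ 2 * n%:R + beta * E x w).

(** The probability that a given site is as deep as [t_w] decays like [exp (- kappa n)]. *)
Definition env_kappa : R := alpha ^+ 2 * beta ^+ 2 / 2.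

Local Notation V := env_rate.
Local Notation kappa := env_kappa.

Lemma env_rate_gt0 n (x : hcube n) w : 0 < V x w.
Proof. exact: expR_gt0. Qed.

Lemma measurable_env_rate n (x : hcube n) : measurable_fun setT (V x).
Proof.
apply: measurableT_comp; first exact: measurable_expR.
by apply: measurable_funD => //; apply: measurable_funM => //; exact: mE.
Qed.

Definition env_level n (r : R) : R :=
  (alpha * beta ^+ 2 * n%:R - ln r) / (beta * Num.sqrt n%:R).

(** The tail is prescribed for [u >= 0] only. At [u = 0] it equals 1, so a negative threshold is
    exceeded almost surely; this is the last branch. *)
Definition env_cdf n (r : R) : R :=
  if r <= 0 then 0 else if 0 <= env_level n r then expR (- (env_level n r ^+ 2) / 2)
  else 1.

Lemma env_rate_cdf n (x : hcube n) r : (0 < n)%N ->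
  P [set w | V x w <= r] = (env_cdf n r)%:E.
Proof.
move=> n0; rewrite /env_cdf; case: leP => [r0|r0].
  rewrite (_ : [set w | _] = set0) ?measure0//.
  apply/seteqP; split => w //= h.
  by have := lt_le_trans (env_rate_gt0 x w) (le_trans h r0); rewrite ltxx.
have sn : 0 < Num.sqrt n%:R :> R by rewrite sqrtr_gt0 ltr0n.
have lvl w : (env_level n r <= - E x w / Num.sqrt n%:R) =
    (alpha * beta ^+ 2 * n%:R + beta * E x w <= ln r).
  rewrite /env_level ler_pdivrMr ?mulr_gt0//.
  have -> : - E x w / Num.sqrt n%:R * (beta * Num.sqrt n%:R) = - (beta * E x w).
    by field; rewrite gt_eqF.
  by apply/idP/idP => h; lra.
have -> : [set w | V x w <= r] = [set w | env_level n r <= - E x w / Num.sqrt n%:R].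
  have VE w : (V x w <= r) = (alpha * beta ^+ 2 * n%:R + beta * E x w <= ln r).
    by rewrite -{1}(lnK r0) ler_expR.
  by apply/seteqP; split => w /=; rewrite lvl VE.
case: leP => h; first exact: tailE.
have mS (u : R) : measurable [set w | u <= - E x w / Num.sqrt n%:R].
  have mX : measurable_fun setT (fun w => - E x w / Num.sqrt n%:R).
    by apply: measurable_funM => //; apply: measurable_funN; exact: mE.
  rewrite -[X in measurable X]setTI.
  by have := mX measurableT _ (measurable_itv `[u, +oo[); rewrite set_itvcy.
apply/eqP; rewrite eq_le probability_le1//=.
have /(_ (lexx 0)) := @tailE n x 0 n0; rewrite expr0n/= oppr0 mul0r expR0 => <-.
apply: le_measure; rewrite ?inE//.
by move=> w /=; exact: le_trans (ltW h).
Qed.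

(** Completing the square, half the squared level is [kappa n - alpha ln r + (ln r)^2 / (2 beta^2
    n)]. The first term cancels the normalisation, the second is the power [r^alpha], and the third
    only helps. When the level is negative, [r] is so large that [r^alpha] alone exceeds
    [exp (kappa n)]. *)
Lemma env_cdf_le n r : (0 < n)%N -> 0 <= r ->
  expR (kappa * n%:R) * env_cdf n r <= r `^ alpha.
Proof.
move=> n0 r0; rewrite /env_cdf; case: (leP r 0) => rr.
  by rewrite mulr0 powR_ge0.
have nR : 0 < n%:R :> R by rewrite ltr0n.
have sn : 0 < Num.sqrt n%:R :> R by rewrite sqrtr_gt0.
have sn2 : Num.sqrt n%:R ^+ 2 = n%:R :> R by rewrite sqr_sqrtr// ltW.
rewrite /powR gt_eqF//; case: (leP 0 (env_level n r)) => h.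
  rewrite -expRD ler_expR /env_level /kappa expr_div_n exprMn sn2.
  set L := ln r; rewrite -subr_ge0.
  rewrite (_ : _ - _ = L ^+ 2 / (2 * beta ^+ 2 * n%:R)); last first.
    by field; rewrite !gt_eqF.
  by rewrite divr_ge0 ?sqr_ge0// mulr_ge0 ?(ltW nR)// mulr_ge0 ?sqr_ge0.
rewrite mulr1 ler_expR /kappa; move: h; rewrite /env_level ltr_pdivrMr ?mulr_gt0// mul0r.
rewrite subr_lt0 => h.
have := ltW h; rewrite -(ler_pM2l a0) => {}h; apply: le_trans h.
rewrite -subr_ge0 (_ : _ - _ = alpha ^+ 2 * beta ^+ 2 * n%:R / 2); last by field.
by rewrite divr_ge0// mulr_ge0 ?(ltW nR)// mulr_ge0 ?sqr_ge0.
Qed.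

Lemma env_cdf_cvg r : 0 <= r ->
  expR (kappa * n.+1%:R) * env_cdf n.+1 r @[n --> \oo] --> r `^ alpha.
Proof.
move=> r0; rewrite le_eqVlt in r0; case/predU1P: r0 => [<-|r0].
  rewrite powR0 ?gt_eqF//; under eq_fun do rewrite /env_cdf lexx mulr0.
  exact: cvg_cst.
set L := ln r.
have ninf : (n.+1%:R : R)^-1 @[n --> \oo] --> 0 by exact: cvg_harmonic.
have : expR (alpha * L - L ^+ 2 / (2 * beta ^+ 2) * n.+1%:R^-1) @[n --> \oo] --> r `^ alpha.
  rewrite /powR gt_eqF// -/L -[X in expR X](subr0) -(mulr0 (L ^+ 2 / (2 * beta ^+ 2))).
  apply: continuous_cvg; first exact: continuous_expR.
  by apply: cvgB; [exact: cvg_cst|apply: cvgMl_tmp].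
apply: cvg_trans; apply: near_eq_cvg; near=> n.
have nR : 0 < n.+1%:R :> R by rewrite ltr0n.
have sn : 0 < Num.sqrt n.+1%:R :> R by rewrite sqrtr_gt0.
have sn2 : Num.sqrt n.+1%:R ^+ 2 = n.+1%:R :> R by rewrite sqr_sqrtr// ltW.
have ab0 : 0 < alpha * beta ^+ 2 by rewrite mulr_gt0// exprn_gt0.
have nL : L <= alpha * beta ^+ 2 * n.+1%:R.
  rewrite -ler_pdivrMl//; apply: (@le_trans _ _ n%:R); last by rewrite ler_nat.
  by near: n; exact: nbhs_infty_ger.
rewrite /env_cdf leNgt r0/=.
have -> : 0 <= env_level n.+1 r.
  by rewrite /env_level divr_ge0 ?subr_ge0// mulr_ge0// ltW.
rewrite -expRD /env_level /kappa expr_div_n exprMn sn2 -/L; congr expR.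
by field; rewrite !gt_eqF.
Unshelve. all: by end_near. Qed.

Definition env_chi s k n (x : hcube n) (w : T) : R := chi s (V x w / k.+2%:R).

(** All vertices of one hypercube share the same law; [hc_ones] is a representative. *)
Definition env_mean s k n : R := Ex P (env_chi s k (hc_ones n)).

Let mX k n (x : hcube n) : measurable_fun setT (fun w => V x w / k.+2%:R).
Proof. by apply: measurable_funM => //; exact: measurable_env_rate. Qed.

Let X0 k n (x : hcube n) w : 0 <= V x w / k.+2%:R.
Proof. by rewrite divr_ge0// ltW// env_rate_gt0. Qed.

Let setE k n (x : hcube n) r :
  [set w | V x w / k.+2%:R <= r] = [set w | V x w <= r * k.+2%:R].
Proof. by apply/seteqP; split => w /=; rewrite ler_pdivrMr. Qed.

Lemma env_chi_gt0 s k n (x : hcube n) w : 0 < env_chi s k x w.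
Proof. exact: chi_gt0. Qed.

Lemma env_chi_le1 s k n (x : hcube n) w : 0 <= s -> env_chi s k x w <= 1.
Proof. by move=> s0; apply: chi_le1. Qed.

Lemma bdd_rv_env_chi s k n (x : hcube n) : 0 <= s -> bdd_rv (env_chi s k x).
Proof.
move=> s0; exact: (@bdd_rv_chi R _ T (fun=> fun w => V x w / k.+2%:R) s s0
  (fun=> mX k x) (fun=> X0 k x) 0%N).
Qed.

Lemma env_chi_mean s k n (x : hcube n) : (0 < n)%N -> 0 <= s ->
  Ex P (env_chi s k x) = env_mean s k n.
Proof.
move=> n0 s0; apply: EFin_inj.
rewrite /env_mean -!EFin_Ex; [|exact: bdd_rv_env_chi|exact: bdd_rv_env_chi].
rewrite (layer_cake P measurableT (mX k x) (fun w _ => X0 k x w) s0).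
rewrite (layer_cake P measurableT (mX k (hc_ones n)) (fun w _ => X0 k _ w) s0).
apply: eq_integral => r _; rewrite !setTI !setE.
congr (_ * _)%E; transitivity (env_cdf n (r * k.+2%:R))%:E.
  exact: env_rate_cdf.
by apply/esym; exact: env_rate_cdf.
Qed.

Section Asymp.
Variables (s : R) (k : nat).
Hypothesis s_ge0 : 0 <= s.
Local Notation mu := (k.+2%:R : R).

Let X_ n w := V (hc_ones n.+1) w / mu.
Let c_ n : R := expR (kappa * n.+1%:R) / mu `^ alpha.

Let mua0 : 0 < mu `^ alpha. Proof. exact: powR_gt0. Qed.

Let c_ge0 n : 0 <= c_ n.
Proof. by rewrite divr_ge0 ?expR_ge0// ltW. Qed.

Let cdfE n r : c_ n * fine (P [set w | X_ n w <= r]) =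
  (mu `^ alpha)^-1 * (expR (kappa * n.+1%:R) * env_cdf n.+1 (r * mu)).
Proof.
rewrite setE env_rate_cdf//= /c_.
by rewrite mulrAC mulrC.
Qed.

Let powE r : 0 <= r -> (mu `^ alpha)^-1 * (r * mu) `^ alpha = r `^ alpha.
Proof. by move=> r0; rewrite powRM// mulrC mulfK// gt_eqF. Qed.

Let cdf_le n r : 0 <= r -> c_ n * fine (P [set w | X_ n w <= r]) <= r `^ alpha.
Proof.
move=> r0; rewrite cdfE -(powE r0) ler_wpM2l ?invr_ge0 ?(ltW mua0)//.
by apply: env_cdf_le => //; rewrite mulr_ge0.
Qed.

Let cdf_cvg r : 0 <= r ->
  c_ n * fine (P [set w | X_ n w <= r]) @[n --> \oo] --> r `^ alpha.
Proof.
move=> r0; rewrite -(powE r0); under eq_fun do rewrite cdfE.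
by apply: cvgMl_tmp; apply: env_cdf_cvg => //; rewrite mulr_ge0.
Qed.

Let cE n : expR (kappa * n.+1%:R) * env_mean s k n.+1 =
  mu `^ alpha * (c_ n * Ex P (fun w => chi s (X_ n w))).
Proof. by rewrite /c_ mulrA mulrCA mulfV ?gt_eqF// mulr1. Qed.

Lemma env_mean_le n :
  expR (kappa * n.+1%:R) * env_mean s k n.+1 <= mu `^ alpha * stabC alpha s.
Proof.
rewrite cE ler_pM2l//.
exact: (Ex_chi_le alpha01 s_ge0 (fun n => mX k (hc_ones n.+1))
  (fun n => X0 k (hc_ones n.+1)) c_ge0 cdf_le).
Qed.

Lemma env_mean_cvg : expR (kappa * n.+1%:R) * env_mean s k n.+1 @[n --> \oo] -->
  mu `^ alpha * stabC alpha s.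
Proof.
under eq_fun do rewrite cE.
apply: cvgMl_tmp.
exact: (Ex_chi_cvg alpha01 s_ge0 (fun n => mX k (hc_ones n.+1))
  (fun n => X0 k (hc_ones n.+1)) c_ge0 cdf_le cdf_cvg).
Qed.

Lemma env_mean_gt0 n : 0 < env_mean s k n.+1.
Proof.
pose A := [set w | V (hc_ones n.+1) w <= 1].
have mA : measurable A.
  rewrite -[X in measurable X]setTI.
  have := @measurable_env_rate n.+1 (hc_ones n.+1) measurableT
    _ (measurable_itv `]-oo, 1]).
  by rewrite set_itvNyc.
pose c := expR (- s) / 2.
have c0 : 0 < c by rewrite divr_gt0// expR_gt0.
have bA : bdd_rv (\1_A : T -> R).
  split; first exact: measurable_indic.
  by exists 1 => w; rewrite indicE; case: (_ \in _); rewrite ?normr1 ?normr0.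
apply: (@lt_le_trans _ _ (Ex P (fun w => c * \1_A w))).
  rewrite ExZ// mulr_gt0// /Ex /Rintegral integral_indic// setIT.
  rewrite [X in fine X](_ : _ = (env_cdf n.+1 1)%:E); last first.
    exact: env_rate_cdf.
  rewrite /env_cdf leNgt ltr01/=.
  by case: ifP => _; rewrite ?expR_gt0.
apply: le_Ex; [exact: bdd_rvZ|exact: bdd_rv_env_chi|].
move=> w; rewrite indicE; case: (boolP (w \in A)) => [|_].
  rewrite inE/= mulr1 => h; rewrite /env_chi /chi ger0_norm//.
  have Vm : V (hc_ones n.+1) w / mu <= 1.
    by rewrite ler_pdivrMr// mul1r (le_trans h)// ler1n.
  have := X0 k (hc_ones n.+1) w; move: (_ / mu) Vm => v v1 v0.
  apply: ler_pM; rewrite ?expR_ge0 ?invr_ge0//.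
    by rewrite ler_expR mulNr lerN2 ler_piMr.
  by rewrite lef_pV2 ?posrE//; lra.
by rewrite mulr0 ltW// env_chi_gt0.
Qed.

End Asymp.

Lemma env_chi_indep s s' k n (x y : hcube n) : (0 < n)%N -> 0 <= s -> 0 <= s' ->
  x != y -> Ex P (fun w => env_chi s k x w * env_chi s' k y w) =
  env_mean s k n * env_mean s' k n.
Proof.
move=> n0 s0 s0' xy; rewrite -(env_chi_mean k x n0 s0) -(env_chi_mean k y n0 s0').
pose phi s e : R := chi s (expR (alpha * beta ^+ 2 * n%:R + beta * e) / k.+2%:R).
have mphi t : measurable_fun setT (phi t).
  apply: measurableT_comp.
    by apply: continuous_measurable_fun; exact: continuous_chi.
  apply: measurable_funM => //; apply: measurableT_comp; first exact: measurable_expR.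
  by apply: measurable_funD => //; apply: measurable_funM.
have phi01 t r : 0 <= t -> 0 <= phi t r <= 1.
  by move=> t0; rewrite (ltW (chi_gt0 _ _)) chi_le1// divr_ge0// expR_ge0.
apply: (@indep_Ex_prod _ _ R P (E x) (E y) (phi s) (phi s')) => //.
- exact: mutually_independent_pair (indepE n0) xy.
- by move=> r; exact: phi01.
- by move=> r; exact: phi01.
Qed.

Hypothesis kappa_lt : kappa < ln 2.
Hypothesis kappa_gt : ln 2 < 2 * kappa.
Local Notation Y := env_chi.
Local Notation mean := env_mean.

Let card_hcube n : #|{: hcube n}| = (2 ^ n)%N.
Proof. by rewrite card_ffun card_bool card_ord. Qed.

Let sum_cst n (c : R) : \sum_(x : hcube n) c = 2 ^+ n * c.
Proof. by rewrite sumr_const card_hcube -[LHS]mulr_natl natrX. Qed.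

Let mean_gt0 s k n : 0 <= s -> 0 < mean s k n.+1.
Proof. by move=> s0; apply: env_mean_gt0. Qed.

Let Ymean s k n (x : hcube n.+1) : 0 <= s -> Ex P (Y s k x) = mean s k n.+1.
Proof. by move=> s0; exact: env_chi_mean. Qed.

Let bY s k n (x : hcube n) : 0 <= s -> bdd_rv (Y s k x).
Proof. by move=> s0; exact: bdd_rv_env_chi. Qed.

Let mean_le s k : 0 <= s -> exists2 C, 0 < C &
  forall n, mean s k n.+1 <= C * expR (- kappa) ^+ n.+1.
Proof.
move=> s0; exists (k.+2%:R `^ alpha * stabC alpha s) => [|n].
  by rewrite mulr_gt0 ?powR_gt0// stabC_gt0.
rewrite -expRM_natr mulNr expRN ler_pdivlMr ?expR_gt0// mulrC.
exact: env_mean_le.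
Qed.

Let inv_mean_le s k : 0 <= s -> exists2 C, 0 < C &
  forall n, (mean s k n.+1)^-1 <= C * expR kappa ^+ n.+1.
Proof.
move=> s0; set L := k.+2%:R `^ alpha * stabC alpha s.
have L0 : 0 < L by rewrite mulr_gt0 ?powR_gt0// stabC_gt0.
have : (expR (kappa * n.+1%:R) * mean s k n.+1)^-1 @[n --> \oo] --> L^-1.
  apply: cvgV; first by rewrite gt_eqF.
  exact: env_mean_cvg.
move=> /cvgP /cvg_seq_bounded /pinfty_ex_gt0 [C C0 HC].
exists C => // n; have := HC n I.
have e0 := expR_gt0 (kappa * n.+1%:R).
have m0 := mean_gt0 k n s0.
rewrite /= ger0_norm ?invr_ge0 ?mulr_ge0 ?(ltW e0) ?(ltW m0)// invfM.
by rewrite -expRM_natr mulrC ler_pdivrMr.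
Qed.

(** Since [0 <= Y <= 1], the second moment of [Y] is at most its mean, and distinct sites are
    independent. The variance of the normalised sum is thus at most [1 / (2^n mean)], of order
    [(exp kappa / 2)^n], which is summable by [kappa < ln 2]. *)
Lemma env_lln s k : 0 <= s -> {ae P, forall w,
  (2 ^+ n * mean s k n)^-1 * (\sum_(x : hcube n) Y s k x w) @[n --> \oo] --> (1 : R)}.
Proof.
move=> s0; pose S n w := \sum_(x : hcube n) Y s k x w.
pose K n := 2 ^+ n * mean s k n.
pose Z n w := ((K n)^-1 * S n w - 1) ^+ 2.
have bS n : bdd_rv (S n) by apply: bdd_rv_sum => x; exact: bY.
have bS2 n : bdd_rv (fun w => S n w * S n w) by exact: bdd_rvM.
have bZ n : bdd_rv (Z n).
  rewrite (_ : Z n = fun w => ((K n)^-1 * S n w + -1) * ((K n)^-1 * S n w + -1)).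
    apply: bdd_rvM; apply: bdd_rvD; try exact: bdd_rv_cst; exact: bdd_rvZ.
  by apply/funext => w; rewrite /Z expr2.
have [C C0 HC] := inv_mean_le k s0.
suff : {ae P, forall w, Z n w @[n --> \oo] --> 0}.
  apply: filterS => w /cvgr0Pnorm_le Zw; apply/cvgrPdist_le => e e0.
  apply: filterS (Zw (e ^+ 2) (exprn_gt0 2 e0)) => n.
  rewrite ger0_norm ?sqr_ge0// /Z -[X in X <= _]real_normK ?num_real//.
  by rewrite distrC ler_pXn2r ?nnegrE// ltW.
apply: (ae_cvg0_of_summable (u := fun n => C * (expR kappa / 2) * (expR kappa / 2) ^+ n)) => //.
- by move=> n w; exact: sqr_ge0.
- move=> n; have m0 := mean_gt0 k n s0.
  have K0 : 0 < K n.+1 by rewrite mulr_gt0// exprn_gt0.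
  have ES : Ex P (S n.+1) = K n.+1.
    rewrite Ex_sum => [|x]; last exact: bY.
    rewrite (eq_bigr (fun=> mean s k n.+1)) => [|x _]; last exact: Ymean.
    exact: sum_cst.
  have ES2 : Ex P (fun w => S n.+1 w * S n.+1 w) <= K n.+1 + K n.+1 ^+ 2.
    rewrite (_ : (fun w => _) = fun w => \sum_(x : hcube n.+1) \sum_(y : hcube n.+1)
        Y s k x w * Y s k y w); last first.
      by apply/funext => w; rewrite mulr_suml; apply: eq_bigr => x _; rewrite mulr_sumr.
    have bYY (x y : hcube n.+1) : bdd_rv (fun w => Y s k x w * Y s k y w).
      by apply: bdd_rvM; exact: bY.
    rewrite Ex_sum => [|x]; last exact: bdd_rv_sum.
    under eq_bigr do rewrite Ex_sum//.
    apply: (@le_trans _ _ (\sum_(x : hcube n.+1) (mean s k n.+1 +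
        \sum_(y : hcube n.+1) mean s k n.+1 ^+ 2))).
      apply: ler_sum => x _; rewrite (bigD1 x)//=; apply: lerD.
        rewrite -(Ymean k x s0); apply: le_Ex => //; first exact: bY.
        move=> w; rewrite -[leRHS]mulr1 ler_wpM2l ?env_chi_le1//.
        by rewrite ltW// env_chi_gt0.
      rewrite [leRHS](bigD1 x)//= -[leLHS]add0r; apply: lerD.
        by rewrite exprn_ge0// ltW.
      apply: ler_sum => y yx; rewrite expr2 eq_sym in yx *.
      by rewrite env_chi_indep.
    rewrite big_split/= !sum_cst -/(K n.+1) lerD2l.
    by rewrite /K exprMn expr2 mulrA.
  have -> : Ex P (Z n.+1) = (K n.+1)^-1 ^+ 2 * Ex P (fun w => S n.+1 w * S n.+1 w)
      - 2 * (K n.+1)^-1 * Ex P (S n.+1) + 1.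
    rewrite (_ : Z n.+1 = fun w => (K n.+1)^-1 ^+ 2 * (S n.+1 w * S n.+1 w) +
       ((- (2 * (K n.+1)^-1)) * S n.+1 w + 1)); last first.
      by apply/funext => w; rewrite /Z; ring.
    have bb : bdd_rv (fun w => (- (2 * (K n.+1)^-1)) * S n.+1 w + 1).
      by apply: bdd_rvD; [exact: bdd_rvZ|exact: bdd_rv_cst].
    rewrite ExD//; last exact: bdd_rvZ.
    rewrite ExD ?Ex_cst ?ExZ//; [|exact: bdd_rvZ|exact: bdd_rv_cst].
    by rewrite mulNr addrA.
  apply: (@le_trans _ _ (K n.+1)^-1).
    rewrite ES; apply: (@le_trans _ _ ((K n.+1)^-1 ^+ 2 * (K n.+1 + K n.+1 ^+ 2)
      - 2 * (K n.+1)^-1 * K n.+1 + 1)).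
      by rewrite !lerD2r ler_wpM2l// exprn_ge0// invr_ge0 ltW.
    rewrite le_eqVlt; apply/orP; left; apply/eqP; field.
    by rewrite gt_eqF.
  rewrite /K invfM -mulrA -exprS expr_div_n mulrC mulrA.
  by rewrite ler_wpM2r// invr_ge0 exprn_ge0.
- apply: is_cvg_geometric_series.
  rewrite ger0_norm ?divr_ge0 ?expR_ge0// ltr_pdivrMr// mul1r.
  by rewrite -[ltRHS](@lnK R) ?posrE// ltr_expR.
Qed.

(** The starting vertex is one fixed site, a deep trap with probability of order [exp (- kappa n)],
    which is summable. *)
Lemma env_start k : {ae P, forall w, Y 0 k (hc_ones n) w @[n --> \oo] --> 0}.
Proof.
have [C C0 HC] := mean_le k (lexx 0).
apply: (ae_cvg0_of_summable (u := fun n => C * expR (- kappa) * expR (- kappa) ^+ n)).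
- by move=> n; exact: bY.
- by move=> n w; rewrite ltW// env_chi_gt0.
- by move=> n; rewrite Ymean// -mulrA -exprS.
- apply: is_cvg_geometric_series; rewrite ger0_norm ?expR_ge0// -expR0 ltr_expR.
  have := kappa_gt; have : 0 < ln (2 : R) by rewrite ln_gt0// ltr1n.
  by lra.
Qed.

(** Summing over [z] replaces a supremum over starting points. Independence gives [mean^2] for each
    pair and the Green weights add up to at most [(n^2 / 2)^2], so the expectation is of order
    [2^n n^4 exp (- 2 kappa n)]. This is where [ln 2 < 2 * kappa] is needed. *)
Lemma env_offdiag k : {ae P, forall w,
  \sum_(z : hcube n) \sum_(y : hcube n) \sum_(y' | y' != y)
    (green1 R (n ^ 2) z y * green1 R (n ^ 2) z y') * (Y 0 k y w * Y 0 k y' w)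
  @[n --> \oo] --> 0}.
Proof.
have [C C0 HC] := mean_le k (lexx 0).
(* Half of the exponential gap absorbs [n^4 <= 24 exp (eta n) / eta^4]; the other half gives a
   summable rate. The 6 in [D] is this 24 divided by the 4 coming from [(n^2 / 2)^2]. *)
pose eta := (2 * kappa - ln 2) / 2.
have eta0 : 0 < eta by rewrite divr_gt0// subr_gt0.
pose D := C ^+ 2 * 6 / eta ^+ 4.
apply: (ae_cvg0_of_summable (u := fun n => D * expR (- eta) * expR (- eta) ^+ n)).
- move=> n; apply: bdd_rv_sum => z; apply: bdd_rv_sum => y; apply: bdd_rv_sum => y'.
  by apply: bdd_rvZ; apply: bdd_rvM; exact: bY.
- move=> n w; apply: sumr_ge0 => z _; apply: sumr_ge0 => y _.
  apply: sumr_ge0 => y' _; apply: mulr_ge0; first by rewrite mulr_ge0 ?green1_ge0.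
  by rewrite mulr_ge0// ltW// env_chi_gt0.
- move=> n; set N := (n.+1 ^ 2)%N.
  have bt (z y y' : hcube n.+1) : bdd_rv (fun w =>
      (green1 R N z y * green1 R N z y') * (Y 0 k y w * Y 0 k y' w)).
    by apply: bdd_rvZ; apply: bdd_rvM; exact: bY.
  rewrite Ex_sum => [|z]; last by apply: bdd_rv_sum => y; exact: bdd_rv_sum.
  apply: (@le_trans _ _ (\sum_(z : hcube n.+1) (N%:R / 2) ^+ 2 * mean 0 k n.+1 ^+ 2)).
    apply: ler_sum => z _; rewrite Ex_sum => [|y]; last exact: bdd_rv_sum.
    under eq_bigr do rewrite Ex_sum//.
    rewrite -{1}(sum_green1 R N z (ltn0Sn n)) expr2 -mulrA mulr_suml.
    apply: ler_sum => y _.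
    rewrite [X in _ <= _ * X]mulr_suml [leRHS]mulr_sumr.
    rewrite [leRHS](bigD1 y)//= -[leLHS]add0r; apply: lerD.
      apply: mulr_ge0; first exact: green1_ge0.
      apply: mulr_ge0; [exact: green1_ge0|exact: sqr_ge0].
    apply: ler_sum => y' yy'; rewrite ExZ; last by apply: bdd_rvM; exact: bY.
    rewrite eq_sym in yy'.
    rewrite env_chi_indep//.
    by rewrite -(mulrA (green1 R N z y)) expr2.
  rewrite sum_cst.
  have m0 := mean_gt0 k n (lexx 0).
  apply: (@le_trans _ _ (2 ^+ n.+1 * ((N%:R / 2) ^+ 2 * (C * expR (- kappa) ^+ n.+1) ^+ 2))).
    rewrite ler_pM2l ?exprn_gt0//; apply: ler_wpM2l; first by rewrite sqr_ge0.
    by rewrite ler_pXn2r ?nnegrE ?HC ?(ltW m0)// mulr_ge0 ?exprn_ge0 ?expR_ge0// ltW.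
  have n4 : (n.+1%:R : R) ^+ 4 <= 24 / eta ^+ 4 * expR (eta * n.+1%:R).
    have := @expR_ge1Dxn R (eta * n.+1%:R) 3 (mulr_ge0 (ltW eta0) (ler0n _ _)).
    rewrite (_ : 4`!%:R = 24 :> R)// exprMn => h.
    rewrite mulrAC ler_pdivlMr ?exprn_gt0// mulrC.
    by move: h; set X := eta ^+ 4 * _; set Z := expR _; lra.
  have -> : 2 ^+ n.+1 = expR (ln 2 * n.+1%:R) :> R by rewrite expRM_natr lnK ?posrE.
  have -> : (N%:R / 2) ^+ 2 = n.+1%:R ^+ 4 / 4 :> R by rewrite /N natrX; field.
  have -> : expR (- kappa) ^+ n.+1 = expR (- kappa * n.+1%:R) by rewrite expRM_natr.
  have -> : D * expR (- eta) * expR (- eta) ^+ n = D * expR (- eta * n.+1%:R).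
    by rewrite expRM_natr exprS mulrA.
  have -> : D * expR (- eta * n.+1%:R) = expR (ln 2 * n.+1%:R) *
      (24 / eta ^+ 4 * expR (eta * n.+1%:R) / 4 * (C * expR (- kappa * n.+1%:R)) ^+ 2).
    have -> : - eta * n.+1%:R = ln 2 * n.+1%:R + eta * n.+1%:R +
        (- kappa * n.+1%:R + - kappa * n.+1%:R) by rewrite /eta; field.
    by rewrite /D !expRD; field; rewrite gt_eqF.
  rewrite ler_pM2l ?expR_gt0//; apply: ler_wpM2r; first exact: sqr_ge0.
  by rewrite ler_wpM2r// invr_ge0.
- apply: is_cvg_geometric_series; rewrite ger0_norm ?expR_ge0// -expR0 ltr_expR.
  by rewrite oppr_lt0.
Qed.

Let mass k n w : R := \sum_(x : hcube n.+1) trap_kill (fun x : hcube n.+1 => V x w) k x.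

Lemma trap_kill_env k n (x : hcube n) w :
  trap_kill (fun x : hcube n => V x w) k x = Y 0 k x w.
Proof.
have V0 := env_rate_gt0 x w.
rewrite /env_chi /chi oppr0 mul0r expR0 mul1r ger0_norm ?divr_ge0 ?(ltW V0)//.
have k0 : k.+2%:R != 0 :> R by rewrite pnatr_eq0.
by rewrite -[X in X + _](divff k0) -mulrDl invf_div.
Qed.

Lemma trap_kill_stay_env theta k n (x : hcube n) w :
  trap_kill (fun x : hcube n => V x w) k x * expR (- theta * V x w) =
  Y (theta * k.+2%:R) k x w.
Proof.
rewrite trap_kill_env /env_chi /chi oppr0 mul0r expR0 mul1r mulrC; congr (expR _ / _).
have k0 : k.+2%:R != 0 :> R by rewrite pnatr_eq0.
by rewrite -[in LHS](divfK k0 (V x w)); ring.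
Qed.

Let mu0 k : 0 < k.+2%:R `^ alpha. Proof. by rewrite powR_gt0. Qed.

(** The expected total killing weight grows like [(2 / exp kappa)^n]. *)
Lemma env_total_mean_cvg k : (2 ^+ n.+1 * mean 0 k n.+1)^-1 @[n --> \oo] --> (0 : R).
Proof.
have E1 n : (2 ^+ n.+1 * mean 0 k n.+1)^-1 =
    (expR kappa / 2) ^+ n.+1 * (expR (kappa * n.+1%:R) * mean 0 k n.+1)^-1.
  have m0 := mean_gt0 k n (lexx 0).
  rewrite expRM_natr expr_div_n; have := exprn_gt0 n.+1 (expR_gt0 kappa).
  move: (expR kappa ^+ _) => t t0; field.
  by rewrite !gt_eqF// exprn_gt0.
have c1 : (expR kappa / 2) ^+ n.+1 @[n --> \oo] --> (0 : R).
  rewrite (cvg_shiftS (fun n => (expR kappa / 2) ^+ n)); apply: cvg_expr.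
  rewrite ger0_norm ?divr_ge0 ?expR_ge0// ltr_pdivrMr// mul1r.
  by rewrite -[ltRHS](@lnK R) ?posrE// ltr_expR.
have nz : k.+2%:R `^ alpha * stabC alpha 0 != 0.
  by rewrite gt_eqF// mulr_gt0// stabC_gt0.
have := cvgM c1 (cvgV nz (@env_mean_cvg _ k (lexx 0))).
by rewrite mul0r (eq_cvg _ _ E1); apply.
Qed.

Let lln_shift s k w :
  (2 ^+ n * mean s k n)^-1 * (\sum_(x : hcube n) Y s k x w) @[n --> \oo] --> (1 : R) ->
  (2 ^+ n.+1 * mean s k n.+1)^-1 * (\sum_(x : hcube n.+1) Y s k x w) @[n --> \oo] --> (1 : R).
Proof.
by rewrite (cvg_shiftS (fun n => (2 ^+ n * mean s k n)^-1 * (\sum_(x : hcube n) Y s k x w))).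
Qed.

Let massE k n w : mass k n w = \sum_(x : hcube n.+1) Y 0 k x w.
Proof. by apply: eq_bigr => x _; rewrite trap_kill_env. Qed.

Lemma env_mass_cvg k w :
  (2 ^+ n * mean 0 k n)^-1 * (\sum_(x : hcube n) Y 0 k x w) @[n --> \oo] --> (1 : R) ->
  (mass k n w)^-1 @[n --> \oo] --> (0 : R).
Proof.
have E1 n : (mass k n w)^-1 = (2 ^+ n.+1 * mean 0 k n.+1)^-1 *
    ((2 ^+ n.+1 * mean 0 k n.+1)^-1 * (\sum_(x : hcube n.+1) Y 0 k x w))^-1.
  have m0 : 2 ^+ n.+1 * mean 0 k n.+1 != 0.
    by rewrite mulf_neq0 ?expf_neq0// gt_eqF// mean_gt0.
  by rewrite massE; move: (2 ^+ _ * _) m0 => m m0; rewrite invfM invrK mulKf.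
move=> /lln_shift lln; have := cvgM (env_total_mean_cvg k) (cvgV (oner_neq0 R) lln).
by rewrite mul0r (eq_cvg _ _ E1); apply.
Qed.

(** Both sums are replaced by their means through the law of large numbers; the factors
    [exp (kappa n)] and [mu^alpha] cancel in the quotient, leaving a limit that depends on
    [theta * mu] only. *)
Lemma env_ratio_cvg theta k w : 0 < theta ->
  (2 ^+ n * mean 0 k n)^-1 * (\sum_(x : hcube n) Y 0 k x w) @[n --> \oo] --> (1 : R) ->
  (2 ^+ n * mean (theta * k.+2%:R) k n)^-1 *
    (\sum_(x : hcube n) Y (theta * k.+2%:R) k x w) @[n --> \oo] --> (1 : R) ->
  (\sum_(x : hcube n.+1) trap_kill (fun x : hcube n.+1 => V x w) k x *
     expR (- theta * V x w)) / mass k n w @[n --> \oo] -->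
  stabC alpha (theta * k.+2%:R) / stabC alpha 0.
Proof.
move=> theta0 /lln_shift c0 /lln_shift; set s := theta * k.+2%:R => cs.
have s0 : 0 <= s by rewrite mulr_ge0// ltW.
have C0 : stabC alpha 0 != 0 by rewrite gt_eqF// stabC_gt0.
have nz : k.+2%:R `^ alpha * stabC alpha 0 != 0 by rewrite mulf_neq0// gt_eqF.
have := cvgM (cvgM cs (cvgV (oner_neq0 R) c0))
  (cvgM (@env_mean_cvg _ k s0) (cvgV nz (@env_mean_cvg _ k (lexx 0)))).
have -> : 1 * 1^-1 * (k.+2%:R `^ alpha * stabC alpha s * (k.+2%:R `^ alpha * stabC alpha 0)^-1) =
    stabC alpha s / stabC alpha 0.
  by field; rewrite C0 gt_eqF.
have E1 n : (\sum_(x : hcube n.+1) trap_kill (fun x : hcube n.+1 => V x w) k x *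
     expR (- theta * V x w)) / mass k n w =
    (2 ^+ n.+1 * mean s k n.+1)^-1 * (\sum_(x : hcube n.+1) Y s k x w) *
    ((2 ^+ n.+1 * mean 0 k n.+1)^-1 * (\sum_(x : hcube n.+1) Y 0 k x w))^-1 *
    (expR (kappa * n.+1%:R) * mean s k n.+1 *
     (expR (kappa * n.+1%:R) * mean 0 k n.+1)^-1).
  under eq_bigr do rewrite trap_kill_stay_env.
  rewrite massE -/s.
  have S0 : 0 < \sum_(x : hcube n.+1) Y 0 k x w.
    rewrite (bigD1 (hc_ones n.+1))//= ltr_pwDl ?env_chi_gt0// sumr_ge0// => x _.
    exact/ltW/env_chi_gt0.
  have m1 := mean_gt0 k n (lexx 0); have m2 := mean_gt0 k n s0.
  move: (\sum_x Y 0 k x w) S0 (\sum_x Y s k x w) => S S0 S'.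
  by field; rewrite !gt_eqF ?exprn_gt0 ?expR_gt0.
by rewrite (eq_cvg _ _ E1); apply.
Qed.

End Environment.

(** * The primitive of [1 / (1 + x^(1/alpha))] *)

Section StablePrimitive.
Variables (R : realType) (alpha : R).
Hypothesis alpha01 : 0 < alpha < 1.
Local Notation leb := (@lebesgue_measure R).
Local Notation p := (alpha^-1).
Implicit Types (x y : R).

Let a0 : 0 < alpha. Proof. by case/andP: alpha01. Qed.
Let p1 : 1 < p. Proof. by rewrite invf_gt1//; case/andP: alpha01. Qed.
Let p0 : 0 < p. Proof. by rewrite invr_gt0. Qed.

Definition stabP y : R := \int[leb]_(x in `[0, y]) chi 0 (x `^ p).

Let chi0 x : 0 <= chi 0 (x `^ p).
Proof. exact/ltW/chi_gt0. Qed.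

Lemma chi0_powRE x : chi 0 (x `^ p) = (1 + x `^ p)^-1.
Proof. by rewrite /chi oppr0 mul0r expR0 mul1r ger0_norm// powR_ge0. Qed.

Let mchi (D : set R) : measurable_fun D (EFin \o (fun x => chi 0 (x `^ p))).
Proof.
apply: measurable_funTS; apply/measurable_EFinP; exact: measurable_chi_pow.
Qed.

Let integrable_stab : leb.-integrable `[0, +oo[ (EFin \o (fun x => chi 0 (x `^ p))).
Proof.
apply/integrableP; split; first exact: mchi.
under eq_integral do rewrite gee0_abs ?lee_fin//.
by have := stab_int_fin alpha01 (lexx 0); rewrite /stab_int => ->; rewrite ltry.
Qed.

Let integrable_stabP y : leb.-integrable `[0, y] (EFin \o (fun x => chi 0 (x `^ p))).
Proof.
apply: integrableS integrable_stab => //.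
by move=> x; rewrite /= !in_itv/= andbT => /andP[].
Qed.

Lemma stabP_ge0 y : 0 <= stabP y.
Proof. by apply: Rintegral_ge0 => x _; exact: chi0. Qed.

Lemma EFin_stabP y : ((stabP y)%:E = \int[leb]_(x in `[0%R, y]) (chi 0 (x `^ p))%:E)%E.
Proof.
by rewrite /stabP /Rintegral fineK//; exact: integrable_fin_num (integrable_stabP y).
Qed.

Lemma stabP_homo x y : x <= y -> stabP x <= stabP y.
Proof.
move=> xy; rewrite -lee_fin !EFin_stabP; apply: ge0_subset_integral => //.
- exact: mchi.
- by move=> z _; rewrite lee_fin.
- by move=> z; rewrite /= !in_itv/= => /andP[-> /le_trans->].
Qed.

Lemma stabP_le_id y : 0 <= y -> stabP y <= y.
Proof.
move=> y0; rewrite -lee_fin EFin_stabP.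
apply: (@le_trans _ _ (\int[leb]_(x in `[0%R, y]) 1%:E)%E).
  apply: ge0_le_integral => //; first by move=> x _; rewrite lee_fin.
    exact: mchi.
  by move=> x _; rewrite lee_fin chi_le1// powR_ge0.
rewrite integral_cst//= lebesgue_measure_itv/= lte_fin oppr0 adde0 mul1e.
by case: ltP.
Qed.

Lemma stabP_le y : stabP y <= stabC alpha 0.
Proof.
rewrite -lee_fin EFin_stabP -(stab_int_fin alpha01 (lexx 0)).
apply: ge0_subset_integral => //.
- exact: mchi.
- by move=> z _; rewrite lee_fin.
- by move=> z; rewrite /= !in_itv/= andbT => /andP[].
Qed.

Lemma is_derive_stabP y : 0 < y -> is_derive y 1 stabP (1 + y `^ p)^-1.
Proof.
move=> y0; have [] := @continuous_FTC1_closed R (fun x => chi 0 (x `^ p)) 0 y (y + 1)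
  _ (integrable_stabP _) y0.
- by rewrite ltrDl.
- have := @continuous_comp _ _ _ (fun x : R => x `^ p) (chi 0) y.
  apply; last exact: continuous_chi.
  exact: is_derive_continuous_at (is_derive1_powR p y0).
by move=> d1 d2; split => //; rewrite -chi0_powRE -derive1E.
Qed.

Lemma stabP_cvg : stabP n%:R @[n --> \oo] --> stabC alpha 0.
Proof.
suff : (stabP n%:R)%:E @[n --> \oo] --> (stabC alpha 0)%:E by move/fine_cvgP => [].
under eq_fun do rewrite EFin_stabP.
rewrite -(stab_int_fin alpha01 (lexx 0)) /stab_int.
have -> : `[0%R, +oo[%classic = \bigcup_n (`[0%R, n%:R]%classic : set R).
  apply/seteqP; split => x /=; rewrite ?in_itv/= ?andbT.
    move=> x0; exists (Num.truncn x).+1 => //=; rewrite in_itv/= x0/=.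
    exact/ltW/Num.Theory.truncnS_gt.
  by move=> [n _] /=; rewrite in_itv/= => /andP[].
apply: ge0_nondecreasing_set_cvg_integral.
- move=> m n mn; apply/subsetPset => x /=; rewrite !in_itv/= => /andP[-> xm]/=.
  by rewrite (le_trans xm)// ler_nat.
- by [].
- by move=> n; exact: mchi.
- by move=> n x _; rewrite lee_fin.
Qed.

End StablePrimitive.

(** * A mean value inequality *)

Section DerivativeComparison.
Variable R : realType.

Lemma le_derive_norm (f g df dg : R -> R) (a b : R) : a <= b ->
  (forall x, a <= x <= b -> is_derive x 1 f (df x)) ->
  (forall x, a <= x <= b -> is_derive x 1 g (dg x)) ->
  (forall x, a <= x <= b -> `|df x| <= dg x) ->
  `|f b - f a| <= g b - g a.
Proof.
move=> ab fd gd le.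
have sub x : x \in `]a, b[ -> a <= x <= b.
  by rewrite in_itv/= => /andP[/ltW-> /ltW->].
have mono (h dh : R -> R) : (forall x, a <= x <= b -> is_derive x 1 h (dh x)) ->
    (forall x, a <= x <= b -> 0 <= dh x) -> h a <= h b.
  move=> hd dh0; apply: (@ger0_derive1_le_cc _ h a b) => //.
  - by move=> x /sub/hd [].
  - by move=> x /sub xab; rewrite derive1E; case: (hd x xab) => _ ->; exact: dh0.
  - apply: derivable_within_continuous => x; rewrite in_itv/= => xab.
    by case: (hd x xab).
  - by rewrite in_itv/= lexx.
  - by rewrite in_itv/= lexx andbT.
have m1 : g a - f a <= g b - f b.
  apply: (mono (fun x => g x - f x) (fun x => dg x - df x)) => x xab.
    exact: is_deriveB (gd x xab) (fd x xab).
  by have := le x xab; rewrite ler_norml => /andP[]; lra.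
have m2 : g a + f a <= g b + f b.
  apply: (mono (fun x => g x + f x) (fun x => dg x + df x)) => x xab.
    exact: is_deriveD (gd x xab) (fd x xab).
  by have := le x xab; rewrite ler_norml => /andP[]; lra.
by rewrite ler_norml; apply/andP; split; lra.
Qed.

End DerivativeComparison.

(** * Alternating series for [stabC alpha 0] *)

Section StableSeries.
Variables (R : realType) (alpha : R).
Hypothesis alpha01 : 0 < alpha < 1.
Local Notation p := (alpha^-1).
Local Notation P := (stabP alpha).
Implicit Types (q y e : R) (k N : nat).

Let a0 : 0 < alpha. Proof. by case/andP: alpha01. Qed.
Let a1 : alpha < 1. Proof. by case/andP: alpha01. Qed.
Let p1 : 1 < p. Proof. by rewrite invf_gt1. Qed.
Let p0 : 0 < p. Proof. by rewrite invr_gt0. Qed.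

(** Partial sums of the partial fraction expansion of [pi / sin (alpha pi)], the poles [- k] and
    [k + 1] being paired. *)
Definition reflection_sum N : R :=
  \sum_(k < N) (-1) ^+ k * ((k%:R + alpha)^-1 + (k%:R + 1 - alpha)^-1).

Let geom q N : 0 <= q ->
  (1 + q)^-1 - \sum_(k < N) (-1) ^+ k * q ^+ k = (-1) ^+ N * q ^+ N / (1 + q).
Proof.
move=> q0; have q1 : 1 + q != 0 by rewrite gt_eqF// ltr_pwDl.
elim: N => [|N IH]; first by rewrite big_ord0 subr0 !expr0 !mul1r.
rewrite big_ord_recr/= opprD addrA IH !exprS; field.
exact: q1.
Qed.

Let pow_nat y k : 0 <= y -> y `^ (p * k%:R) = (y `^ p) ^+ k.
Proof. by move=> y0; rewrite powRrM powR_mulrn// powR_ge0. Qed.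

Let dpow (c y : R) : 0 < y -> c != 0 ->
  is_derive y 1 (fun x => x `^ c / c) (y `^ (c - 1)).
Proof.
move=> y0 c0; have := derive_mulr c^-1 (is_derive1_powR c y0).
by rewrite mulrAC mulfV// mul1r.
Qed.

Let ck k : 1 <= p * k%:R + 1. Proof. by rewrite lerDr mulr_ge0// ltW. Qed.

(** Integrates over [[0, 1]] the geometric expansion of [1 / (1 + y^p)], whose remainder is at most
    [y^(p N)]. *)
Lemma stabP1_series N :
  `|P 1 - \sum_(k < N) (-1) ^+ k / (p * k%:R + 1)| <= (p * N%:R + 1)^-1.
Proof.
pose f y := P y - \sum_(k < N) (-1) ^+ k * (y `^ (p * k%:R + 1) / (p * k%:R + 1)).
pose g y := y `^ (p * N%:R + 1) / (p * N%:R + 1).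
have fd y : 0 < y -> is_derive y 1 f ((-1) ^+ N * (y `^ p) ^+ N / (1 + y `^ p)).
  move=> y0; rewrite -geom ?powR_ge0//.
  suff ds : is_derive y 1 (fun y => \sum_(k < N) (-1) ^+ k *
      (y `^ (p * k%:R + 1) / (p * k%:R + 1))) (\sum_(k < N) (-1) ^+ k * (y `^ p) ^+ k).
    exact: (is_deriveB (is_derive_stabP alpha01 y0) ds).
  apply: derive_sum => k; apply: derive_mull.
  have c0 : p * k%:R + 1 != 0 by rewrite gt_eqF// (lt_le_trans _ (ck k)).
  by have := dpow y0 c0; rewrite addrK pow_nat// ltW.
have gd y : 0 < y -> is_derive y 1 g ((y `^ p) ^+ N).
  move=> y0; have c0 : p * N%:R + 1 != 0 by rewrite gt_eqF// (lt_le_trans _ (ck N)).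
  by have := dpow y0 c0; rewrite addrK pow_nat// ltW.
have g0 y : 0 <= g y.
  by rewrite divr_ge0 ?powR_ge0// (le_trans _ (ck N)).
(* Real powers are differentiated at positive points only, so the comparison starts at [e > 0];
   [small] then removes the contribution of [[0, e]]. *)
have main e : 0 < e -> e <= 1 -> `|f 1 - f e| <= g 1 - g e.
  move=> e0 e1.
  apply: (le_derive_norm (df := fun y => (-1) ^+ N * (y `^ p) ^+ N / (1 + y `^ p))
    (dg := fun y => (y `^ p) ^+ N)) => // y /andP[ey _].
  - exact/fd/(lt_le_trans e0).
  - exact/gd/(lt_le_trans e0).
  - have q0 : 0 <= y `^ p by exact: powR_ge0.
    rewrite !normrM normrX normrN1 expr1n mul1r ger0_norm ?exprn_ge0//.
    rewrite ger0_norm ?invr_ge0 ?addr_ge0// ler_piMr ?exprn_ge0//.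
    by rewrite invf_le1 ?ltr_pwDl// lerDl.
have small e : 0 < e -> e <= 1 -> `|f e| <= (N.+1)%:R * e.
  move=> e0 e1; rewrite -natr1 mulrDl mul1r addrC; apply: le_trans (ler_normB _ _) _.
  apply: lerD; first by rewrite ger0_norm ?stabP_ge0// stabP_le_id// ltW.
  apply: le_trans (ler_norm_sum _ _ _) _.
  apply: (@le_trans _ _ (\sum_(k < N) e)); last by rewrite sumr_const card_ord mulr_natl.
  apply: ler_sum => k _; rewrite normrM normrX normrN1 expr1n mul1r.
  have ck0 : 0 < p * k%:R + 1 by exact: lt_le_trans (ck k).
  rewrite ger0_norm ?divr_ge0 ?powR_ge0 ?(ltW ck0)// ler_pdivrMr//.
  apply: (@le_trans _ _ e); last by rewrite ler_peMr ?ck// ltW.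
  by apply: ge1r_powR => //; rewrite e0.
have f1 : f 1 = P 1 - \sum_(k < N) (-1) ^+ k / (p * k%:R + 1).
  by congr (_ - _); apply: eq_bigr => k _; rewrite powR1 mul1r.
have g1 : g 1 = (p * N%:R + 1)^-1 by rewrite /g powR1 mul1r.
rewrite -f1 -g1; apply/ler_addgt0Pr => e e0.
pose e' := Num.min 1 (e / N.+1%:R).
have e'0 : 0 < e' by rewrite lt_min ltr01 divr_gt0.
have e'1 : e' <= 1 by rewrite ge_min lexx.
have e'e : N.+1%:R * e' <= e.
  by rewrite mulrC -ler_pdivlMr ?ltr0n// ge_min lexx orbT.
have := main _ e'0 e'1; have := small _ e'0 e'1; have := g0 e'.
move: (f 1) (f e') (g 1) (g e') e'e => u v w z h1 h2 h3 h4.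
have -> : u = (u - v) + v by ring.
apply: le_trans (ler_normD _ _) _; lra.
Qed.

Let dk k : 0 < p * k.+1%:R - 1.
Proof.
rewrite subr_gt0 (lt_le_trans p1)// ler_peMr ?(ltW p0)//.
by rewrite ler1n.
Qed.

(** The same argument on [[1, +oo[], with the expansion in powers of [y^-p]. The primitives have
    negative exponents because [p > 1], so their values vanish along the integers and only those at
    1 remain. *)
Lemma stabC_tail_series N :
  `|stabC alpha 0 - P 1 - \sum_(k < N) (-1) ^+ k / (p * k.+1%:R - 1)| <=
  (p * N.+1%:R - 1)^-1.
Proof.
pose f y := P y - \sum_(k < N) (-1) ^+ k * (y `^ (1 - p * k.+1%:R) / (1 - p * k.+1%:R)).
pose g y := y `^ (1 - p * N.+1%:R) / (1 - p * N.+1%:R).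
have nz k : 1 - p * k.+1%:R != 0 by rewrite -opprB oppr_eq0 gt_eqF.
have powk y k : 0 < y -> y `^ (- (p * k.+1%:R)) = (y `^ p)^-1 * (y `^ p)^-1 ^+ k.
  by move=> y0; rewrite powRN pow_nat ?(ltW y0)// -exprVn exprS.
have dk' y k : 0 < y -> is_derive y 1 (fun x => x `^ (1 - p * k.+1%:R) / (1 - p * k.+1%:R))
    ((y `^ p)^-1 * (y `^ p)^-1 ^+ k).
  by move=> y0; have := dpow y0 (nz k); rewrite addrAC subrr sub0r powk.
have fd y : 0 < y -> is_derive y 1 f
    ((y `^ p)^-1 * ((-1) ^+ N * (y `^ p)^-1 ^+ N / (1 + (y `^ p)^-1))).
  move=> y0; have q0 : 0 < y `^ p by exact: powR_gt0.
  rewrite -geom ?invr_ge0 ?(ltW q0)//.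
  have -> : (y `^ p)^-1 * ((1 + (y `^ p)^-1)^-1 - \sum_(k < N) (-1) ^+ k * (y `^ p)^-1 ^+ k)
      = (1 + y `^ p)^-1 - \sum_(k < N) (-1) ^+ k * ((y `^ p)^-1 * (y `^ p)^-1 ^+ k).
    rewrite mulrBr; congr (_ - _).
      by field; rewrite !gt_eqF// addr_gt0.
    by rewrite mulr_sumr; apply: eq_bigr => k _; rewrite mulrCA.
  suff ds : is_derive y 1 (fun y => \sum_(k < N) (-1) ^+ k *
      (y `^ (1 - p * k.+1%:R) / (1 - p * k.+1%:R)))
      (\sum_(k < N) (-1) ^+ k * ((y `^ p)^-1 * (y `^ p)^-1 ^+ k)).
    exact: (is_deriveB (is_derive_stabP alpha01 y0) ds).
  by apply: derive_sum => k; apply: derive_mull; exact: dk'.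
have main y : 1 <= y -> `|f y - f 1| <= g y - g 1.
  move=> y1.
  apply: (le_derive_norm (df := fun y => (y `^ p)^-1 *
      ((-1) ^+ N * (y `^ p)^-1 ^+ N / (1 + (y `^ p)^-1)))
    (dg := fun y => (y `^ p)^-1 * (y `^ p)^-1 ^+ N)) => // x /andP[/(lt_le_trans ltr01) x0 _].
  - exact: fd.
  - exact: dk'.
  - have q0 : 0 <= (x `^ p)^-1 by rewrite invr_ge0 powR_ge0.
    rewrite normrM (ger0_norm q0) ler_wpM2l//.
    rewrite !normrM normrX normrN1 expr1n mul1r ger0_norm ?exprn_ge0//.
    rewrite ger0_norm ?invr_ge0 ?addr_ge0// ler_piMr ?exprn_ge0//.
    by rewrite invf_le1 ?ltr_pwDl// lerDl.
have gN y : 0 < y -> g y <= 0.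
  by move=> y0; rewrite /g pmulr_rle0 ?powR_gt0// invr_le0 -opprB oppr_le0 ltW.
have g1 : - g 1 = (p * N.+1%:R - 1)^-1 by rewrite /g powR1 mul1r -invrN opprB.
have f1 : f 1 = P 1 + \sum_(k < N) (-1) ^+ k / (p * k.+1%:R - 1).
  rewrite /f -sumrN; congr (_ + _); apply: eq_bigr => k _.
  by rewrite powR1 mul1r -mulrN -invrN opprB.
have pow_cvg k : (n%:R : R) `^ (1 - p * k.+1%:R) @[n --> \oo] --> 0.
  apply/cvgr0Pnorm_le => e e0; near=> n.
  have n0 : 0 < n%:R :> R by rewrite ltr0n; near: n; exists 1%N.
  have ne : e `^ (- (p * k.+1%:R - 1)^-1) <= n%:R.
    by near: n; exact: nbhs_infty_ger.
  rewrite ger0_norm ?powR_ge0// -opprB powRN.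
  rewrite -[leRHS]invrK lef_pV2 ?posrE ?invr_gt0 ?powR_gt0//.
  have -> : e^-1 = (e `^ (- (p * k.+1%:R - 1)^-1)) `^ (p * k.+1%:R - 1).
    by rewrite -powRrM mulNr mulVf ?gt_eqF// powR_inv1// ltW.
  by apply: ge0_ler_powR; rewrite ?nnegrE ?powR_ge0 ?ler0n// ltW.
have fcvg : `|f n%:R - f 1| @[n --> \oo] --> `|stabC alpha 0 - f 1|.
  apply: cvg_norm; apply: cvgB; last exact: cvg_cst.
  rewrite -[stabC alpha 0]subr0; apply: cvgB; first exact: stabP_cvg.
  rewrite [X in _ --> X](_ : 0 = \sum_(k < N) 0); last by rewrite big1.
  apply: cvg_sumr => k.
  rewrite -[X in _ --> X](mulr0 ((-1) ^+ k)); apply: cvgMl_tmp.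
  rewrite -[X in _ --> X](mul0r (1 - p * k.+1%:R)^-1); apply: cvgMr_tmp.
  exact: pow_cvg.
rewrite -addrA -opprD -f1 -g1; apply: (cvgr_to_le fcvg); near=> n.
have n1 : 1 <= n%:R :> R by rewrite ler1n; near: n; exists 1%N.
by apply: le_trans (main _ n1) _; rewrite gerDr gN// (lt_le_trans ltr01).
Unshelve. all: by end_near. Qed.

Lemma reflection_sum_bound N :
  `|stabC alpha 0 / alpha - reflection_sum N| <=
  (N%:R + alpha)^-1 + (N%:R + 1 - alpha)^-1.
Proof.
have E1 k : (p * k%:R + 1)^-1 = alpha * (k%:R + alpha)^-1.
  have h : k%:R + alpha != 0 by rewrite gt_eqF// ltr_wpDl.
  field; rewrite ?h ?gt_eqF//.
have E2 k : (p * k.+1%:R - 1)^-1 = alpha * (k%:R + 1 - alpha)^-1.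
  have h : k%:R + 1 - alpha != 0.
    by rewrite gt_eqF// -addrA ltr_wpDl// subr_gt0.
  rewrite -natr1; field; rewrite ?h ?gt_eqF//.
have S1 := stabP1_series N; have S2 := stabC_tail_series N.
rewrite E1 in S1; rewrite E2 in S2.
have -> : stabC alpha 0 / alpha - reflection_sum N =
    alpha^-1 * ((P 1 - \sum_(k < N) (-1) ^+ k / (p * k%:R + 1)) +
     (stabC alpha 0 - P 1 - \sum_(k < N) (-1) ^+ k / (p * k.+1%:R - 1))).
  rewrite (_ : reflection_sum N = alpha^-1 * (\sum_(k < N) (-1) ^+ k / (p * k%:R + 1) +
      \sum_(k < N) (-1) ^+ k / (p * k.+1%:R - 1))).
    by ring.
  rewrite -big_split/= mulr_sumr; apply: eq_bigr => k _.
  by rewrite E1 E2 -mulrDr -mulrDr mulrCA mulKf ?gt_eqF.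
rewrite normrM ger0_norm ?(ltW p0)// -(ler_pM2l a0) mulVKf ?gt_eqF// mulrDr.
by apply: le_trans (ler_normD _ _) _; exact: lerD.
Qed.

Lemma reflection_sum_cvg : reflection_sum N @[N --> \oo] --> stabC alpha 0 / alpha.
Proof.
apply/cvgrPdist_le => e e0; near=> N.
apply: le_trans (reflection_sum_bound N) _.
have N0 : 0 < N%:R :> R by rewrite ltr0n; near: N; exists 1%N.
have Ne : 2 / e <= N%:R by near: N; exact: nbhs_infty_ger.
have le c : 0 <= c -> (N%:R + c)^-1 <= e / 2.
  move=> c0; rewrite -[leRHS]invrK lef_pV2 ?posrE ?invr_gt0 ?divr_gt0 ?ltr_wpDr//.
  by rewrite invf_div (le_trans Ne)// lerDl.
rewrite -[N%:R + 1 - _]addrA [leRHS]splitr lerD// le ?(ltW a0)//.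
by rewrite subr_ge0 ltW.
Unshelve. all: by end_near. Qed.

End StableSeries.

(** * The reflection formula by Cesaro means *)

Section Reflection.
Variables (R : realType).
Implicit Types (a x : R) (j N M : nat).

Let cos_pair a x j : cos ((a + j%:R) * x) + cos ((a - j%:R - 1) * x) =
  2 * cos ((a - 2^-1) * x) * cos ((j%:R + 2^-1) * x).
Proof.
have -> : (a + j%:R) * x = (a - 2^-1) * x + (j%:R + 2^-1) * x by field.
have -> : (a - j%:R - 1) * x = (a - 2^-1) * x - (j%:R + 2^-1) * x by field.
by rewrite cosB cosD; ring.
Qed.

Let dirichlet x N :
  sin (x / 2) * \sum_(j < N) 2 * cos ((j%:R + 2^-1) * x) = sin (N%:R * x).
Proof.
elim: N => [|N IH]; first by rewrite big_ord0 mulr0 mul0r sin0.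
rewrite big_ord_recr/= mulrDr IH.
have -> : N.+1%:R * x = (N%:R + 2^-1) * x + x / 2 by rewrite -natr1; field.
have -> : N%:R * x = (N%:R + 2^-1) * x - x / 2 by field.
by rewrite sinB sinD; ring.
Qed.

(** Summing the Dirichlet kernels telescopes once more after multiplication by [sin (x / 2)]. The
    right side is at most 2 in absolute value, independently of [M]. *)
Let fejer x M :
  2 * sin (x / 2) ^+ 2 * \sum_(N < M) \sum_(j < N) 2 * cos ((j%:R + 2^-1) * x) =
  cos (x / 2) - cos ((M%:R - 2^-1) * x).
Proof.
elim: M => [|M IH].
  by rewrite big_ord0 mulr0 sub0r mulNr cosN mulrC subrr.
rewrite big_ord_recr/= mulrDr IH expr2 -!mulrA dirichlet.
have -> : (M.+1%:R - 2^-1) * x = M%:R * x + x / 2 by rewrite -natr1; field.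
have -> : (M%:R - 2^-1) * x = M%:R * x - x / 2 by field.
by rewrite cosB cosD; ring.
Qed.

(** The left side is [2 sin^2 ((a - 1/2) x / 2)], and the half-angle is at most [x / 2] in absolute
    value, inside the interval where the sine increases. *)
Let one_minus_cos a x : 0 <= a <= 1 -> 0 <= x <= pi ->
  `|cos ((a - 2^-1) * x) - 1| <= 2 * sin (x / 2) ^+ 2.
Proof.
move=> /andP[a0 a1] /andP[x0 xpi].
have half (y : R) : cos y - 1 = - (2 * sin (y / 2) ^+ 2).
  have {1}-> : y = (y / 2) *+ 2 by rewrite -[_ *+ 2]mulr_natr; field.
  by rewrite cos_mulr2n -mulr_natl cos2sin2; ring.
rewrite half normrN ger0_norm; last by rewrite mulr_ge0 ?sqr_ge0.
rewrite ler_pM2l//.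
set y := _ / 2.
have y1 : y <= x / 2 by rewrite /y; nra.
have y2 : - (x / 2) <= y by rewrite /y; nra.
have ls (u v : R) : - (pi / 2) <= u -> u <= v -> v <= pi / 2 -> sin u <= sin v.
  move=> u1; rewrite le_eqVlt => /predU1P[->//|uv] v1.
  by rewrite ltW// ltr_sin// in_itv/=; apply/andP; split; lra.
have : sin y <= sin (x / 2) by apply: ls; lra.
have : sin (- (x / 2)) <= sin y by apply: ls; lra.
rewrite sinN; nra.
Qed.

Let sin_nat a j : sin ((a + j%:R) * pi) = (-1) ^+ j * sin (a * pi).
Proof.
elim: j => [|j IH]; first by rewrite addr0 expr0 mul1r.
have -> : (a + j.+1%:R) * pi = (a + j%:R) * pi + pi by rewrite -natr1; ring.
by rewrite sinDpi IH exprS mulN1r mulNr.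
Qed.

Let sin_nat' a j : sin ((a - j%:R - 1) * pi) = - ((-1) ^+ j * sin (a * pi)).
Proof.
have E : (-1) ^+ j * (-1) ^+ j = 1 :> R by rewrite -expr2 sqrr_sign.
have := sin_nat (a - j%:R - 1) j.+1.
have -> : a - j%:R - 1 + j.+1%:R = a by rewrite -natr1; ring.
move=> ->; rewrite exprS; set z := sin _; set s := (-1) ^+ j in E *.
by rewrite (_ : - _ = (s * s) * z); [rewrite E mul1r|ring].
Qed.

(* The sum is the integral over [[0, pi]] of [cos ((a - 1/2) x) - 1] times a Fejer
   kernel, whose singularity [1 / sin (x / 2) ^ 2] is cancelled by the first factor. *)
Let reflection_mean a M : 0 < a < 1 ->
  `|\sum_(N < M) (sin (a * pi) * reflection_sum a N - reflection_sum 2^-1 N)| <= 2 * pi.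
Proof.
move=> /andP[a0 a1]; have pi0 : 0 <= pi :> R by exact: pi_ge0.
(* [term] is the primitive of [dterm] that vanishes at 0. At [x = pi] it is [sin (b pi)] times the
   term of rank [j] of [reflection_sum b]. Subtracting the case [b = 1/2], where the factor
   [cos ((b - 1/2) x)] is 1, produces [cos ((a - 1/2) x) - 1]. *)
pose term b x j := sin ((b + j%:R) * x) / (b + j%:R) +
  sin ((b - j%:R - 1) * x) / (b - j%:R - 1).
pose dterm b x j := cos ((b + j%:R) * x) + cos ((b - j%:R - 1) * x).
have dsin (c x : R) : c != 0 -> is_derive x 1 (fun x => sin (c * x) / c) (cos (c * x)).
  move=> c0; have := derive_mulr c^-1 (derive_scale (is_derive_sin (c * x))).
  by rewrite mulrC mulrA mulVf// mul1r.
have nz1 (b : R) j : 0 < b -> b + j%:R != 0 by move=> b0; rewrite gt_eqF// ltr_wpDr.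
have nz2 (b : R) j : b < 1 -> b - j%:R - 1 != 0.
  by move=> b1; rewrite lt_eqF//; have := ler0n R j; lra.
have dt b x j : 0 < b < 1 -> is_derive x 1 (term b ^~ j) (dterm b x j).
  move=> /andP[b0 b1]; apply: is_deriveD; first exact/dsin/nz1.
  exact/dsin/nz2.
pose F x := \sum_(N < M) \sum_(j < N) (term a x j - term 2^-1 x j).
pose f x := \sum_(N < M) \sum_(j < N) (dterm a x j - dterm 2^-1 x j).
have h01 : 0 < (2^-1 : R) < 1 by lra.
have Fd x : is_derive x 1 F (f x).
  apply: derive_sum => N; apply: derive_sum => j.
  by apply: is_deriveB; apply: dt => //; rewrite a0.
have fE x : f x = (cos ((a - 2^-1) * x) - 1) *
    \sum_(N < M) \sum_(j < N) 2 * cos ((j%:R + 2^-1) * x).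
  rewrite mulr_sumr; apply: eq_bigr => N _; rewrite mulr_sumr; apply: eq_bigr => j _.
  by rewrite /dterm !cos_pair subrr mul0r cos0; ring.
(* The integrand is bounded by 2 on [[0, pi]], hence the bound [2 pi], free of [M]. *)
have := @le_derive_norm R F (fun x => 2 * x) f (fun=> 2) 0 pi pi0.
rewrite mulr0 subr0.
have F0 : F 0 = 0.
  by rewrite /F big1// => N _; rewrite big1// => j _; rewrite /term !mulr0 sin0 !mul0r addr0 subr0.
have reflE b j : 0 < b < 1 -> term b pi j =
    sin (b * pi) * ((-1) ^+ j * ((j%:R + b)^-1 + (j%:R + 1 - b)^-1)).
  move=> /andP[b0 b1]; rewrite /term sin_nat sin_nat'.
  have -> : b - j%:R - 1 = - (j%:R + 1 - b) by ring.
  by rewrite invrN mulrNN (addrC b); ring.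
have Fpi : F pi = \sum_(N < M) (sin (a * pi) * reflection_sum a N - reflection_sum 2^-1 N).
  apply: eq_bigr => N _; rewrite sumrB; congr (_ - _).
    by rewrite /reflection_sum mulr_sumr; apply: eq_bigr => j _; rewrite reflE// a0.
  apply: eq_bigr => j _; rewrite reflE// (mulrC 2^-1).
  by rewrite sin_pihalf mul1r.
rewrite F0 subr0 Fpi; apply.
- by move=> x _; have := derive_mull 2 (is_derive_id x (1 : R)); rewrite mulr1.
- move=> x xpi; rewrite fE normrM.
  have := fejer x M; set K := \sum_(N < M) _ => KE.
  apply: (@le_trans _ _ (2 * sin (x / 2) ^+ 2 * `|K|)).
    by rewrite ler_wpM2r// one_minus_cos// !ltW.
  have s0 : 0 <= 2 * sin (x / 2) ^+ 2 by rewrite mulr_ge0 ?sqr_ge0.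
  rewrite -(ger0_norm s0) -normrM KE.
  rewrite (le_trans (ler_normB _ _))// -[leRHS]/(1 + 1) lerD//.
    by rewrite ler_norml cos_le1 cos_geN1.
  by rewrite ler_norml cos_le1 cos_geN1.
Qed.

(** At [alpha = 1/2] the integrand is [1 / (1 + x^2)], with primitive [atan]. *)
Lemma stabC_half : stabC (2^-1 : R) 0 = pi / 2.
Proof.
have h01 : 0 < (2^-1 : R) < 1 by lra.
rewrite /stabC /stab_int.
rewrite [X in fine X](_ : _ = \int[lebesgue_measure]_(x in `[0%R, +oo[)
    ((1 + x ^+ 2)^-1)%:E)%E; last first.
  apply: eq_integral => x; rewrite inE/= in_itv/= andbT => x0.
  by rewrite chi0_powRE invrK powR_mulrn.
have pos (x : R) : 0 < 1 + x ^+ 2 by rewrite ltr_pwDl// sqr_ge0.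
rewrite (@ge0_continuous_FTC2y _ (fun x => (1 + x ^+ 2)^-1) (@atan R) 0 (pi / 2)).
- by rewrite atan0 -EFinB/= subr0.
- by move=> x _; rewrite invr_ge0 ltW.
- apply: continuous_subspaceT => x; apply: cvgV; first by rewrite gt_eqF.
  by apply: cvgD; [exact: cvg_cst|exact: exprn_continuous].
- exact: cvgy_atan.
- by move=> x _; exact: derivable_atan.
- by apply: cvg_at_right_filter; exact: continuous_atan.
- by move=> x _; rewrite derive1_atan.
Qed.

(* The Cesaro means of [sin (a pi) S_N(a) - S_N(1/2)] vanish, which transfers the
   value at [a = 1/2] to every [a]. *)
Lemma stabC_reflection a : 0 < a < 1 -> sin (a * pi) * stabC a 0 = a * pi.
Proof.
move=> a01; have [a0 a1] := andP a01.
have h01 : 0 < (2^-1 : R) < 1 by lra.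
pose u N := sin (a * pi) * reflection_sum a N - reflection_sum 2^-1 N.
pose l := sin (a * pi) * (stabC a 0 / a) - stabC (2^-1 : R) 0 / 2^-1.
have ul : u @ \oo --> l.
  apply: cvgB; last exact: reflection_sum_cvg.
  by apply: cvgMl_tmp; exact: reflection_sum_cvg.
have c1 := cesaro ul.
have c0 : arithmetic_mean u @ \oo --> 0.
  apply/cvgr0Pnorm_le => e e0; near=> n.
  rewrite /arithmetic_mean/= normrM ger0_norm// seriesEord/=.
  rewrite mulrC ler_pdivrMr// (le_trans (reflection_mean _ a01))// -ler_pdivrMl//.
  rewrite mulrC (@le_trans _ _ n%:R) ?ler_nat//; near: n.
  exact: nbhs_infty_ger.
have /eqP : l = 0 by exact: (cvg_unique _ c1 c0).
rewrite subr_eq0 stabC_half invrK divfK// mulrA => /eqP H.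
by rewrite -[LHS](divfK (lt0r_neq0 a0)) H mulrC.
Unshelve. all: by end_near. Qed.

End Reflection.

(** * The limit function and its moments *)

Section LimitFunction.
Variables (R : realType) (alpha theta : R).
Hypothesis alpha01 : 0 < alpha < 1.
Hypothesis theta0 : 0 < theta.
Local Notation leb := (@lebesgue_measure R).
Local Notation p := (alpha^-1).
Implicit Types (u x y : R) (k : nat).

Let a0 : 0 < alpha. Proof. by case/andP: alpha01. Qed.
Let C0 : 0 < stabC alpha 0. Proof. exact: stabC_gt0. Qed.

(* The limiting probability of not moving during [[t, t + theta]], where [u = e^-t]. *)
Definition stabPhi u : R := stabP alpha ((- ln u / theta) `^ alpha) / stabC alpha 0.

Lemma stabPhi_01 u : 0 <= stabPhi u <= 1.
Proof.
apply/andP; split; first exact: divr_ge0 (stabP_ge0 _ _) (ltW C0).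
by rewrite /stabPhi (ler_pdivrMr _ _ C0) mul1r; exact: stabP_le.
Qed.

Let mstabP : measurable_fun [set: R] (fun u => stabP alpha ((- ln u / theta) `^ alpha)).
Proof.
apply: (measurableT_comp (f := stabP alpha)).
  by apply: nondecreasing_measurable => // x y; exact: stabP_homo.
apply: (measurableT_comp (measurable_powR alpha)).
apply: measurable_funM => //; apply: measurable_funN.
exact: measurable_ln.
Qed.

Lemma bdd_meas_stabPhi : bdd_meas stabPhi.
Proof.
split; first exact: measurable_funM.
by exists 1 => u _; have /andP[h0 h1] := stabPhi_01 u; rewrite ger0_norm.
Qed.

Lemma continuous_stabPhi u : 0 < u < 1 -> {for u, continuous stabPhi}.
Proof.
move=> /andP[u0 u1]; apply: cvgMr_tmp.
have v0 : 0 < - ln u / theta by rewrite divr_gt0// oppr_gt0 ln_lt0// u0.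
have := @continuous_comp _ _ _ (fun u => (- ln u / theta) `^ alpha) (stabP alpha) u.
apply; last exact: is_derive_continuous_at (is_derive_stabP alpha01 (powR_gt0 alpha v0)).
have := @continuous_comp _ _ _ (fun u => - ln u / theta) (fun y => y `^ alpha) u.
apply; last exact: is_derive_continuous_at (is_derive1_powR alpha v0).
by apply: cvgMr_tmp; apply: cvgN; exact: continuous_ln.
Qed.

Let integral_pow (c : R) k : 0 < c ->
  (\int[leb]_(u in `[0%R, c]) (u ^+ k.+1)%:E = (c ^+ k.+2 / k.+2%:R)%:E)%E.
Proof.
move=> c0; pose F u : R := u ^+ k.+2 / k.+2%:R.
have Fd u : is_derive u 1 F (u ^+ k.+1).
  have := derive_mulr k.+2%:R^-1 (derive_exprn k.+1 u).
  by rewrite mulrAC mulfV ?mul1r// pnatr_eq0.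
rewrite (@continuous_FTC2 _ _ F 0 c c0).
- by rewrite /F expr0n mul0r sube0.
- by apply: continuous_subspaceT => u; exact: exprn_continuous.
- have Fc : continuous F by exact: is_derive_continuous Fd.
  split.
  + by move=> u _; case: (Fd u).
  + by apply: cvg_at_right_filter; exact: Fc.
  + by apply: cvg_at_left_filter; exact: Fc.
- by move=> u _; rewrite derive1E; case: (Fd u).
Qed.

Let below u x : 0 < u -> u <= 1 -> 0 <= x ->
  (u <= expR (- theta * x `^ p)) = (x <= (- ln u / theta) `^ alpha).
Proof.
move=> u0 u1 x0; rewrite -(powR_le_inv alpha01)//; last first.
  by rewrite divr_ge0 ?(ltW theta0)// oppr_ge0 ln_le0.
rewrite ler_pdivlMr// -[X in X <= _](lnK (_ : u \is Num.pos))// ler_expR.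
by rewrite mulNr lerNr mulrC.
Qed.

(** Tonelli on the region [u <= exp (- theta x^p)], with integrand [u^(k+1) / (1 + x^p)].
    Integrating in [x] first gives the moment of [stabP]; integrating in [u] first gives
    [exp (- theta (k+2) x^p) / (k+2)], which turns [chi 0] into [chi (theta * (k+2))]. *)
Lemma int01_stabPhi k : k.+2%:R * int01 (fun u => u ^+ k.+1 * stabPhi u) =
  stabC alpha (theta * k.+2%:R) / stabC alpha 0.
Proof.
pose G u := stabP alpha ((- ln u / theta) `^ alpha).
have bG : bdd_meas (fun u => u ^+ k.+1 * G u).
  apply: bdd_measM; first exact: bdd_measX.
  split; first exact: mstabP.
  by exists (stabC alpha 0) => u _; rewrite ger0_norm ?stabP_ge0// stabP_le.
suff H : k.+2%:R * int01 (fun u => u ^+ k.+1 * G u) = stabC alpha (theta * k.+2%:R).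
  rewrite -H -mulrA; congr (_ * _); rewrite mulrC -int01Z//.
  by apply: eq_int01 => u _; rewrite /stabPhi -/(G u); ring.
have tk0 : 0 <= theta * k.+2%:R by rewrite mulr_ge0// ltW.
pose A : set (R * R) := [set z | 0 <= z.1] `&` [set z | 0 <= z.2] `&`
  [set z | z.1 <= expR (- theta * z.2 `^ p)].
have mle (h : R * R -> R) : measurable_fun setT h -> measurable [set z | 0 <= h z].
  move=> mh; have := mh measurableT _ (measurable_itv `[0, +oo[); rewrite setTI.
  by rewrite (_ : _ @^-1` _ = [set z | 0 <= h z])//; apply/seteqP; split => z /=;
    rewrite in_itv/= andbT.
have mA : measurable A.
  apply: measurableI; first by apply: measurableI; apply: mle;
    [exact: measurable_fst|exact: measurable_snd].
  rewrite (_ : [set z | _] = [set z : R * R | 0 <= expR (- theta * z.2 `^ p) - z.1]).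
    apply: mle; apply: measurable_funB; last exact: measurable_fst.
    apply: measurableT_comp; first exact: measurable_expR.
    apply: measurable_funM => //.
    exact: (measurableT_comp (measurable_powR p) measurable_snd).
  by apply/seteqP; split => z /=; rewrite subr_ge0.
pose f (z : R * R) := (\1_A z * (z.1 ^+ k.+1 * chi 0 (z.2 `^ p)))%:E.
have mf : measurable_fun setT f.
  apply/measurable_EFinP; apply: measurable_funM; first exact: measurable_indic.
  apply: measurable_funM; first by apply: measurable_funX; exact: measurable_fst.
  exact: (measurableT_comp (measurable_chi_pow alpha 0) measurable_snd).
have f0 z : (0 <= f z)%E.
  rewrite lee_fin indicE; case: (boolP (z \in A)); rewrite ?mul0r// inE => -[[/= z1 z2] _].
  by rewrite mul1r mulr_ge0 ?exprn_ge0// ltW// chi_gt0.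
have L : (\int[leb]_u \int[leb]_x f (u, x) = (int01 (fun u => u ^+ k.+1 * G u))%:E)%E.
  rewrite /int01 /Rintegral fineK; last first.
    by apply: integrable_fin_num => //; apply: bdd_meas_integrable.
  rewrite [RHS]integral_mkcond; apply: eq_integral => u _.
  rewrite patchE mem_setE in_itv/=; case: ifPn => [/andP[u0 u1]|u01]; last first.
    rewrite -[RHS](integral0 leb setT); apply: eq_integral => x _.
    rewrite /f indicE (_ : _ \in A = false) ?mul0r//.
    apply/negbTE; rewrite notin_setE => -[[/= u0 x0] ux]; move/negP: u01; apply.
    rewrite u0 (le_trans ux)// -expR0 ler_expR mulNr oppr_le0 mulr_ge0 ?powR_ge0//.
    exact: ltW.
  move: u0; rewrite le_eqVlt => /predU1P[<-|u0].
    rewrite expr0n mul0r -[RHS](integral0 leb setT); apply: eq_integral => x _.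
    by rewrite /f/= expr0n mul0r mulr0.
  rewrite EFinM (EFin_stabP alpha01) -ge0_integralZl//=; last 3 first.
  - by apply/measurable_EFinP; apply: measurable_funTS; exact: measurable_chi_pow.
  - by move=> x _; rewrite lee_fin ltW// chi_gt0.
  - by rewrite lee_fin exprn_ge0// ltW.
  rewrite [RHS]integral_mkcond; apply: eq_integral => x _.
  rewrite patchE mem_setE in_itv/= /f indicE.
  have -> : (u, x) \in A = (0 <= x <= (- ln u / theta) `^ alpha).
    apply/idP/idP => [|/andP[x0 xu]].
      by rewrite inE => -[[/= _ x0]]; rewrite below// x0.
    by rewrite inE; split; [split => //=; exact: ltW|rewrite /= below].
  by case: ifP; rewrite ?mul1r ?mul0r -?EFinM.
have E : ((int01 (fun u => u ^+ k.+1 * G u))%:E =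
    (k.+2%:R^-1)%:E * (stabC alpha (theta * k.+2%:R))%:E)%E.
  rewrite -L (@fubini_tonelli _ _ _ _ R leb leb f mf f0) -(stab_int_fin alpha01 tk0) /stab_int -ge0_integralZl//=; last 2 first.
  - by apply/measurable_EFinP; apply: measurable_funTS; exact: measurable_chi_pow.
  - by move=> x _; rewrite lee_fin ltW// chi_gt0.
  rewrite [RHS]integral_mkcond; apply: eq_integral => x _.
  rewrite patchE mem_setE in_itv/= andbT; case: ifPn => x0; last first.
    rewrite -[RHS](integral0 leb setT); apply: eq_integral => u _.
    rewrite /f indicE (_ : _ \in A = false) ?mul0r//.
    by apply/negbTE; rewrite notin_setE => -[[_ /= h]]; rewrite h in x0.
  set c := expR (- theta * x `^ p).
  have -> : ((k.+2%:R^-1)%:E * (chi (theta * k.+2%:R) (x `^ p))%:E =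
      (chi 0 (x `^ p))%:E * (c ^+ k.+2 / k.+2%:R)%:E)%E.
    rewrite -!EFinM; congr _%:E; rewrite /c -expRM_natr /chi oppr0 mul0r expR0.
    have -> : - theta * x `^ p * k.+2%:R = - (theta * k.+2%:R) * x `^ p by ring.
    by ring.
  rewrite -integral_pow ?expR_gt0// -ge0_integralZl//=; last 3 first.
  - by apply/measurable_EFinP; apply: measurable_funTS; exact: exprn_measurable.
  - by move=> u; rewrite in_itv/= => /andP[u0 _]; rewrite lee_fin exprn_ge0.
  - by rewrite lee_fin ltW// chi_gt0.
  rewrite [RHS]integral_mkcond; apply: eq_integral => u _.
  rewrite patchE mem_setE in_itv/= /f indicE.
  have -> : (u, x) \in A = (0 <= u <= c).
    apply/idP/idP => [|/andP[u0 uc]]; rewrite inE; last by [].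
    by move=> [[/= -> _]].
  by case: ifP; rewrite ?mul1r ?mul0r -?EFinM// mulrC.
by case: E => ->; rewrite mulrA mulfV ?mul1r// pnatr_eq0.
Qed.

End LimitFunction.

(** * Identification with the generalised arcsine law *)

Section Arcsine.
Variables (R : realType) (alpha theta : R).
Hypothesis alpha01 : 0 < alpha < 1.
Hypothesis theta0 : 0 < theta.
Local Notation leb := (@lebesgue_measure R).
Local Notation p := (alpha^-1).
Implicit Types (s : R).

Let a0 : 0 < alpha. Proof. by case/andP: alpha01. Qed.
Let dens s : R := s `^ (alpha - 1) * (1 - s) `^ (- alpha).
Let G s : R := stabP alpha ((s / (1 - s)) `^ alpha) / alpha.

Let dens_ge0 s : 0 <= dens s.
Proof. by rewrite mulr_ge0// powR_ge0. Qed.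

(** With [x = (s / (1 - s))^alpha] one has [1 + x^(1/alpha) = 1 / (1 - s)], and [dx / ds] is
    [alpha s^(alpha-1) (1 - s)^(-alpha-1)]; the quotient is [alpha] times the density. *)
Let is_derive_G s : 0 < s < 1 -> is_derive s 1 G (dens s).
Proof.
move=> /andP[s0 s1]; have r0 : 0 < 1 - s by rewrite subr_gt0.
have y0 : 0 < s / (1 - s) by rewrite divr_gt0.
have dr : is_derive s 1 (fun s => (1 - s)^-1) ((1 - s) ^- 2).
  have d1 : is_derive s 1 (fun s : R => 1 - s) (-1).
    by have := derive_reflect (is_derive_id (1 - s) (1 : R)).
  have r1 : 1 - s != 0 by rewrite gt_eqF.
  have dV := @is_deriveV R (fun s => 1 - s) s (-1) 1 r1 d1.
  apply: is_derive_eq dV _.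
  by rewrite /GRing.scale/= mulrNN mulr1 -exprVn.
have dy := derive_mul (is_derive_id s (1 : R)) dr.
have dw := is_derive1_comp (g := fun s => s / (1 - s)) (is_derive1_powR alpha y0) dy.
have dP := is_derive1_comp (g := fun s => (s / (1 - s)) `^ alpha)
  (is_derive_stabP alpha01 (powR_gt0 alpha y0)) dw.
apply: is_derive_eq (derive_mulr alpha^-1 dP) _.
rewrite -powRrM mulfV ?gt_eqF// powRr1 ?(ltW y0)//.
have -> : (1 + s / (1 - s))^-1 = 1 - s by field; rewrite gt_eqF//= subrK oner_neq0.
rewrite powRM ?invr_ge0 ?(ltW s0) ?(ltW r0)// -(powR_inv1 (ltW r0)) -powRrM.
have -> : dens s = s `^ (alpha - 1) * ((1 - s) `^ (-1 * (alpha - 1)) * (1 - s)^-1).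
  rewrite -(powR_inv1 (ltW r0)) -powRD; last first.
    by rewrite (gt_eqF r0) implybT.
  by congr (_ * _ `^ _); ring.
rewrite (powR_inv1 (ltW r0)).
by field; rewrite !gt_eqF.
Qed.

(** The density is unbounded at 0, so the fundamental theorem is applied on [[e n, u]], and monotone
    convergence removes the cutoff. *)
Lemma integral_arcsine u : 0 < u < 1 ->
  \int[leb]_(s in `[0, u]) dens s = stabP alpha ((u / (1 - u)) `^ alpha) / alpha.
Proof.
move=> /andP[u0 u1]; have v0 : 0 < 1 - u by rewrite subr_gt0.
(* The shift by two makes every cutoff strictly smaller than [u]. *)
pose e n : R := u / n.+2%:R.
have e0 n : 0 < e n by rewrite divr_gt0.
have eu n : e n < u by rewrite ltr_pdivrMr// ltr_pMr// ltr1n.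
have mdens (D : set R) : measurable_fun D (fun s => (dens s)%:E).
  apply: measurable_funTS; apply/measurable_EFinP; apply: measurable_funM.
    exact: measurable_powR.
  by apply: (measurableT_comp (measurable_powR _)); exact: measurable_funB.
have part n : (\int[leb]_(s in `[e n, u]) (dens s)%:E = (G u - G (e n))%:E)%E.
  have in01 s : e n <= s <= u -> 0 < s < 1.
    by move=> /andP[es su]; rewrite (lt_le_trans (e0 n) es) (le_lt_trans su u1).
  have cG s : e n <= s <= u -> {for s, continuous G}.
    by move=> /in01/is_derive_G; exact: is_derive_continuous_at.
  rewrite (@continuous_FTC2 _ dens G (e n) u (eu n)) ?EFinB//.
  - apply: continuous_in_subspaceT => s; rewrite inE/= in_itv/= => /in01/andP[s0 s1].
    have s1' : 0 < 1 - s by rewrite subr_gt0.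
    exact: cvgM (is_derive_continuous_at (is_derive1_powR (alpha - 1) s0))
      (is_derive_continuous_at (derive_reflect (is_derive1_powR (- alpha) s1'))).
  - split.
    + move=> s; rewrite in_itv/= => /andP[/ltW es /ltW su].
      by case: (is_derive_G (in01 s _)) => //; rewrite es.
    + by apply: cvg_at_right_filter; apply: cG; rewrite lexx (ltW (eu n)).
    + by apply: cvg_at_left_filter; apply: cG; rewrite lexx (ltW (eu n)).
  - move=> s; rewrite in_itv/= => /andP[/ltW es /ltW su]; rewrite derive1E.
    by case: (is_derive_G (in01 s _)) => //; rewrite es.
have Ge : G (e n) @[n --> \oo] --> 0.
  apply/cvgr0Pnorm_le => r r0; near=> n.
  rewrite ger0_norm ?divr_ge0 ?stabP_ge0 ?(ltW a0)// ler_pdivrMr//.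
  apply: le_trans (stabP_le_id alpha01 (powR_ge0 _ _)) _.
  have ra0 : 0 < r * alpha by rewrite mulr_gt0.
  have -> : r * alpha = ((r * alpha) `^ p) `^ alpha.
    by rewrite -powRrM mulVf ?gt_eqF// powRr1// ltW.
  have q0 : 0 < (r * alpha) `^ p by exact: powR_gt0.
  have en1 : 0 < 1 - e n by rewrite subr_gt0 (lt_trans (eu n)).
  have en0 : 0 <= e n / (1 - e n) := divr_ge0 (ltW (e0 n)) (ltW en1).
  apply: ge0_ler_powR; rewrite ?nnegrE ?en0 ?(ltW a0) ?(ltW q0)//.
  apply: (@le_trans _ _ (e n / (1 - u))).
    rewrite (ler_pM2l (e0 n)) lef_pV2 ?posrE// lerD2l lerN2 ltW//.
  have : u / ((1 - u) * (r * alpha) `^ p) <= n%:R by near: n; exact: nbhs_infty_ger.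
  rewrite ler_pdivrMr ?mulr_gt0// /e !ler_pdivrMr// => /le_trans; apply.
  rewrite mulrC (mulrC (1 - u)) ler_wpM2l ?mulr_ge0 ?(ltW v0) ?(ltW q0)//.
  by rewrite ler_nat -addn2 leq_addr.
have lim1 : (\int[leb]_(s in `[e n, u]) (dens s)%:E)%E @[n --> \oo] --> (G u)%:E.
  under eq_fun do rewrite part.
  apply: cvg_EFin; first by near=> n.
  by rewrite -[X in _ --> X]subr0; apply: cvgB => //; exact: cvg_cst.
have lim2 : (\int[leb]_(s in `[e n, u]) (dens s)%:E)%E @[n --> \oo] -->
    (\int[leb]_(s in `[0%R, u]) (dens s)%:E)%E.
  rewrite -(integral_itv_obnd_cbnd (mdens _)).
  have -> : `]0%R, u]%classic = \bigcup_n (`[e n, u]%classic : set R).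
    apply/seteqP; split => s /=; rewrite ?in_itv/=.
      move=> /andP[s0 su]; exists (Num.truncn (u / s)) => //=; rewrite in_itv/= su andbT.
      rewrite /e ler_pdivrMr// -ler_pdivrMl// mulrC ltW//.
      apply: lt_trans (Num.Theory.truncnS_gt _) _; by rewrite ltr_nat.
    by move=> [n _] /=; rewrite in_itv/= => /andP[es ->]; rewrite (lt_le_trans (e0 n)).
  apply: ge0_nondecreasing_set_cvg_integral => //.
  - move=> m n mn; apply/subsetPset => s /=; rewrite !in_itv/= => /andP[es ->]; rewrite andbT.
    apply: le_trans es; rewrite ler_pM2l// lef_pV2 ?posrE// ler_nat.
    by rewrite !ltnS.
  - by move=> n; exact: mdens.
  - by move=> n s _; rewrite lee_fin.
by rewrite /Rintegral (cvg_unique _ lim2 lim1).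
Unshelve. all: by end_near. Qed.

(** Time 1 is [u = e^-1]. Both sides evaluate [stabP] at [theta^(-alpha)], since
    [v / (1 - v) = 1 / theta] for [v = 1 / (1 + theta)]; the constants agree by
    [stabC_reflection]. *)
Lemma stabPhi_Asl : stabPhi alpha theta (expR (-1)) = Asl alpha (1 / (1 + theta)).
Proof.
have t1 : 0 < 1 + theta by rewrite addr_gt0.
rewrite /Asl integral_arcsine; last first.
  by rewrite divr_gt0//= ltr_pdivrMr// mul1r ltrDl.
have -> : 1 / (1 + theta) / (1 - 1 / (1 + theta)) = theta^-1.
  have -> : 1 - 1 / (1 + theta) = theta / (1 + theta) by field; rewrite gt_eqF.
  by field; rewrite !gt_eqF.
rewrite /stabPhi expRK opprK mul1r; set S := stabP _ _.
have C0 : stabC alpha 0 != 0 by rewrite gt_eqF// stabC_gt0.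
have pi0 : pi != 0 :> R by rewrite gt_eqF// pi_gt0.
have H := stabC_reflection alpha01.
apply: (mulIf C0); rewrite divfK// [RHS](_ : _ =
  sin (alpha * pi) * stabC alpha 0 * S / (alpha * pi)).
  by rewrite H mulrAC mulfV ?mul1r// mulf_neq0// gt_eqF.
by clear H; move: (sin _) => z; move: (pi) pi0 => c c0; field; rewrite c0 gt_eqF.
Qed.

End Arcsine.

(** * Deterministic errors for the lazy walk run for [n^2] steps *)

Section MixingRates.
Variable R : realType.

Definition lazy_error n : R := 2 ^+ n * (1 - n%:R^-1) ^+ (n ^ 2).

Definition green_error n : R := 2 ^- n * ((n ^ 2)%:R / 2) + 3 / Num.sqrt n%:R.

Lemma lazy_error_ge0 n : 0 <= lazy_error n.+1.
Proof.
rewrite mulr_ge0 ?exprn_ge0// subr_ge0 invf_le1 ?ltr0n//.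
by rewrite ler1n.
Qed.

Lemma lazy_error_cvg : lazy_error n.+1 @[n --> \oo] --> 0.
Proof.
pose q : R := 2 * expR (-1).
have q0 : 0 <= q by rewrite mulr_ge0 ?expR_ge0.
have q1 : q < 1.
  by rewrite /q expRN ltr_pdivrMr ?expR_gt0// mul1r expR_gt1Dx// oner_neq0.
have qc : q ^+ n.+1 @[n --> \oo] --> 0.
  rewrite (cvg_shiftS (fun n => q ^+ n)); apply: cvg_expr.
  by rewrite ger0_norm.
apply: (squeeze_cvgr _ (cvg_cst 0) qc); near=> n.
rewrite lazy_error_ge0/= exprMn; apply: ler_wpM2l; first by rewrite exprn_ge0.
have n0 : 0 < n.+1%:R :> R by rewrite ltr0n.
rewrite expnS expn1 exprM; apply: lerXn2r; rewrite ?nnegrE ?expR_ge0//.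
  by rewrite exprn_ge0// subr_ge0 invf_le1// ler1n.
have -> : expR (-1) = expR (- n.+1%:R^-1) ^+ n.+1 :> R.
  by rewrite -expRM_natr mulNr mulVf// gt_eqF.
apply: lerXn2r; rewrite ?nnegrE ?expR_ge0 ?expR_ge1Dx//.
by rewrite subr_ge0 invf_le1// ler1n.
Unshelve. all: by end_near. Qed.

Lemma green_error_ge0 n : 0 <= green_error n.
Proof. by rewrite addr_ge0// divr_ge0// ?sqrtr_ge0. Qed.

Lemma green_error_cvg : green_error n.+1 @[n --> \oo] --> 0.
Proof.
have l2 : 0 < ln (2 : R) by rewrite ln_gt0// ltr1n.
(* The cubic term of the exponential gives [2^n >= (n ln 2)^3 / 6], whence
   [2^-n n^2 / 2 <= C / n]. *)
pose C : R := 3 / ln 2 ^+ 3.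
have C0 : 0 < C by rewrite divr_gt0// exprn_gt0.
apply/cvgr0Pnorm_le => e e0; near=> n.
have n0 : 0 < n.+1%:R :> R by rewrite ltr0n.
rewrite ger0_norm ?green_error_ge0// [leRHS]splitr; apply: lerD.
  apply: (@le_trans _ _ (C / n.+1%:R)); last first.
    rewrite ler_pdivrMr// mulrC -ler_pdivrMr ?divr_gt0//.
    rewrite (@le_trans _ _ n%:R) ?ler_nat//.
    by near: n; exact: nbhs_infty_ger.
  have := @expR_ge1Dxn R (ln 2 * n.+1%:R) 2 (mulr_ge0 (ltW l2) (ltW n0)).
  rewrite expRM_natr lnK ?posrE// (_ : 3`!%:R = 6 :> R)// exprMn.
  move: (2 ^+ n.+1) (exprn_gt0 n.+1 (ltr0n R 2)) => t t0 h.
  rewrite natrX mulrC ler_pdivrMr// /C; move: n.+1%:R n0 h => m m0 h.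
  have h' : ln 2 ^+ 3 * m ^+ 3 <= 6 * t by move: h; set X := ln 2 ^+ 3 * _; lra.
  move: (ln 2) l2 h' => l l2 h'.
  have -> : 3 / l ^+ 3 / m * t = 6 * t / (2 * (l ^+ 3 * m)).
    by field; rewrite !gt_eqF.
  rewrite ler_pdivlMr ?mulr_gt0 ?exprn_gt0//; apply: le_trans h'.
  by rewrite le_eqVlt; apply/orP; left; apply/eqP; field.
have s0 : 0 < Num.sqrt n.+1%:R :> R by rewrite sqrtr_gt0.
rewrite ler_pdivrMr// -ler_pdivrMl ?divr_gt0//.
rewrite -[X in X <= _]ger0_norm ?mulr_ge0 ?invr_ge0 ?divr_ge0 ?(ltW e0)// -sqrtr_sqr.
rewrite ler_sqrt// (@le_trans _ _ n%:R) ?ler_nat//.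
by near: n; exact: nbhs_infty_ger.
Unshelve. all: by end_near. Qed.

End MixingRates.

(** * The limit for a deterministic sequence of good environments *)

Section TrapLimit.
Variables (R : realType) (alpha theta : R).
Hypothesis alpha01 : 0 < alpha < 1.
Hypothesis theta0 : 0 < theta.
Variable V : forall n, hcube n.+1 -> R.
Hypothesis V_gt0 : forall n (x : hcube n.+1), 0 < V x.
Local Notation a n := (trap_kill (@V n)).
Local Notation A k n := (\sum_y a n k y).
Local Notation x0 n := (hc_ones n.+1).

Definition trap_offdiag k n : R :=
  \sum_(z : hcube n.+1) \sum_(y : hcube n.+1) \sum_(y' | y' != y)
    (green1 R (n.+1 ^ 2) z y * green1 R (n.+1 ^ 2) z y') * (a n k y * a n k y').

Hypothesis start_cvg : forall k, a n k (x0 n) @[n --> \oo] --> 0.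
Hypothesis mass_cvg : forall k, (A k n)^-1 @[n --> \oo] --> 0.
Hypothesis offdiag_cvg : forall k, trap_offdiag k n @[n --> \oo] --> 0.
Hypothesis ratio_cvg : forall k,
  (\sum_y a n k y * expR (- theta * V y)) / A k n @[n --> \oo] -->
  stabC alpha (theta * k.+2%:R) / stabC alpha 0.

Let sigma k n : R := green_error R n.+1 + Num.sqrt (trap_offdiag k n).

Let sigma_cvg k : sigma k n @[n --> \oo] --> 0.
Proof.
rewrite -[X in _ --> X](addr0 0); apply: cvgD; first exact: green_error_cvg.
rewrite -(sqrtr0 R).
exact: (continuous_cvg _ (@sqrt_continuous R 0) (offdiag_cvg k)).
Qed.

(** Write [S] for the sum and square it. Diagonal terms are at most [e] times the terms of [S],
    because the Green entries are at most [e] and [a <= 1]; the others are part of [trap_offdiag].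
    From [S^2 <= e S + O] follows [S <= e + sqrt O]. *)
Let sigmaP k n (z : hcube n.+1) :
  \sum_y green1 R (n.+1 ^ 2) z y * a n k y <= sigma k n.
Proof.
set N := (n.+1 ^ 2)%N; set S := \sum_y _; set e := green_error R n.+1.
pose t y := green1 R N z y * a n k y.
have t0 y : 0 <= t y by rewrite mulr_ge0 ?green1_ge0 ?trap_kill_ge0.
have e0 : 0 <= e by exact: green_error_ge0.
have off0 z' : 0 <= \sum_(y : hcube n.+1) \sum_(y' | y' != y)
    (green1 R N z' y * green1 R N z' y') * (a n k y * a n k y').
  apply: sumr_ge0 => y _; apply: sumr_ge0 => y' _.
  by apply: mulr_ge0; apply: mulr_ge0; rewrite ?green1_ge0 ?trap_kill_ge0.
have O0 : 0 <= trap_offdiag k n by apply: sumr_ge0 => z' _; exact: off0.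
have SS : S * S <= e * S + trap_offdiag k n.
  apply: (@le_trans _ _ (e * S + \sum_(y : hcube n.+1) \sum_(y' | y' != y)
    (green1 R N z y * green1 R N z y') * (a n k y * a n k y'))); last first.
    by rewrite lerD2l [leRHS](bigD1 z)//= lerDl sumr_ge0.
  rewrite {1}/S mulr_suml mulr_sumr -big_split/=; apply: ler_sum => y _.
  rewrite mulr_sumr (bigD1 y)//=; apply: lerD.
    rewrite -/(t y) ler_wpM2r// -[leRHS]mulr1 ler_pM ?green1_ge0 ?trap_kill_ge0//.
      exact: green1_le.
    exact: trap_kill_le1.
  rewrite le_eqVlt; apply/orP; left; apply/eqP; apply: eq_bigr => y' _.
  by rewrite mulrACA.
rewrite leNgt; apply/negP; rewrite /sigma -/e => h.
have s0 := sqrtr_ge0 (trap_offdiag k n).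
have s2 := sqr_sqrtr O0.
move: (Num.sqrt _) s0 s2 h => s s0 s2 h.
by nra.
Qed.

Let lazyP n (z y : hcube n.+1) :
  `|kpow (@lazy_srw R n.+1) (n.+1 ^ 2) z y - 2 ^- n.+1| <= 2 ^- n.+1 * lazy_error R n.+1.
Proof. exact: kpow_lazy_uniform. Qed.

Let greenP n (z y : hcube n.+1) : green1 R (n.+1 ^ 2) z y <= green_error R n.+1.
Proof. exact: green1_le. Qed.

Let A_gt0 k n : 0 < A k n.
Proof.
rewrite (bigD1 (x0 n))//= ltr_pwDl ?trap_kill_gt0// sumr_ge0// => y _.
exact: trap_kill_ge0.
Qed.

Let D k n x := trap_mean (@V n) k x * A k n.

(** Once the lazy error is at most one half and [sigma] at most 1, [trap_mean_le] reads
    [D / 2 <= 2]. The bound is uniform in the starting point, as the return estimate requires. *)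
Let D_le k : \forall n \near \oo, forall x : hcube n.+1, 0 <= D k x <= 4.
Proof.
near=> n => x.
have d1 : lazy_error R n.+1 <= 2^-1.
  near: n; have /cvgr0Pnorm_le /(_ 2^-1) := @lazy_error_cvg R.
  rewrite invr_gt0 ltr0n => /(_ isT); apply: filterS => n; exact/le_trans/ler_norm.
have s1 : sigma k n <= 1.
  near: n; have /cvgr0Pnorm_le /(_ 1 ltr01) := sigma_cvg k.
  by apply: filterS => n; exact/le_trans/ler_norm.
have c0 : 0 <= trap_mean (@V n) k x by exact: trap_mean_ge0.
have := trap_mean_le (ltn0Sn n) (@V_gt0 n) (@lazyP n) (@sigmaP k n) x.
have D0 : 0 <= D k x by rewrite mulr_ge0// ltW.
rewrite -mulrA (mulrC (1 - _)) mulrA -/(D k x) D0 => h /=.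
have : D k x * (1 - lazy_error R n.+1) >= D k x * 2^-1 by rewrite ler_wpM2l//; lra.
lra.
Unshelve. all: by end_near. Qed.

Let err k n : R := D k (x0 n) * lazy_error R n.+1 + a n k (x0 n) + 2 * sigma k n.

Let err_cvg k : err k n @[n --> \oo] --> 0.
Proof.
rewrite -[X in _ --> X](addr0 0) -[X in _ --> X + _](addr0 0) -[X in _ --> _ + X](mulr0 2).
apply: cvgD; last by apply: cvgMl_tmp; exact: sigma_cvg.
apply: cvgD; last exact: start_cvg.
have c4 : 4 * lazy_error R n.+1 @[n --> \oo] --> 0.
  by rewrite -[X in _ --> X](mulr0 4); apply: cvgMl_tmp; exact: lazy_error_cvg.
apply: (squeeze_cvgr _ (cvg_cst 0) c4); near=> n.
have : forall x : hcube n.+1, 0 <= D k x <= 4 by near: n; exact: D_le.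
move=> /(_ (x0 n))/andP[D0 D4].
by rewrite mulr_ge0 ?lazy_error_ge0// ler_wpM2r// lazy_error_ge0.
Unshelve. all: by end_near. Qed.

Let estimate k n (f : hcube n.+1 -> R) : (forall y, 0 <= f y <= 1) ->
  `|k.+2%:R * \sum_y trap_resolvent (@V n) k (x0 n) y * f y -
    D k (x0 n) * ((\sum_y a n k y * f y) / A k n)| <= err k n.
Proof.
move=> f01.
have := trap_resolvent_estimate (ltn0Sn n) (@V_gt0 n) (@lazyP n) (@sigmaP k n) (x0 n) f01.
move=> h.
have -> : D k (x0 n) * ((\sum_y a n k y * f y) / A k n) =
    trap_mean (@V n) k (x0 n) * \sum_y a n k y * f y.
  by rewrite /D; field; rewrite gt_eqF.
by rewrite /err (_ : D k (x0 n) * _ = trap_mean (@V n) k (x0 n) * lazy_error R n.+1 * A k n)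
  // /D mulrAC.
Qed.

(** For [f = 1] the main estimate compares the total killing probability 1 with [D] itself; this
    determines the normalisation left open by [trap_mean]. *)
Let D_cvg k : D k (x0 n) @[n --> \oo] --> (1 : R).
Proof.
apply/cvgrPdist_le => e e0; near=> n.
have : err k n <= e.
  near: n; have /cvgr0Pnorm_le /(_ e e0) := err_cvg k.
  by apply: filterS => n; exact/le_trans/ler_norm.
apply: le_trans.
have /estimate : forall y : hcube n.+1, 0 <= (1 : R) <= 1 by move=> y; rewrite ler01 lexx.
move=> /(_ k); under eq_bigr do rewrite mulr1.
under [X in _ * (X / _)]eq_bigr do rewrite mulr1.
by rewrite trap_resolvent_sum// mulfV ?pnatr_eq0// mulfV ?gt_eqF// mulr1.
Unshelve. all: by end_near. Qed.

(** The estimate with [f y = exp (- theta * V y)] shows that [mu] times the moment is [D] times the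
    ratio of site sums, up to [err]; [int01_stabPhi] recognises the limit. *)
Let moment_cvg k : int01 (fun u => u ^+ k.+1 * trap_stay (@V n) theta (x0 n) (- ln u))
  @[n --> \oo] --> int01 (fun u => u ^+ k.+1 * stabPhi alpha theta u).
Proof.
have k0 : k.+2%:R != 0 :> R by rewrite pnatr_eq0.
have f01 n (y : hcube n.+1) : 0 <= expR (- theta * V y) <= 1.
  rewrite expR_ge0 -expR0 ler_expR mulNr oppr_le0 mulr_ge0//; exact: ltW.
suff : k.+2%:R * \sum_y trap_resolvent (@V n) k (x0 n) y * expR (- theta * V y)
    @[n --> \oo] --> stabC alpha (theta * k.+2%:R) / stabC alpha 0.
  move=> h; rewrite -[X in _ --> X](mulKf k0) int01_stabPhi//.
  under eq_fun do rewrite trap_stay_resolvent// -[\sum_y _](mulKf k0).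
  exact: cvgMl_tmp.
have DR : D k (x0 n) * ((\sum_y a n k y * expR (- theta * V y)) / A k n)
    @[n --> \oo] --> stabC alpha (theta * k.+2%:R) / stabC alpha 0.
  rewrite -[X in _ --> X]mul1r; apply: cvgM; first exact: D_cvg.
  exact: ratio_cvg.
rewrite -[X in _ --> X]addr0 (_ : (fun n => _) = fun n =>
    D k (x0 n) * ((\sum_y a n k y * expR (- theta * V y)) / A k n) +
    (k.+2%:R * \sum_y trap_resolvent (@V n) k (x0 n) y * expR (- theta * V y) -
     D k (x0 n) * ((\sum_y a n k y * expR (- theta * V y)) / A k n))); last first.
  by apply/funext => n; rewrite addrC subrK.
apply: cvgD; first exact: DR.
apply: norm_cvg0; apply: (squeeze_cvgr _ (cvg_cst 0) (err_cvg k)).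
near=> n; rewrite normr_ge0/=.
exact: (estimate k (f01 n)).
Unshelve. all: by end_near. Qed.

Let stay_cvg : trap_stay (@V n) theta (x0 n) 1 @[n --> \oo] -->
  Asl alpha (1 / (1 + theta)).
Proof.
have l1 : - ln (expR (-1)) = 1 :> R by rewrite expRK opprK.
rewrite -stabPhi_Asl//.
suff : trap_stay (@V n) theta (x0 n) (- ln (expR (-1))) @[n --> \oo] -->
    stabPhi alpha theta (expR (-1)) by rewrite l1.
have nl (u : R) : 0 <= u <= 1 -> 0 <= - ln u.
  by move=> /andP[_ u1]; rewrite oppr_ge0 ln_le0.
have u01 : 0 < expR (-1 : R) < 1.
  by rewrite expR_gt0 expR_lt1 oppr_lt0 ltr01.
(* For [e^-1 / 2 <= u <= v], [ln v - ln u <= (v - u) / u <= 2 (v - u) / e^-1]; dividing by [theta]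
   as in [trap_stay_quasimono] gives the constant [C]. *)
apply: (moment_inversion (H_ := fun n u => trap_stay (@V n) theta (x0 n) (- ln u))
  (C := 2 / (expR (-1) * theta))).
- move=> n; apply: (bdd_meas_log (C := 1)); first exact: continuous_trap_stay.
  move=> t t0; have /andP[h0 h1] := trap_stay_01 (ltn0Sn n) (@V_gt0 n) (x0 n) theta0 t0.
  by rewrite ger0_norm.
- exact: bdd_meas_stabPhi.
- near=> n => u /nl t0.
  have /andP[h0 h1] := trap_stay_01 (ltn0Sn n) (@V_gt0 n) (x0 n) theta0 t0.
  by rewrite ger0_norm.
- by move=> u _; have /andP[h0 h1] := stabPhi_01 theta alpha01 u; rewrite ger0_norm.
- exact: moment_cvg.
- exact: u01.
- by rewrite divr_gt0// mulr_gt0// expR_gt0.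
- near=> n => u v u1 uv v1; set b := expR (-1) in u1 *.
  have b0 : 0 < b by exact: expR_gt0.
  have u0 : 0 < u by rewrite (lt_le_trans _ u1)// divr_gt0.
  have v0 : 0 < v by exact: lt_le_trans uv.
  apply: le_trans (trap_stay_quasimono (ltn0Sn n) (@V_gt0 n) (x0 n) theta0 (t := - ln u) _ _) _.
  + by apply: nl; rewrite v1 ltW.
  + by rewrite lerN2 ler_ln.
  rewrite lerD2l opprK addrC -lnV ?posrE// -lnM ?posrE ?invr_gt0//.
  have vu : ln (v / u) <= v / u - 1.
    have := @le_ln1Dx R (v / u - 1); rewrite [1 + _]addrC subrK; apply.
    by rewrite ltrBrDl subrr divr_gt0.
  rewrite ler_pdivrMr// (le_trans vu)//.
  have -> : 2 / (b * theta) * (v - u) * theta = (v - u) / (b / 2).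
    by field; rewrite !gt_eqF.
  have -> : v / u - 1 = (v - u) / u by rewrite mulrBl divff// gt_eqF.
  by rewrite ler_wpM2l ?subr_ge0// lef_pV2 ?posrE ?divr_gt0.
- exact: continuous_stabPhi.
Unshelve. all: by end_near. Qed.
(** One resolvent, at [k = 0], suffices: the returns are bounded through [trap_mean <= 4 / A], which
    tends to 0 uniformly in [x], and [trap_return_le] converts this to the fixed time [theta]. *)
Let return_cvg (e : R) : 0 < e -> \forall n \near \oo, forall x : hcube n.+1,
  ctmc_kernel (trap_gen (@V n)) theta x x - expR (- V x * theta) <= e.
Proof.
move=> e0.
(* As [eta <= 1/2], the window loss [eta / (1 - eta)] is at most [2 eta <= e / 2]; the integral term
   takes the other half of [e]. *)
pose eta := Num.min 2^-1 (e / 4).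
have eta0 : 0 < eta by rewrite lt_min; apply/andP; split; lra.
have eta1 : eta <= 2^-1 by rewrite ge_min lexx.
have eta4 : eta <= e / 4 by rewrite ge_min lexx orbT.
pose K := expR (- theta) * (expR (- (theta * (1 - eta))) - expR (- theta)).
have K0 : 0 < K by rewrite mulr_gt0 ?expR_gt0// subr_gt0 ltr_expR;
  have := mulr_gt0 theta0 eta0; lra.
pose r n := 4 * (A 0 n)^-1 * (1 + lazy_error R n.+1) + green_error R n.+1.
have r_cvg : r n @[n --> \oo] --> 0.
  rewrite -[X in _ --> X](addr0 0); apply: cvgD; last exact: green_error_cvg.
  rewrite [X in _ --> X](_ : 0 = 4 * 0 * (1 + 0)); last by rewrite mulr0 mul0r.
  apply: cvgM.
    by apply: cvgMl_tmp; exact: mass_cvg.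
  by apply: cvgD; [exact: cvg_cst|exact: lazy_error_cvg].
near=> n => x.
have rK : r n <= e * K.
  near: n; have /cvgr0Pnorm_le /(_ (e * K) (mulr_gt0 e0 K0)) := r_cvg.
  by apply: filterS => n; exact/le_trans/ler_norm.
have : forall x : hcube n.+1, 0 <= D 0 x <= 4 by near: n; exact: D_le.
move=> /(_ x)/andP[_ D4].
have eta01 : 0 < eta < 1 by rewrite eta0/=; lra.
apply: le_trans (trap_return_le (ltn0Sn n) (@V_gt0 n) x theta0 eta01) _.
have := trap_return_resolvent (ltn0Sn n) (@V_gt0 n) 0 (lazy_error_ge0 R n) (@lazyP n)
  (@greenP n) x.
set I := int01 _ => h.
have c4 : trap_mean (@V n) 0 x <= 4 * (A 0 n)^-1 by rewrite ler_pdivlMr.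
have hr : 2 * I <= r n.
  apply: le_trans h _; rewrite lerD2r ler_wpM2r// addr_ge0// lazy_error_ge0//.
have IK : I / K <= e / 2 by rewrite ler_pdivrMr//; lra.
have : eta / (1 - eta) <= e / 2.
  by rewrite ler_pdivrMr; [have := mulr_ge0 (ltW e0) (ltW eta0); nra|lra].
rewrite -/K; lra.
Unshelve. all: by end_near. Qed.

Lemma trap_aging : \sum_y ctmc_kernel (trap_gen (@V n)) 1 (x0 n) y *
    ctmc_kernel (trap_gen (@V n)) theta y y @[n --> \oo] --> Asl alpha (1 / (1 + theta)).
Proof.
apply/cvgrPdist_le => e e0; have e20 : 0 < e / 2 by rewrite divr_gt0.
near=> n.
have h1 : `|Asl alpha (1 / (1 + theta)) - trap_stay (@V n) theta (x0 n) 1| <= e / 2.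
  by near: n; have /cvgrPdist_le /(_ _ e20) := stay_cvg.
have h2 : forall x : hcube n.+1,
    ctmc_kernel (trap_gen (@V n)) theta x x - expR (- V x * theta) <= e / 2.
  by near: n; exact: return_cvg.
have /andP[h3 h4] := trap_same_stay (ltn0Sn n) (@V_gt0 n) (x0 n) theta0 h2.
move: h1; rewrite !ler_norml => /andP[h5 h6]; apply/andP; split; lra.
Unshelve. all: by end_near. Qed.

End TrapLimit.

(** * The Bouchaud generator in units of the age, and conclusion *)

Lemma trap_gen_btm (R : realType) (n : nat) (tau : hcube n.+1 -> R) (c : R) x y :
  trap_gen (fun x => c * (tau x)^-1) x y = c * btm_gen tau x y.
Proof.
rewrite /trap_gen /btm_gen /delta; case: eqVneq => [<-|xy].
  rewrite {1}/srw hc_adjxx sub0r mulrN1 mulrN; congr (- _).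
  congr (_ * _).
  rewrite (eq_bigr (fun z => srw R x z * (tau x)^-1)) => [|z xz]; last first.
    by rewrite /btm_rate /srw xz.
  rewrite -mulr_suml (_ : \sum_(z | _) _ = 1) ?mul1r//.
  rewrite -(srw_stochastic R x (ltn0Sn n)) [RHS](bigID (fun z => hc_adj x z))/=.
  by rewrite [X in _ + X]big1 ?addr0// => z /negPf xz; rewrite /srw xz.
rewrite subr0 -mulrA; congr (_ * _); rewrite /srw /btm_rate.
by case: ifP => _; rewrite ?mulr0// mulrC.
Qed.

(** Speeding the generator up by [t] turns the time [t] and the lag [s * t] into 1 and [s]. *)
Lemma ctmc_same_prob_scale (R : realType) (U : finType) (Q : U -> U -> R) x (t s : R) :
  ctmc_same_prob Q x t ((1 + s) * t) =
  \sum_y ctmc_kernel (fun x y => t * Q x y) 1 x y *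
         ctmc_kernel (fun x y => t * Q x y) s y y.
Proof.
apply: eq_bigr => y _; rewrite !ctmc_kernel_scale mulr1 (mulrC t).
by rewrite mulrDl mul1r addrC addKr.
Qed.

Theorem theoremt (R : realType) (d : measure_display) (T : measurableType d)
  (P : probability T R) (E : forall n : nat, hcube n -> T -> R)
  (alpha beta : R) :
  0 < alpha < 1 -> 0 < beta ->
  3 / 4 < alpha ^+ 2 * beta ^+ 2 / (2 * ln 2) < 1 ->
  (forall n (x : hcube n), measurable_fun setT (E n x)) ->
  (forall n, (0 < n)%N -> mutually_independent P (E n)) ->
  (forall n (x : hcube n) (u : R), (0 < n)%N -> 0 <= u ->
     P [set w | u <= - E n x w / Num.sqrt (n%:R)] = (expR (- (u ^+ 2) / 2))%:E) ->
  forall theta : R, 0 < theta ->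
  {ae P, forall w : T,
     (fun n : nat =>
        ctmc_same_prob
          (btm_gen (fun x : hcube n => expR (- beta * E n x w)))
          (hc_ones n)
          (expR (alpha * beta ^+ 2 * n%:R))
          ((1 + theta) * expR (alpha * beta ^+ 2 * n%:R)))
     @ \oo --> Asl alpha (1 / (1 + theta))}.
Proof.
move=> alpha01 beta0 /andP[kgt klt] mE indepE tailE theta theta0.
have l2 : 0 < ln (2 : R) by rewrite ln_gt0// ltr1n.
have kE : alpha ^+ 2 * beta ^+ 2 / (2 * ln 2) = env_kappa alpha beta / ln 2.
  by rewrite /env_kappa invfM mulrA.
have kappa_lt : env_kappa alpha beta < ln 2.
  by move: klt; rewrite kE ltr_pdivrMr// mul1r.
have kappa_gt : ln 2 < 2 * env_kappa alpha beta.
  by move: kgt; rewrite kE ltr_pdivlMr//; lra.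
have lln := env_lln alpha01 beta0 mE indepE tailE kappa_lt.
(* The full-measure event must serve all moments at once; countably many [k] allow the intersection.
   [H1] handles the denominators and [H2] the numerators of the ratios. *)
have /ae_foralln H1 := fun k => lln 0 k (lexx 0).
have /ae_foralln H2 := fun k =>
  lln (theta * k.+2%:R) k (mulr_ge0 (ltW theta0) (ler0n R k.+2)).
have /ae_foralln H3 := fun k => env_start alpha01 beta0 mE tailE kappa_gt k.
have /ae_foralln H4 := fun k => env_offdiag alpha01 beta0 mE indepE tailE kappa_gt k.
apply: filterS (filterI (filterI H1 H2) (filterI H3 H4)) => w [[h1 h2] [h3 h4]].
pose V n (x : hcube n.+1) := env_rate E alpha beta x w.
pose F n := ctmc_same_prob (btm_gen (fun x : hcube n => expR (- beta * E n x w)))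
  (hc_ones n) (expR (alpha * beta ^+ 2 * n%:R)) ((1 + theta) * expR (alpha * beta ^+ 2 * n%:R)).
(* The law of the environment is prescribed for [n > 0] only; dropping one index does not change the
   limit. *)
suff : F n.+1 @[n --> \oo] --> Asl alpha (1 / (1 + theta)) by rewrite (cvg_shiftS F).
have FE n : F n.+1 = \sum_y ctmc_kernel (trap_gen (@V n)) 1 (hc_ones n.+1) y *
    ctmc_kernel (trap_gen (@V n)) theta y y.
  rewrite /F ctmc_same_prob_scale; apply: eq_bigr => y _.
  have QE (x z : hcube n.+1) : expR (alpha * beta ^+ 2 * n.+1%:R) *
      btm_gen (fun x => expR (- beta * E n.+1 x w)) x z = trap_gen (@V n) x z.
    rewrite -trap_gen_btm; congr (trap_gen _ x z); apply/funext => x'.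
    by rewrite /V /env_rate expRD mulNr expRN invrK.
  by congr (_ * _); exact: eq_ctmc_kernel QE.
rewrite (eq_cvg _ _ FE).
apply: (@trap_aging R alpha theta alpha01 theta0 V (fun n x => env_rate_gt0 _ _ _ _ _)) => k.
- pose S n := env_chi E alpha beta 0 k (hc_ones n) w.
  have SE n : trap_kill (@V n) k (hc_ones n.+1) = S n.+1 by exact: trap_kill_env.
  rewrite (eq_cvg _ _ SE) (cvg_shiftS S); exact: h3.
- by apply: (env_mass_cvg alpha01 beta0 mE tailE kappa_lt); exact: h1.
- pose O n := \sum_(z : hcube n) \sum_(y : hcube n) \sum_(y' | y' != y)
    (green1 R (n ^ 2) z y * green1 R (n ^ 2) z y') *
    (env_chi E alpha beta 0 k y w * env_chi E alpha beta 0 k y' w).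
  have OE n : trap_offdiag V k n = O n.+1.
    apply: eq_bigr => z _; apply: eq_bigr => y _; apply: eq_bigr => y' _.
    by rewrite !trap_kill_env.
  rewrite (eq_cvg _ _ OE) (cvg_shiftS O); exact: h4.
- by apply: (env_ratio_cvg alpha01 beta0 mE tailE theta0); [exact: h1|exact: h2].
Qed.
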